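(* Consider the accelerated random-SVRG algorithm (see context). Assume that $f$ is $\mu$-strongly convex with $\mu>0$, let $\eta=\min\left(\frac1{3L_Q},\frac1{15\mu n}\right)$, and target an accuracy $\varepsilon$ smaller than $B=3\rho_Q\tilde\sigma^2\sqrt{\eta/(\mu n)}$. First, use the constant step size $\eta_k=\eta$ with $\gamma_0=\mu$ until $\mathbb E[F(x_k)-F^\star]\le B$. Then, restart the optimization procedure (from the point obtained, with $\gamma_0=\mu$) with decreasing step sizes $\eta_k=\min\left(\eta,\frac{12n}{5\mu(k+2)^2}\right)$, generating a new sequence of iterates. The resulting number of gradient evaluations to achieve $\mathbb E[F(x_k)-F^\star]\le\varepsilon$ (with $x_k$ the iterates of the new sequence) is upper bounded by $$O\left(\left(n+\sqrt{\frac{nL_Q}{\mu}}\right)\log\left(\frac{F(x_0)-F^\star}{\varepsilon}\right)\right)+O\left(\frac{\rho_Q\tilde\sigma^2}{\mu\varepsilon}\right).$$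
   Context: Problem: minimize $F=f+\psi$ on $\mathbb R^p$; $\psi$ is convex lower semicontinuous (possibly extended-valued); $f=\frac1n\sum_{i=1}^nf_i$ is $\mu$-strongly convex, each $f_i$ is convex and $L_i$-smooth (differentiable with $L_i$-Lipschitz gradient) with $L_i\ge\mu$; $x^\star$ is a minimizer of $F$, $F^\star=F(x^\star)$. $\mathrm{Prox}_{\eta\psi}[u]=\arg\min_x\{\eta\psi(x)+\frac12\|x-u\|^2\}$. Sampling and noise: $Q=\{q_1,\dots,q_n\}$ is a sampling distribution on $\{1,\dots,n\}$; $L_Q=\max_iL_i/(q_in)$, $\rho_Q=1/(n\min_iq_i)$. $\tilde\nabla f_i(x)$ denotes $\nabla f_i(x)$ corrupted by a zero-mean random perturbation with $\mathbb E\|\tilde\nabla f_i(x)-\nabla f_i(x)\|^2\le\tilde\sigma_i^2$ for all $x$; $\tilde\nabla f(x)=\frac1n\sum_i\tilde\nabla f_i(x)$; $\tilde\sigma^2=\frac1n\sum_{i=1}^n\frac1{q_in}\tilde\sigma_i^2$. Accelerated random-SVRG algorithm: input $x_0$, step sizes $\eta_k>0$, $\gamma_0\ge\mu$. Initialize $\tilde x_0=v_0=x_0$, $\bar z_0=\tilde\nabla f(x_0)$. For $k\ge1$: 1. find $(\delta_k,\gamma_k)$ such that $\gamma_k=(1-\delta_k)\gamma_{k-1}+\delta_k\mu$ and $\delta_k=\sqrt{\frac{5\eta_k\gamma_k}{3n}}$; 2. $y_{k-1}=\theta_kv_{k-1}+(1-\theta_k)\tilde x_{k-1}$ with $\theta_k=\frac{3n\delta_k-5\mu\eta_k}{3-5\mu\eta_k}$;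 3. sample $i_k$ according to $Q$ and set $g_k=\frac1{q_{i_k}n}\big(\tilde\nabla f_{i_k}(y_{k-1})-\tilde\nabla f_{i_k}(\tilde x_{k-1})\big)+\bar z_{k-1}$, with perturbations drawn at iteration $k$ for the two gradients in the parentheses; 4. $x_k=\mathrm{Prox}_{\eta_k\psi}[y_{k-1}-\eta_kg_k]$; 5. $v_k=\big(1-\frac{\mu\delta_k}{\gamma_k}\big)v_{k-1}+\frac{\mu\delta_k}{\gamma_k}y_{k-1}+\frac{\delta_k}{\gamma_k\eta_k}(x_k-y_{k-1})$; 6. with probability $1/n$ set $\tilde x_k=x_k$, $\bar z_k=\tilde\nabla f(\tilde x_k)$; otherwise $\tilde x_k=\tilde x_{k-1}$, $\bar z_k=\bar z_{k-1}$. The algorithm outputs its last iterate $x_K$. As in the general accelerated scheme of which it is an instance, $g_k$ is an unbiased estimate, $\mathbb E[g_k\mid\mathcal F_{k-1}]=\nabla f(y_{k-1})$, with $\mathcal F_{k-1}$ representing the information up to iteration $k-1$. *)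

(* Defs.v *)
From HB Require Import structures.
From mathcomp Require Import all_boot all_order all_algebra.
From mathcomp Require Import all_classical all_reals all_analysis.

Set Implicit Arguments.
Unset Strict Implicit.
Unset Printing Implicit Defensive.

Import Order.TTheory GRing.Theory Num.Theory.
Import numFieldNormedType.Exports.

Local Open Scope classical_set_scope.
Local Open Scope ring_scope.

(* The norm [`|_|] that MathComp-Analysis puts on row vectors is the sup norm.
   It is only used below through the topology and [differentiable]; every
   metric quantity uses the Euclidean norm [enorm]. *)

Section Euclidean.
Context {R : realType} {p : nat}.
Implicit Types (u x y : 'rV[R]_p) (f : 'rV[R]_p -> R) (psi : 'rV[R]_p -> \bar R).

Definition sqnorm u : R := \sum_(c < p) u 0 c ^+ 2.

Definition enorm u : R := Num.sqrt (sqnorm u).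

(* Meaningful when [f] is differentiable at [x]. *)
Definition grad f x : 'rV[R]_p := \row_(c < p) 'D_(delta_mx 0 c) f x.

Definition smooth (L : R) f : Prop :=
  (forall x, differentiable f x) /\
  (forall x y, enorm (grad f x - grad f y) <= L * enorm (x - y)).

Definition strongly_convex (mu : R) f : Prop :=
  forall x y (t : R), 0 <= t <= 1 ->
    f (t *: x + (1 - t) *: y)
      <= t * f x + (1 - t) * f y - mu / 2 * t * (1 - t) * sqnorm (x - y).

Definition econvex psi : Prop :=
  forall x y (t : R), 0 < t < 1 ->
    (psi (t *: x + (1 - t) *: y)%R <= t%:E * psi x + (1 - t)%:E * psi y)%E.

(* [x] is the minimizer defining [Prox_{eta psi}[u]], unique for a proper convex
   lower semicontinuous [psi]. *)
Definition is_prox (eta : R) psi u x : Prop :=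
  forall y, (eta%:E * psi x + (2^-1 * sqnorm (x - u))%:E
             <= eta%:E * psi y + (2^-1 * sqnorm (y - u))%:E)%E.

End Euclidean.

Section Problem.
Context {R : realType} {p n : nat}.

Definition average (fi : 'I_n -> 'rV[R]_p -> R) (x : 'rV[R]_p) : R :=
  n%:R^-1 * \sum_(i < n) fi i x.

Definition objective (fi : 'I_n -> 'rV[R]_p -> R) (psi : 'rV[R]_p -> \bar R)
  (x : 'rV[R]_p) : \bar R := ((average fi x)%:E + psi x)%E.

(* The default value 0 is harmless: the [L i / (q i * n)] are positive. *)
Definition L_Q (L q : 'I_n -> R) : R := \big[Num.max/0]_(i < n) (L i / (q i * n%:R)).

(* The default value 1 is harmless: the [q i] are probabilities. *)
Definition rho_Q (q : 'I_n -> R) : R := (n%:R * \big[Num.min/1]_(i < n) q i)^-1.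

(* [sd i ^+ 2] bounds the variance of the perturbation of the i-th gradient. *)
Definition noise_level (q sd : 'I_n -> R) : R :=
  n%:R^-1 * \sum_(i < n) (q i * n%:R)^-1 * sd i ^+ 2.

End Problem.

Section Conditioning.
Context {d : measure_display} {T : measurableType d} {R : realType}.
Variable P : probability T R.

Definition sigma_gen (S : set (T -> R)) : set_system T :=
  <<s \bigcup_(X in S) preimage_set_system setT X measurable >>.

Definition coords {p : nat} (X : T -> 'rV[R]_p) : set (T -> R) :=
  range (fun (c : 'I_p) (w : T) => X w 0 c).

Definition random_vector {p : nat} (X : T -> 'rV[R]_p) : Prop :=
  forall Y, coords X Y -> measurable_fun setT Y.

(* [Y] is a version of [E[X | G]]. *)
Definition is_cond_exp (G : set_system T) (X Y : T -> R) : Prop :=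
  [/\ P.-integrable setT (EFin \o X), P.-integrable setT (EFin \o Y),
      preimage_set_system setT Y measurable `<=` G &
      forall A, G A -> (\int[P]_(w in A) (X w)%:E = \int[P]_(w in A) (Y w)%:E)%E].

Definition is_cond_exp_vec {p : nat} (G : set_system T) (X Y : T -> 'rV[R]_p) : Prop :=
  forall c : 'I_p, is_cond_exp G (fun w => X w 0 c) (fun w => Y w 0 c).

(* [W] is a fresh evaluation of the perturbed gradient of [fi (I w)] at the
   random point [X w]: given the past [G], the perturbation has mean zero and
   second moment at most [sd (I w) ^+ 2].  In the uses below [I] and [X] are
   determined by [G]. *)
Definition noisy_gradient {p n : nat} (fi : 'I_n -> 'rV[R]_p -> R) (sd : 'I_n -> R)
    (G : set_system T) (I : T -> 'I_n) (X W : T -> 'rV[R]_p) : Prop :=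
  let zeta w := W w - grad (fi (I w)) (X w) in
  is_cond_exp_vec G zeta (fun=> 0) /\
  (forall A, G A ->
    (\int[P]_(w in A) (sqnorm (zeta w))%:E <= \int[P]_(w in A) (sd (I w) ^+ 2)%:E)%E).

End Conditioning.

(* All the quantities produced by one execution.  In iteration [k >= 1],
   [idx k] is the sampled index, [draw_y k] and [draw_xt k] are the perturbed
   gradients of [f_(idx k)] at [y_(k-1)] and at [xt (k-1)], and [coin k] decides
   whether the anchor is refreshed.  The perturbed gradients averaged in
   [zb k] are [draw_anchor k i]; for [k >= 1] they are used only if [coin k]. *)
Record execution (T : Type) (R : realType) (p n : nat) := Execution {
  delta : nat -> R;
  gamma : nat -> R;
  iter_x : nat -> T -> 'rV[R]_p;
  iter_v : nat -> T -> 'rV[R]_p;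
  anchor : nat -> T -> 'rV[R]_p;
  zbar : nat -> T -> 'rV[R]_p;
  idx : nat -> T -> 'I_n;
  coin : nat -> T -> bool;
  draw_y : nat -> T -> 'rV[R]_p;
  draw_xt : nat -> T -> 'rV[R]_p;
  draw_anchor : nat -> 'I_n -> T -> 'rV[R]_p }.

Section Algorithm.
Context {d : measure_display} {T : measurableType d} {R : realType} {p n : nat}.
Variable P : probability T R.
Variables (fi : 'I_n -> 'rV[R]_p -> R) (psi : 'rV[R]_p -> \bar R) (mu : R).
Variables (q sd : 'I_n -> R) (eta : nat -> R) (gamma0 : R).
Implicit Types (e : execution T R p n) (k : nat).

Definition theta e k : R :=
  (3 * n%:R * delta e k - 5 * mu * eta k) / (3 - 5 * mu * eta k).

(* The point written y_k, which is the one used in iteration k + 1. *)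
Definition iter_y e k (w : T) : 'rV[R]_p :=
  theta e k.+1 *: iter_v e k w + (1 - theta e k.+1) *: anchor e k w.

(* [estimate e k] is g_(k+1). *)
Definition estimate e k (w : T) : 'rV[R]_p :=
  (q (idx e k.+1 w) * n%:R)^-1 *: (draw_y e k.+1 w - draw_xt e k.+1 w) + zbar e k w.

Definition anchor_gradient e k (w : T) : 'rV[R]_p :=
  n%:R^-1 *: \sum_(i < n) draw_anchor e k i w.

(* Everything drawn up to the end of iteration [k]. *)
Definition drawn e k : set (T -> R) :=
  coords (iter_x e 0) `|`
  (\bigcup_(j in [set j | (j <= k)%N]) \bigcup_(i in [set: 'I_n])
     coords (draw_anchor e j i)) `|`
  (\bigcup_(j in [set j | (1 <= j <= k)%N])
     ([set (fun w => (idx e j w)%:R); (fun w => (coin e j w)%:R)] `|`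
      coords (draw_y e j) `|` coords (draw_xt e j))).

(* The successive stages of iteration [k + 1]: after sampling the index, after
   the draw at [y_k], after the draw at [anchor e k], after tossing the coin. *)
Definition drawn_idx e k := drawn e k `|` [set (fun w => (idx e k.+1 w)%:R)].
Definition drawn_y e k := drawn_idx e k `|` coords (draw_y e k.+1).
Definition drawn_xt e k := drawn_y e k `|` coords (draw_xt e k.+1).
Definition drawn_coin e k := drawn_xt e k `|` [set (fun w => (coin e k.+1 w)%:R)].

(* The sigma-algebra F_k of unbiasedness, generated by the iterates up to
   iteration [k]; the noisy averages [zbar] are not included, since conditioning
   on [zbar e k] would force it to equal the exact gradient of the average.  As
   [iter_y e k] is measurable for it, by the tower property unbiasedness given
   any larger sigma-algebra implies unbiasedness given it. *)
Definition information e k : set_system T :=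
  sigma_gen (\bigcup_(j in [set j | (j <= k)%N])
    (coords (iter_x e j) `|` coords (iter_v e j) `|` coords (anchor e j))).

(* The starting point [iter_x e 0] may be random, as needed for a restart. *)
Record accelerated_random_svrg e : Prop := {
  start_measurable : random_vector (iter_x e 0);
  idx_measurable : forall k i, measurable [set w | idx e k.+1 w = i];
  coin_measurable : forall k, measurable [set w | coin e k.+1 w];
  draw_y_measurable : forall k, random_vector (draw_y e k.+1);
  draw_xt_measurable : forall k, random_vector (draw_xt e k.+1);
  draw_anchor_measurable : forall k i, random_vector (draw_anchor e k i);
  idx_law : forall k i A, sigma_gen (drawn e k) A ->
    P (A `&` [set w | idx e k.+1 w = i]) = (P A * (q i)%:E)%E;
  draw_y_noise : forall k, noisy_gradient P fi sd (sigma_gen (drawn_idx e k))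
    (idx e k.+1) (iter_y e k) (draw_y e k.+1);
  draw_xt_noise : forall k, noisy_gradient P fi sd (sigma_gen (drawn_y e k))
    (idx e k.+1) (anchor e k) (draw_xt e k.+1);
  coin_law : forall k A, sigma_gen (drawn_xt e k) A ->
    P (A `&` [set w | coin e k.+1 w]) = (P A * (n%:R^-1)%:E)%E;
  anchor0_noise : forall i, noisy_gradient P fi sd (sigma_gen (coords (iter_x e 0)))
    (fun=> i) (anchor e 0) (draw_anchor e 0 i);
  anchor_noise : forall k i, noisy_gradient P fi sd (sigma_gen (drawn_coin e k))
    (fun=> i) (anchor e k.+1) (draw_anchor e k.+1 i);
  estimate_unbiased : forall k, is_cond_exp_vec P (information e k)
    (estimate e k) (fun w => grad (average fi) (iter_y e k w));
  gamma_0 : gamma e 0 = gamma0;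
  anchor_0 : anchor e 0 = iter_x e 0;
  iter_v_0 : iter_v e 0 = iter_x e 0;
  zbar_0 : zbar e 0 = anchor_gradient e 0;
  gamma_S : forall k,
    gamma e k.+1 = (1 - delta e k.+1) * gamma e k + delta e k.+1 * mu;
  delta_S : forall k,
    delta e k.+1 = Num.sqrt (5 * eta k.+1 * gamma e k.+1 / (3 * n%:R));
  iter_x_S : forall k w, is_prox (eta k.+1) psi
    (iter_y e k w - eta k.+1 *: estimate e k w) (iter_x e k.+1 w);
  iter_v_S : forall k w, iter_v e k.+1 w =
    (1 - mu * delta e k.+1 / gamma e k.+1) *: iter_v e k w
    + (mu * delta e k.+1 / gamma e k.+1) *: iter_y e k w
    + (delta e k.+1 / (gamma e k.+1 * eta k.+1)) *: (iter_x e k.+1 w - iter_y e k w);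
  anchor_S : forall k w, anchor e k.+1 w =
    if coin e k.+1 w then iter_x e k.+1 w else anchor e k w;
  zbar_S : forall k w, zbar e k.+1 w =
    if coin e k.+1 w then anchor_gradient e k.+1 w else zbar e k w }.

End Algorithm.

Section Complexity.
Context {d : measure_display} {T : measurableType d} {R : realType} {p n : nat}.
Variable P : probability T R.

(* [E[F(X) - F(xstar)]]; the integrand is nonnegative when [xstar] is a minimizer. *)
Definition expected_gap (F : 'rV[R]_p -> \bar R) (xstar : 'rV[R]_p)
  (X : T -> 'rV[R]_p) : \bar R := (\int[P]_w (F (X w) - F xstar))%E.

Definition first_reaches (F : 'rV[R]_p -> \bar R) (xstar : 'rV[R]_p)
    (e : execution T R p n) (tol : R) (K : nat) : Prop :=
  (expected_gap F xstar (iter_x e K) <= tol%:E)%E /\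
  (forall j, (j < K)%N -> (tol%:E < expected_gap F xstar (iter_x e j))%E).

(* Number of evaluations of perturbed gradients of the components in [K]
   iterations: [n] for the initial anchor, 2 per iteration, and [n] more each
   time the anchor is refreshed. *)
Definition gradient_evaluations (e : execution T R p n) (K : nat) (w : T) : nat :=
  (n + \sum_(1 <= k < K.+1) (2 + n * coin e k w))%N.

End Complexity.

Definition base_step {R : realType} (n : nat) (mu LQ : R) : R :=
  Num.min (3 * LQ)^-1 (15 * mu * n%:R)^-1.

Definition decreasing_step {R : realType} (n : nat) (mu LQ : R) (k : nat) : R :=
  Num.min (base_step n mu LQ) (12 * n%:R / (5 * mu * k.+2%:R ^+ 2)).

(* Main.v *)
(** Since [gamma0 = mu], every [gamma_k] equals [mu] and
    [delta_k ^+ 2 = 5 mu eta_k / (3 n)].  The relation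
    [delta (1 - delta) (v - y) = (1/n - delta) (y - xt)] behind the choice of
    [theta_k], the subgradient inequality of the proximal point at [xstar] and at
    the anchor [xt], and the descent lemma for [f] give a pathwise inequality
    for [mu / 2 * |v_k - xstar|^2 + F(x_k) / n].  Its only terms involving the noise
    are [eta / n * |g_k - grad f(y)|^2], whose mean is at most
    [2 L_Q (f(xt) - f(y) - <grad f(y), xt - y>) + 3 s2] (with [s2] the noise
    level) because its components are orthogonal given the successive stages
    of an iteration, and the inner product of [g_k - grad f(y)] with a vector known
    before the iteration, which has mean zero.  As the anchor is refreshed with
    probability [1/n], [E F(xt_k) = E F(x_k) / n + (1 - 1/n) E F(xt_(k-1))], and
    [a_k = E (mu / 2 * |v_k - xstar|^2 + F(xt_k) - F(xstar))] satisfies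
    [a_k <= (1 - delta_k) a_(k-1) + 3 s2 eta_k / n].

    This controls the anchors only; but [E F(xt_k)] is a convex combination of
    the [E F(x_j)] with [j <= k], so some [x_j] is at least as good.  A constant
    step gives a linear rate up to [4/5 B], and decreasing steps give
    [a_k <= 10 rho_Q s2 / (mu (k + 2))].  Since [eps < B], the quantity
    [n + sqrt (n L_Q / mu)] is at most [6 rho_Q s2 / (mu eps)], which absorbs all
    terms without a logarithm. *)

Require Import Defs.
From mathcomp Require Import all_boot all_order all_algebra.
From mathcomp Require Import all_classical all_reals all_analysis.
From mathcomp Require Import finmap measurable_realfun.
From mathcomp Require Import ring lra.
Import Order.TTheory GRing.Theory Num.Theory.
Import numFieldNormedType.Exports.

Set Implicit Arguments.
Unset Strict Implicit.
Unset Printing Implicit Defensive.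

Local Open Scope classical_set_scope.
Local Open Scope ring_scope.

(** * Euclidean geometry and smooth convex functions *)

Section Dot.
Context {R : realType} {p : nat}.
Implicit Types (u v w x y : 'rV[R]_p) (a : R).

(** The algebra is short; most of the work is to make every expectation legitimate. The iterates are
    prox points of random vectors and [psi] may be infinite, so neither their measurability nor the
    integrability of [F(x_k)] is given. Both rest on the prox point being a total, single-valued,
    1-Lipschitz function of its argument, which carries measurability and square integrability
    through the iterations.

    The other obstacle is that x_k is correlated with the error [g_k - grad f(y)], so their inner
    product does not vanish in mean. Replacing x_k by the prox point computed with the exact
    gradient, a function of y alone, leaves a term of mean zero, and nonexpansiveness makes
    [eta / n * |g_k - grad f(y)|^2] the whole price. Unbiasedness is tested on the sigma-algebra of
    the iterates, while noise and sampling are tested on that of all the draws; both have to be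
    kept. *)

Definition dot u v : R := \sum_(c < p) u 0 c * v 0 c.

Lemma dotC u v : dot u v = dot v u.
Proof. by apply: eq_bigr => c _; rewrite mulrC. Qed.

Lemma dotDl u v w : dot (u + v) w = dot u w + dot v w.
Proof. by rewrite -big_split; apply: eq_bigr => c _; rewrite mxE mulrDl. Qed.

Lemma dotDr u v w : dot w (u + v) = dot w u + dot w v.
Proof. by rewrite dotC dotDl !(dotC w). Qed.

Lemma dotZl a u v : dot (a *: u) v = a * dot u v.
Proof. by rewrite mulr_sumr; apply: eq_bigr => c _; rewrite mxE mulrA. Qed.

Lemma dotZr a u v : dot u (a *: v) = a * dot u v.
Proof. by rewrite dotC dotZl dotC. Qed.

Lemma dotNl u v : dot (- u) v = - dot u v.
Proof. by rewrite -scaleN1r dotZl mulN1r. Qed.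

Lemma dotNr u v : dot u (- v) = - dot u v.
Proof. by rewrite dotC dotNl dotC. Qed.

Lemma dot0l u : dot 0 u = 0.
Proof. by rewrite -(scale0r 0) dotZl mul0r. Qed.

Lemma dot0r u : dot u 0 = 0.
Proof. by rewrite dotC dot0l. Qed.

Lemma dot_suml (I : Type) (r : seq I) (F : I -> 'rV[R]_p) v :
  dot (\sum_(i <- r) F i) v = \sum_(i <- r) dot (F i) v.
Proof.
by elim: r => [|i r IH]; rewrite ?big_nil ?dot0l// !big_cons dotDl IH.
Qed.

Lemma sqnormE u : sqnorm u = dot u u.
Proof. by apply: eq_bigr => c _; rewrite expr2. Qed.

Lemma sqnorm_ge0 u : 0 <= sqnorm u.
Proof. by apply: sumr_ge0 => c _; exact: sqr_ge0. Qed.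

Lemma sqnorm0 : sqnorm (0 : 'rV[R]_p) = 0.
Proof. by rewrite sqnormE dot0l. Qed.

Lemma sqnormD u v : sqnorm (u + v) = sqnorm u + 2 * dot u v + sqnorm v.
Proof. by rewrite !sqnormE !dotDl !dotDr (dotC v u); ring. Qed.

Lemma sqnormN u : sqnorm (- u) = sqnorm u.
Proof. by rewrite !sqnormE dotNl dotNr opprK. Qed.

Lemma sqnormB u v : sqnorm (u - v) = sqnorm u - 2 * dot u v + sqnorm v.
Proof. by rewrite sqnormD sqnormN dotNr; ring. Qed.

Lemma sqnorm_subC u v : sqnorm (u - v) = sqnorm (v - u).
Proof. by rewrite -sqnormN opprB. Qed.

Lemma sqnormZ a u : sqnorm (a *: u) = a ^+ 2 * sqnorm u.
Proof. by rewrite !sqnormE dotZl dotZr; ring. Qed.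

Lemma sqnormD_le u v : sqnorm (u + v) <= 2 * sqnorm u + 2 * sqnorm v.
Proof. by have := sqnorm_ge0 (u - v); rewrite sqnormB sqnormD; lra. Qed.

Lemma dot_le u v : 2 * dot u v <= sqnorm u + sqnorm v.
Proof. by have := sqnorm_ge0 (u - v); rewrite sqnormB; lra. Qed.

Lemma normr_dot_le u v : `|dot u v| <= sqnorm u + sqnorm v.
Proof.
have := sqnorm_ge0 u; have := sqnorm_ge0 v.
have := dot_le u v; have := dot_le (- u) v.
by rewrite dotNl sqnormN ler_norml => *; apply/andP; split; lra.
Qed.

Lemma coord_le_sqnorm u c : u 0 c ^+ 2 <= sqnorm u.
Proof.
rewrite /sqnorm (bigD1 c)//= lerDl sumr_ge0// => i _; exact: sqr_ge0.
Qed.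

Lemma sqnorm_le0 u : sqnorm u <= 0 -> u = 0.
Proof.
move=> u0; apply/rowP => c; rewrite mxE; apply/eqP; rewrite -sqrf_eq0.
rewrite eq_le sqr_ge0 andbT (le_trans (coord_le_sqnorm u c))//.
Qed.

(** Expanding [|u - L v|^2 >= 0] gives [2 L <u, v> <= |u|^2 + L^2 |v|^2 <= 2 L^2 |v|^2]: the case of
    Cauchy-Schwarz that is needed, without square roots. *)
Lemma dot_le_scaled (L : R) u v :
  0 < L -> sqnorm u <= L ^+ 2 * sqnorm v -> dot u v <= L * sqnorm v.
Proof.
move=> L0 uv; have := sqnorm_ge0 (u - L *: v).
rewrite sqnormB sqnormZ dotZr => h.
by rewrite -(ler_pM2l L0); lra.
Qed.

Lemma smooth_sqnorm (L : R) (f : 'rV[R]_p -> R) x y : smooth L f ->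
  sqnorm (grad f x - grad f y) <= L ^+ 2 * sqnorm (x - y).
Proof.
move=> [_ /(_ x y)]; rewrite /enorm => h.
rewrite -[leLHS]sqr_sqrtr ?sqnorm_ge0//.
rewrite -[X in _ * X]sqr_sqrtr ?sqnorm_ge0//.
by rewrite -exprMn ler_sqr ?nnegrE ?sqrtr_ge0// (le_trans _ h)// sqrtr_ge0.
Qed.

End Dot.

(** * First-order inequalities along a segment *)

Section Gradient.
Context {R : realType} {p : nat}.
Implicit Types (f : 'rV[R]_p -> R) (x y d : 'rV[R]_p).

Lemma derive_grad f x d : differentiable f x -> 'D_d f x = dot (grad f x) d.
Proof.
move=> df; rewrite deriveE// {1}(row_sum_delta d) linear_sum.
by apply: eq_bigr => c _; rewrite linearZ /= mxE deriveE// mulrC.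
Qed.

Lemma is_derive_line f x d (t : R) : differentiable f (x + t *: d) ->
  is_derive t 1 (fun s : R => f (x + s *: d)) (dot (grad f (x + t *: d)) d).
Proof.
move=> df.
have E : (fun h : R => h^-1 *: (((fun s : R => f (x + s *: d)) \o shift t) (h *: 1)
            - f (x + t *: d))) =
         (fun h : R => h^-1 *: ((f \o shift (x + t *: d)) (h *: d)
            - f (x + t *: d))).
  apply/funext => h /=; congr (_ *: (f _ - _)).
  by rewrite scaler1 scalerDl addrCA.
split; first by rewrite /derivable E; exact: diff_derivable.
by rewrite -derive_grad// /derive E.
Qed.

(** Along the segment, [phi] is [f] minus its quadratic model at [x]. Its derivative is nonpositive
    for [s >= 0] because the gradient is Lipschitz, so monotonicity replaces the integral of the
    gradient. *)
Lemma descent (L : R) f x y : 0 < L -> smooth L f ->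
  f y <= f x + dot (grad f x) (y - x) + L / 2 * sqnorm (y - x).
Proof.
move=> L0 smf; have [df _] := smf; set d := y - x.
pose phi s := f (x + s *: d) - (s * dot (grad f x) d + s ^+ 2 * (L / 2 * sqnorm d)).
have dphi (s : R) : is_derive s 1 phi (dot (grad f (x + s *: d)) d
    - (dot (grad f x) d + 2 * s * (L / 2 * sqnorm d))).
  have h := is_derive_line (df (x + s *: d)).
  set a := dot (grad f x) d; set b := L / 2 * sqnorm d.
  have q : is_derive s 1 (fun s : R => s * a + s ^+ 2 * b) (a + 2 * s * b).
    rewrite (_ : (fun _ => _) = a \*: id + b \*: (id ^+ 2)); last first.
      by apply/funext => r; congr (_ + _); rewrite mulrC.
    apply: is_derive_eq; rewrite /GRing.scale /=; ring.
  exact: is_deriveB h q.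
have neg (s : R) : 0 <= s -> derive1 phi s <= 0.
  move=> s0; rewrite derive1E derive_val.
  suff : dot (grad f (x + s *: d) - grad f x) d <= s * L * sqnorm d.
    by rewrite dotDl dotNl => h; lra.
  move: s0; rewrite le_eqVlt => /predU1P[<-|s0].
    by rewrite scale0r addr0 subrr dot0l !mul0r.
  apply: dot_le_scaled; first by rewrite mulr_gt0.
  have := smooth_sqnorm (x + s *: d) x smf.
  by rewrite addrAC subrr add0r sqnormZ => h; apply: le_trans h _; lra.
have : phi 1 <= phi 0.
  apply: (@ler0_derive1_le_cc R phi 0 1) => //; rewrite ?in_itv/= ?lexx ?ler01//.
  - by move=> s; rewrite in_itv/= => /andP[/ltW s0 _]; exact: neg.
  - apply: derivable_within_continuous => s _.
    by have [] := dphi s.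
have xd : x + d = y by rewrite /d addrC subrK.
rewrite /phi scale1r scale0r addr0 xd expr1n expr0n/=; lra.
Qed.

(** Strong convexity with weight [h] bounds the difference quotient from [y] towards [x] by
    [C + h * (mu / 2 * |d|^2)]; the claim is the limit as [h] decreases to 0. *)
Lemma strongly_convex_grad (mu : R) f x y : differentiable f y ->
  strongly_convex mu f ->
  f y + dot (grad f y) (x - y) + mu / 2 * sqnorm (x - y) <= f x.
Proof.
move=> df scf; set d := x - y.
have df0 : differentiable f (y + 0 *: d) by rewrite scale0r addr0.
have [dphi vphi] := is_derive_line df0.
move: vphi; rewrite scale0r addr0 => vphi.
set phi := fun s : R => f (y + s *: d).
have cv1 : (fun h : R => h^-1 *: ((phi \o shift 0) (h *: 1) - phi 0)) @ 0^'+
    --> dot (grad f y) d.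
  rewrite -vphi; apply: cvg_trans dphi.
  apply: cvg_app => A [e e0 eA]; exists e => // z ze z0.
  by apply: eA => //; rewrite gt_eqF.
pose C := f x - f y - mu / 2 * sqnorm d.
have cv2 : (fun h : R => C + h * (mu / 2 * sqnorm d)) @ 0^'+ --> C + 0 * (mu / 2 * sqnorm d).
  apply: cvg_at_right_filter; apply: cvgD; first exact: cvg_cst.
  by apply: cvgM; [exact: cvg_id | exact: cvg_cst].
suff : dot (grad f y) d <= C + 0 * (mu / 2 * sqnorm d) by rewrite /C; lra.
apply: ler_cvg_to cv1 cv2 _.
near=> h; have h0 : 0 < h by [].
have h1 : h <= 1 by near: h; exact: nbhs_right_le.
have /(scf x y) : 0 <= h <= 1 by rewrite h1 (ltW h0).
rewrite /phi /= scaler1 addr0 scale0r addr0.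
have -> : h *: x + (1 - h) *: y = y + h *: d.
  by apply/rowP => c; rewrite !mxE; ring.
rewrite -/d => sc; rewrite -[_ *: _]/(_ * _) ler_pdivrMl//.
by rewrite /C; lra.
Unshelve. all: by end_near.
Qed.

End Gradient.

(* Replaces the independence of the [n] perturbations averaged at an anchor: with
   weights [q i] it already bounds their mean by the noise level. *)
Lemma jensen_sqnorm (R : realType) (p n : nat) (q : 'I_n -> R) (a : 'I_n -> 'rV[R]_p) :
  (forall i, 0 < q i) -> \sum_(i < n) q i = 1 ->
  sqnorm (\sum_(i < n) a i) <= \sum_(i < n) (q i)^-1 * sqnorm (a i).
Proof.
move=> q0 q1; set u := \sum_(i < n) a i.
have : 0 <= \sum_(i < n) q i * sqnorm ((q i)^-1 *: a i - u).
  by apply: sumr_ge0 => i _; rewrite mulr_ge0 ?sqnorm_ge0// ltW.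
have -> : \sum_(i < n) q i * sqnorm ((q i)^-1 *: a i - u) =
    \sum_(i < n) ((q i)^-1 * sqnorm (a i) - 2 * dot (a i) u + q i * sqnorm u).
  by apply: eq_bigr => i _; rewrite sqnormB sqnormZ dotZl; field; rewrite gt_eqF.
rewrite !big_split /= -mulr_suml q1 sumrN -mulr_sumr -dot_suml -/u -sqnormE; lra.
Qed.

(** Variance decomposition: [a i - b] has mean zero under the weights [q], so [z] contributes only
    its own square. It serves with [z] the error of the stored average. *)
Lemma sum_sqnorm_shift (R : realType) (p n : nat) (q : 'I_n -> R)
    (a : 'I_n -> 'rV[R]_p) (b z : 'rV[R]_p) :
  \sum_(i < n) q i = 1 -> \sum_(i < n) q i *: a i = b ->
  \sum_(i < n) q i * sqnorm (a i - b + z) =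
    \sum_(i < n) q i * sqnorm (a i) - sqnorm b + sqnorm z.
Proof.
move=> q1 ab.
have -> : \sum_(i < n) q i * sqnorm (a i - b + z) =
    \sum_(i < n) (q i * sqnorm (a i) + 2 * dot (q i *: a i) (z - b) + q i * sqnorm (z - b)).
  apply: eq_bigr => i _; rewrite -addrA (addrC (- b)).
  by rewrite (sqnormD (a i)) (dotZl (q i)); ring.
rewrite !big_split /= -mulr_sumr -dot_suml ab -mulr_suml q1.
by rewrite sqnormB dotDr dotNr -sqnormE (dotC z b); ring.
Qed.

Section ConvexSmooth.
Context {R : realType} {p : nat}.
Implicit Types (f : 'rV[R]_p -> R) (x y : 'rV[R]_p).

Lemma convex_function_strongly_convex f :
  convex_function setT f -> strongly_convex 0 f.
Proof.
move=> cf x y t t01; have [t0 t1] := andP t01.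
have H : Itv.spec (@Itv.num_sem R) (Itv.Real `[0%Z, 1%Z]) t.
  by apply/and3P; split; rewrite ?num_real// bnd_simp.
have := cf (Itv.mk H) x y (in_setT _) (in_setT _).
rewrite /conv /= mul0r !mul0r subr0; exact.
Qed.

Lemma convex_grad f x y : convex_function setT f -> differentiable f y ->
  f y + dot (grad f y) (x - y) <= f x.
Proof.
move=> cf df; have := strongly_convex_grad x df (convex_function_strongly_convex cf).
by rewrite mul0r mul0r addr0.
Qed.

(** The point [z] is a gradient step from [x] for [f] minus its linearization at [y]. Convexity at
    [y] bounds [f z] below, the descent lemma at [x] bounds it above. *)
Lemma cocoercive (L : R) f x y : 0 < L -> convex_function setT f -> smooth L f ->
  sqnorm (grad f x - grad f y)
    <= 2 * L * (f x - f y - dot (grad f y) (x - y)).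
Proof.
move=> L0 cf smf; have [df _] := smf.
set h := grad f x - grad f y; pose z := x - L^-1 *: h.
have zx : z - x = - (L^-1 *: h) by rewrite /z addrAC subrr add0r.
have := convex_grad z cf (df y).
have -> : z - y = (x - y) - L^-1 *: h by rewrite /z addrAC.
have := descent x z L0 smf; rewrite zx sqnormN sqnormZ dotNr dotDr dotNr !dotZr.
have : dot (grad f x) h - dot (grad f y) h = sqnorm h.
  by rewrite -dotNl -dotDl sqnormE.
move: (dot (grad f x) h) (dot (grad f y) h) => a b ab d1 d2.
rewrite mulrC -ler_pdivrMr ?mulr_gt0//.
have : L / 2 * (L^-1 ^+ 2 * sqnorm h) = sqnorm h / (2 * L) by field; rewrite gt_eqF.
have : sqnorm h / (2 * L) = L^-1 * (a - b) / 2 by rewrite ab; field; rewrite gt_eqF.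
lra.
Qed.

End ConvexSmooth.

(** * The averaged function under importance sampling *)

Section Average.
Context {R : realType} {p n : nat}.
Variables (fi : 'I_n -> 'rV[R]_p -> R) (L q : 'I_n -> R) (mu : R).
Hypotheses (n0 : (0 < n)%N) (mu0 : 0 < mu) (q0 : forall i, 0 < q i)
  (q1 : \sum_(i < n) q i = 1) (muL : forall i, mu <= L i)
  (cfi : forall i, convex_function setT (fi i))
  (sfi : forall i, smooth (L i) (fi i)).
Implicit Types (x y : 'rV[R]_p).

Let nR0 : 0 < n%:R :> R. Proof. by rewrite ltr0n. Qed.
Let L0 i : 0 < L i. Proof. exact: lt_le_trans (muL i). Qed.

Lemma averageE : average fi = \sum_(i < n) n%:R^-1 \*: fi i.
Proof.
apply/funext => x; rewrite fct_sumE /average mulr_sumr.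
by apply: eq_bigr => i _.
Qed.

Lemma differentiable_average x : differentiable (average fi) x.
Proof.
rewrite averageE; apply: differentiable_sum => i; apply: differentiableZ.
by have [] := sfi i.
Qed.

Lemma grad_average x : grad (average fi) x = n%:R^-1 *: \sum_(i < n) grad (fi i) x.
Proof.
have df i : differentiable (fi i) x by have [] := sfi i.
apply/rowP => c; rewrite !mxE averageE derive_sum => [|i]; last first.
  by apply: derivableZ; exact: diff_derivable.
rewrite summxE mulr_sumr; apply: eq_bigr => i _.
by rewrite deriveZ ?mxE//; exact: diff_derivable.
Qed.

Lemma L_Q_ge i : L i / (q i * n%:R) <= L_Q L q.
Proof. by apply: (@le_bigmax _ R _ 0 (fun i => L i / (q i * n%:R))). Qed.

Lemma L_Q_gt0 : 0 < L_Q L q.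
Proof.
by apply: lt_le_trans (L_Q_ge (Ordinal n0)); rewrite divr_gt0// mulr_gt0.
Qed.

(** The mean of the [L i] is a smoothness constant of the average; since [L i / n <= q i * L_Q] and
    the [q i] sum to 1, it is at most [L_Q]. *)
Lemma average_descent x y :
  average fi y <= average fi x + dot (grad (average fi) x) (y - x)
    + L_Q L q / 2 * sqnorm (y - x).
Proof.
have ni : n%:R^-1 * \sum_(i < n) L i <= L_Q L q.
  have -> : L_Q L q = \sum_(i < n) q i * L_Q L q by rewrite -mulr_suml q1 mul1r.
  rewrite mulr_sumr; apply: ler_sum => i _.
  rewrite (_ : n%:R^-1 * L i = q i * (L i / (q i * n%:R))).
    by rewrite ler_pM2l// L_Q_ge.
  by field; rewrite !gt_eqF.
apply: (@le_trans _ _ (average fi x + dot (grad (average fi) x) (y - x)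
    + (n%:R^-1 * \sum_(i < n) L i) / 2 * sqnorm (y - x))); last first.
  by rewrite lerD2l ler_wpM2r ?sqnorm_ge0// ler_pM2r.
rewrite grad_average dotZl dot_suml /average -!mulrA -!mulrDr ler_pM2l ?invr_gt0//.
rewrite mulr_suml -!big_split; apply: ler_sum => i _ /=.
by have := descent x y (L0 i) (sfi i); rewrite mulrA.
Qed.

(** Componentwise cocoercivity: the weight [q i * (q i * n)^-2 * 2 * L i] is [2 / n] times
    [L i / (q i * n)], which [L_Q] bounds uniformly in [i]. *)
Lemma gradient_variance x y :
  \sum_(i < n) q i * sqnorm ((q i * n%:R)^-1 *: (grad (fi i) x - grad (fi i) y))
  <= 2 * L_Q L q * (average fi x - average fi y - dot (grad (average fi) y) (x - y)).
Proof.
rewrite grad_average dotZl dot_suml /average -mulrBr -sumrB -mulrBr -sumrB.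
rewrite mulrA mulr_sumr; apply: ler_sum => i _.
have cc := cocoercive x y (L0 i) (cfi i) (sfi i).
set D := _ - _ - _ in cc *.
(* A positive multiple of [D] bounds a square by cocoercivity; the sign is needed to replace
   [L i / (q i * n)] by [L_Q]. *)
have D0 : 0 <= D.
  rewrite -(pmulr_rge0 _ (L0 i)) -(pmulr_rge0 _ (ltr0n _ 2)) mulrA.
  exact: le_trans (sqnorm_ge0 _) cc.
rewrite sqnormZ.
apply: (@le_trans _ _ (q i * ((q i * n%:R)^-1 ^+ 2 * (2 * L i * D)))).
  by rewrite !ler_pM2l// exprn_gt0// invr_gt0 mulr_gt0.
have -> : q i * ((q i * n%:R)^-1 ^+ 2 * (2 * L i * D)) =
    (L i / (q i * n%:R)) * (2 * n%:R^-1 * D).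
  by field; rewrite !gt_eqF.
have -> : 2 * L_Q L q * n%:R^-1 * D = L_Q L q * (2 * n%:R^-1 * D) by ring.
by rewrite ler_wpM2r ?L_Q_ge// !mulr_ge0// invr_ge0 ltW.
Qed.

End Average.

(** * Proximal points *)

Lemma sqnorm_continuous (R : realType) (p : nat) :
  continuous (@sqnorm R p : 'rV[R]_p -> R).
Proof.
apply: (continuous_big (U := R)) => [|c _ x]; first exact: add_continuous.
by apply: (@cvg_comp _ _ _ (fun x : 'rV[R]_p => x 0 c) (fun t : R => t ^+ 2)); [exact: coord_continuous | exact: exprn_continuous].
Qed.

Section Prox.
Context {R : realType} {p : nat}.
Variable psi : 'rV[R]_p -> \bar R.
Hypotheses (psiNy : forall x, psi x != -oo%E) (cvx : econvex psi)
  (lsc : lower_semicontinuous psi).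
Implicit Types (u x y : 'rV[R]_p) (h : R).

Let psir x : R := fine (psi x).

Lemma psi_fin x (r : R) : (psi x <= r%:E)%E -> psi x \is a fin_num.
Proof.
by move=> xr; rewrite fin_numE psiNy/= lt_eqF// (le_lt_trans xr)// ltry.
Qed.

Lemma econvex_fine x y t : psi x \is a fin_num -> psi y \is a fin_num -> 0 < t < 1 ->
  psi (t *: x + (1 - t) *: y) \is a fin_num /\
  psir (t *: x + (1 - t) *: y) <= t * psir x + (1 - t) * psir y.
Proof.
move=> fx fy t01; have := cvx x y t01.
rewrite -(fineK fx) -(fineK fy) -!EFinM -EFinD => le.
have fz := psi_fin le; split => //.
by move: le; rewrite -(fineK fz) lee_fin.
Qed.

Lemma prox_fin h u x y : 0 < h -> is_prox h psi u x -> psi y \is a fin_num ->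
  psi x \is a fin_num.
Proof.
move=> h0 /(_ y) + fy; rewrite -(fineK fy) -EFinM -EFinD.
have := psiNy x; case: (psi x) => //= _.
by rewrite gt0_muley ?lte_fin// addye.
Qed.

Lemma prox_le h u x y : 0 < h -> is_prox h psi u x -> psi y \is a fin_num ->
  h * psir x + 2^-1 * sqnorm (x - u) <= h * psir y + 2^-1 * sqnorm (y - u).
Proof.
move=> h0 px fy; have fx := prox_fin h0 px fy.
by move: (px y); rewrite -(fineK fy) -(fineK fx) -!EFinM -!EFinD lee_fin.
Qed.

(** The passage [t -> 0] in first-order optimality conditions. If [a < 0], the explicit
    [t = - a / (|b| - a + 1)] satisfies [t * |b| < - a], a contradiction. *)
Lemma ge0_of_affine (a b : R) : (forall t, 0 < t < 1 -> 0 <= a + t * b) -> 0 <= a.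
Proof.
move=> ab; rewrite leNgt; apply/negP => a0.
have d0 : 0 < `|b| - a + 1 by have := normr_ge0 b; lra.
have /ab : 0 < - a / (`|b| - a + 1) < 1.
  rewrite divr_gt0 ?oppr_gt0//= ltr_pdivrMr// mul1r.
  by have := normr_ge0 b; lra.
have : - a / (`|b| - a + 1) * b <= - a / (`|b| - a + 1) * `|b|.
  by rewrite ler_wpM2l ?ler_norm// divr_ge0 ?ltW// oppr_gt0.
have : - a / (`|b| - a + 1) * `|b| < - a.
  rewrite -mulrA gtr_pMr ?oppr_gt0// ltr_pdivrMl// mulr1.
  by have := normr_ge0 b; lra.
lra.
Qed.

(** Optimality of [x] against [t y + (1 - t) x], divided by [t], in the limit [t -> 0]:
    [(u - x) / h] is a subgradient of [psi] at [x]. *)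
Lemma prox_subgradient h u x y : 0 < h -> is_prox h psi u x ->
  psi y \is a fin_num -> h * psir x + dot (u - x) (y - x) <= h * psir y.
Proof.
move=> h0 px fy; have fx := prox_fin h0 px fy.
suff : 0 <= (h * psir y - h * psir x + dot (x - u) (y - x)).
  by rewrite -(opprB x u) dotNl; lra.
apply: (@ge0_of_affine _ (2^-1 * sqnorm (y - x))) => t t01.
have [fz cz] := econvex_fine fy fx t01; have [t0 t1] := andP t01.
have := prox_le h0 px fz.
have -> : t *: y + (1 - t) *: x - u = (x - u) + t *: (y - x).
  by apply/rowP => c; rewrite !mxE; ring.
rewrite (sqnormD (x - u)) sqnormZ dotZr => le.
rewrite -(pmulr_rge0 _ t0); move: cz; rewrite -(ler_pM2l h0); lra.
Qed.

(** Adding the subgradient inequalities at [x] and [x'] gives [|x - x'|^2 <= <u - u', x - x'>]. The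
    case [u = u'] is uniqueness of the prox point. *)
Lemma prox_nonexpansive h u u' x x' : 0 < h -> is_prox h psi u x ->
  is_prox h psi u' x' -> psi x \is a fin_num ->
  sqnorm (x - x') <= sqnorm (u - u').
Proof.
move=> h0 px px' fx; have fx' := prox_fin h0 px' fx.
have := prox_subgradient h0 px fx'; have := prox_subgradient h0 px' fx.
rewrite -(opprB x x') dotNr => a b.
have : dot (u' - x') (x - x') = dot (u - x) (x - x') - dot (u - u') (x - x') + sqnorm (x - x').
  by rewrite sqnormE -dotNl -!dotDl; congr dot; apply/rowP => c; rewrite !mxE; ring.
have := dot_le (u - u') (x - x').
lra.
Qed.

(** The rate is the one that 1-strong convexity at a midpoint gives for points whose values are
    within [1 / (k + 1)] of the infimum. *)
Lemma cvg_rV_of_cauchy_sqnorm (y : nat -> 'rV[R]_p) :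
  (forall i j, sqnorm (y i - y j) <= 4 * (i.+1%:R^-1 + j.+1%:R^-1)) ->
  exists x, y @ \oo --> x.
Proof.
move=> yc; suff : cvg (y @ \oo) by move=> ?; exists (lim (y @ \oo)).
apply/cauchy_cvgP; apply: cauchy_exP => e e0.
have e8 : 0 < e ^+ 2 / 8 by rewrite divr_gt0// exprn_gt0.
have [N _ HN] := near_infty_natSinv_lt (PosNum e8).
exists (y N); exists N => // k /= Nk; split=> // i j; rewrite ord1 /ball /=.
have hN : N.+1%:R^-1 < e ^+ 2 / 8 by exact: HN (leqnn N).
have hk : k.+1%:R^-1 < e ^+ 2 / 8 by exact: HN Nk.
have ye : sqnorm (y N - y k) < e ^+ 2 
  by move: (yc N k) hN hk; move: (_^-1) (_^-1) => a b; lra.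
have := le_lt_trans (coord_le_sqnorm (y N - y k) j) ye; rewrite !mxE.
by rewrite -(real_normK (num_real (_ - _))) ltr_sqr ?nnegrE ?normr_ge0 ?(ltW e0).
Qed.

(* A minimizing sequence of the strongly convex [h * psi + |. - u|^2 / 2] is Cauchy;
   the prox point at [u0] only serves to bound [psi] below by an affine function. *)
Lemma prox_exists h h' u u0 x0 y0 : 0 < h -> 0 < h' -> is_prox h' psi u0 x0 ->
  psi y0 \is a fin_num -> exists x, is_prox h psi u x.
Proof.
move=> h0 h'0 px0 fy0.
pose H y := h * psir y + 2^-1 * sqnorm (y - u).
pose S := [set H y | y in [set y | psi y \is a fin_num]].
have fx0 := prox_fin h'0 px0 fy0.
have lbS : has_lbound S.
  (* Slope of the affine minorant of [h * psi] obtained at [x0]. Its variation from [u] to [y] is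
     absorbed by [|y - u|^2 / 2] at the cost of [|b|^2 / 2]. *)
  pose b := (h / h') *: (u0 - x0).
  exists (h * psir x0 + dot b (u - x0) - 2^-1 * sqnorm b) => _ [y /= fy <-].
  rewrite /H; have := prox_subgradient h'0 px0 fy.
  have -> : dot (u0 - x0) (y - x0) = h' / h * dot b (y - x0).
    by rewrite dotZl; field; rewrite !gt_eqF.
  have -> : dot b (y - x0) = dot b (u - x0) + dot b (y - u).
    by rewrite -dotDr; congr dot; apply/rowP => c; rewrite !mxE; ring.
  rewrite -(ler_pM2l (divr_gt0 h0 h'0)) mulrDr.
  have -> : h / h' * (h' * psir x0) = h * psir x0 by field; rewrite gt_eqF.
  have -> : h / h' * (h' * psir y) = h * psir y by field; rewrite gt_eqF.
  rewrite [h / h' * (h' / h * _)]mulrA (_ : h / h' * (h' / h) = 1) ?mul1r; last first.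
    by field; rewrite !gt_eqF.
  have := dot_le (- b) (y - u); rewrite dotNl sqnormN; lra.
have hiS : has_inf S by split => //; exists (H y0); exists y0.
pose m := inf S.
have mS y : psi y \is a fin_num -> m <= H y by move=> fy; apply: ge_inf => //; exists y.
have /choice[y Hy] (k : nat) : exists y, psi y \is a fin_num /\ H y < m + k.+1%:R^-1.
  have k0 : 0 < k.+1%:R^-1 :> R by rewrite invr_gt0 ltr0n.
  by have [_ [z /= fz <-] zlt] := inf_adherent k0 hiS; exists z.
have fy k := (Hy k).1; have ym k := (Hy k).2.
have [x yx] : exists x, y @ \oo --> x.
  apply: cvg_rV_of_cauchy_sqnorm => i j.
  have half : 0 < (2^-1 : R) < 1 by apply/andP; split; lra.
  (* The value at the midpoint is at least [m], yet by the parallelogram identity it lies at least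
     [|y i - y j|^2 / 8] below the mean of the two values. *)
  have [fz cz] := econvex_fine (fy i) (fy j) half.
  have := mS _ fz; rewrite /H.
  have -> : 2^-1 *: y i + (1 - 2^-1) *: y j - u = 2^-1 *: ((y i - u) + (y j - u)).
    by apply/rowP => c; rewrite !mxE; field.
  have -> : y i - y j = (y i - u) - (y j - u) by apply/rowP => c; rewrite !mxE; ring.
  rewrite sqnormZ; have := ym i; have := ym j; rewrite /H; move: cz; rewrite -(ler_pM2l h0).
  move: (i.+1%:R^-1) (j.+1%:R^-1) (y i - u) (y j - u) => a b v w.
  rewrite sqnormD sqnormB; lra.
(* Lower semicontinuity is used through real levels [r] below [psi x], because [psi x] is not yet
   known to be finite. *)
have key (r : R) : (r%:E < psi x)%E -> h * r + 2^-1 * sqnorm (x - u) <= m.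
  move=> rx; have [V Vx VP] := lsc rx.
  pose c k := h * r + 2^-1 * sqnorm (y k - u).
  have cvc : c @ \oo --> h * r + 2^-1 * sqnorm (x - u).
    apply: cvgD; first exact: cvg_cst.
    apply: cvgM; first exact: cvg_cst.
    apply: (@cvg_comp _ _ _ (fun k => y k - u) sqnorm); last exact: sqnorm_continuous.
    by apply: cvgB; [exact: yx | exact: cvg_cst].
  have cvm : (fun k : nat => m + k.+1%:R^-1) @ \oo --> m + 0.
    by apply: cvgD; [exact: cvg_cst | exact: cvg_harmonic].
  rewrite -[m]addr0; apply: ler_cvg_to cvc cvm _.
  have nV : \forall k \near \oo, V (y k) by exact: yx.
  near=> k; have /VP : V (y k) by near: k.
  rewrite -(fineK (fy k)) lte_fin -(ltr_pM2l h0) => hr.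
  by have := ym k; rewrite /c /H /psir; move: (k.+1%:R^-1) => a; lra.
have le : (psi x <= (h^-1 * (m - 2^-1 * sqnorm (x - u)))%:E)%E.
  rewrite leNgt; apply/negP => lt.
  have [r [r1 r2]] : exists r, h^-1 * (m - 2^-1 * sqnorm (x - u)) < r /\ (r%:E < psi x)%E.
    move: lt; have := psiNy x; case: (psi x) => //= [s|] _.
      rewrite lte_fin => lt; exists ((h^-1 * (m - 2^-1 * sqnorm (x - u)) + s) / 2).
      by rewrite lte_fin midf_lt// midf_lt.
    by move=> _; eexists; split; [exact: ltr_pwDr ltr01 (lexx _) | exact: ltry].
  by have := key _ r2; rewrite mulrC ltr_pdivrMr// in r1; lra.
have fx := psi_fin le.
exists x => z; have := psiNy z; case E : (psi z) => [s||]// _; last first.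
  by rewrite gt0_muley ?lte_fin// addye// leey.
have fz : psi z \is a fin_num by rewrite E.
have := mS z fz; rewrite /H /psir E /= => mz.
move: le; rewrite -(fineK fx) -!EFinM -!EFinD !lee_fin.
rewrite mulrC ler_pdivlMr//; lra.
Unshelve. all: by end_near.
Qed.

End Prox.

(** * Random vectors and conditional expectations *)

Section RandomVector.
Context {d : measure_display} {T : measurableType d} {R : realType} {p : nat}.
Implicit Types (X Y : T -> 'rV[R]_p) (a : T -> R).

Lemma random_vectorP X :
  random_vector X <-> forall c, measurable_fun setT (fun w => X w 0 c).
Proof.
by split=> [h c|h _ [c _ <-]]; [apply: h; exists c | exact: h].
Qed.

Lemma random_vector_cst u : random_vector (cst u : T -> 'rV[R]_p).
Proof. by apply/random_vectorP => c; exact: measurable_cst. Qed.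

Lemma random_vectorD X Y : random_vector X -> random_vector Y ->
  random_vector (fun w => X w + Y w).
Proof.
move=> /random_vectorP mX /random_vectorP mY; apply/random_vectorP => c.
by under eq_fun do rewrite mxE; exact: measurable_funD.
Qed.

Lemma random_vectorZ a X : measurable_fun setT a -> random_vector X ->
  random_vector (fun w => a w *: X w).
Proof.
move=> ma /random_vectorP mX; apply/random_vectorP => c.
by under eq_fun do rewrite mxE; exact: measurable_funM.
Qed.

Lemma random_vectorZc (k : R) X : random_vector X -> random_vector (fun w => k *: X w).
Proof. by apply: random_vectorZ; exact: measurable_cst. Qed.

Lemma random_vectorB X Y : random_vector X -> random_vector Y ->
  random_vector (fun w => X w - Y w).
Proof.
move=> mX mY; under eq_fun do rewrite -scaleN1r.
by apply: random_vectorD => //; exact: random_vectorZc.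
Qed.

Lemma random_vector_sum (I : Type) (r : seq I) (X : I -> T -> 'rV[R]_p) :
  (forall i, random_vector (X i)) -> random_vector (fun w => \sum_(i <- r) X i w).
Proof.
move=> mX; elim: r => [|i r IH].
  by under eq_fun do rewrite big_nil; exact: random_vector_cst.
by under eq_fun do rewrite big_cons; exact: random_vectorD.
Qed.

Lemma random_vector_if (b : T -> bool) X Y : measurable [set w | b w] ->
  random_vector X -> random_vector Y ->
  random_vector (fun w => if b w then X w else Y w).
Proof.
move=> mb /random_vectorP mX /random_vectorP mY; apply/random_vectorP => c.
rewrite (_ : (fun w => _) = (fun w => if b w then X w 0 c else Y w 0 c)).
  apply: measurable_fun_ifT => //; apply: (measurable_fun_bool true).
  by rewrite setTI preimage_true.
by apply/funext => w; case: (b w).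
Qed.

Lemma measurable_dot X Y : random_vector X -> random_vector Y ->
  measurable_fun setT (fun w => dot (X w) (Y w)).
Proof.
move=> /random_vectorP mX /random_vectorP mY.
by apply: measurable_sum => c; exact: measurable_funM.
Qed.

Lemma measurable_sqnorm X : random_vector X ->
  measurable_fun setT (fun w => sqnorm (X w)).
Proof. by move=> mX; under eq_fun do rewrite sqnormE; exact: measurable_dot. Qed.

(* An open set is the union of the rational sup-norm balls it contains. *)
Lemma measurable_preimage_open X (U : set 'rV[R]_p) : random_vector X -> open U ->
  measurable (X @^-1` U).
Proof.
move=> /random_vectorP mX oU.
pose box (c : 'rV[rat]_p * rat) : set T :=
  if pselect (ball (map_mx ratr c.1 : 'rV[R]_p) (ratr c.2 : R) `<=` U)
  then X @^-1` ball (map_mx ratr c.1 : 'rV[R]_p) (ratr c.2 : R) else set0.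
rewrite (_ : X @^-1` U = \bigcup_c box c); last first.
  apply/seteqP; split=> [w /= Uw|w [c _]]; last first.
    by rewrite /box; case: pselect => // cU /cU.
  have [e /= e0 eU] : nbhs_ball (X w) U by apply/nbhs_ballP; exact: open_nbhs_nbhs.
  have [r] : exists r : rat, (ratr r : R) \in `]0, (e / 2)[.
    by apply: rat_in_itvoo; rewrite divr_gt0.
  rewrite in_itv/= => /andP[r0 re].
  have /choice[z Hz] (c : 'I_p) :
      exists z : rat, (ratr z : R) \in `](X w 0 c - ratr r), (X w 0 c + ratr r)[.
    by apply: rat_in_itvoo; rewrite ltrD2l gt0_cp.
  have Hz' c : `|ratr (z c) - X w 0 c| < ratr r.
    by have := Hz c; rewrite in_itv/= ltr_distl.
  exists (\row_c z c, r) => //; rewrite /box; case: pselect => /= [_|].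
    by split=> // i j; rewrite ord1 !mxE /ball/= Hz'.
  case=> y [_ yb]; apply: eU; split=> // i j; rewrite ord1 /ball/=.
  have := yb 0 j; rewrite !mxE /ball/= => h.
  have := ler_distD (ratr (z j)) (X w 0 j) (y 0 j).
  have := Hz' j; rewrite (distrC (ratr (z j)) (X w 0 j)); lra.
apply: countable_bigcupT_measurable; first exact: countableP.
move=> c.
rewrite /box; case: pselect => cU; last exact: measurable0.
have [r0|r0] := ltP 0 (ratr c.2 : R); last first.
  have -> : X @^-1` ball (map_mx ratr c.1 : 'rV[R]_p) (ratr c.2 : R) = set0.
    rewrite -subset0 => w [/= h _].
    by have := lt_le_trans h r0; rewrite ltxx.
  exact: measurable0.
rewrite (_ : _ @^-1` _ = \bigcap_(j in [set: 'I_p])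
    (setT `&` (fun w => X w 0 j) @^-1` ball (ratr (c.1 0 j) : R) (ratr c.2 : R))).
  apply: fin_bigcap_measurable => // j _; apply: mX => //.
  by apply: open_measurable; exact: ball_open.
apply/seteqP; split=> [w [_ h] j _|w h]; split=> //.
  by have := h 0 j; rewrite mxE.
by move=> i j; rewrite ord1 mxE; have [] := h j I.
Qed.

Lemma measurable_lsc_comp (f : 'rV[R]_p -> \bar R) X : lower_semicontinuous f ->
  random_vector X -> measurable_fun setT (f \o X).
Proof.
move=> /lower_semicontinuousP lf mX.
apply: (measurability _ (ErealGenOInfty.measurableE R)) => _ [_ [a ->] <-].
rewrite setTI (_ : (f \o X) @^-1` _ = X @^-1` [set x | (a%:E < f x)%E]).
  by apply: measurable_preimage_open.
by apply/seteqP; split=> w; rewrite /= in_itv/= andbT.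
Qed.

Lemma measurable_continuous_comp (f : 'rV[R]_p -> R) X : continuous f ->
  random_vector X -> measurable_fun setT (f \o X).
Proof.
move=> cf mX; apply/measurable_EFinP; apply: (@measurable_lsc_comp (EFin \o f)) => //.
apply/lower_semicontinuousP => a.
rewrite (_ : [set x | _] = f @^-1` [set r | a < r]).
  by apply: open_comp => [x _|]; [exact: cf | exact: open_gt].
by apply/seteqP; split=> x /=; rewrite lte_fin.
Qed.

Lemma lipschitz_sqnorm_continuous (f : 'rV[R]_p -> 'rV[R]_p) (C : R) c :
  (forall x y, sqnorm (f x - f y) <= C * sqnorm (x - y)) ->
  continuous (fun x => f x 0 c).
Proof.
move=> lf x; apply/(@cvgrPdist_lt _ _ _ (nbhs x) (nbhs_filter x)) => e e0.
have cB : continuous (fun y : 'rV[R]_p => x - y).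
  move=> y; apply: continuousB; [exact: cst_continuous | move=> z; exact: cvg_id].
have cN : continuous (fun y : 'rV[R]_p => sqnorm (x - y)).
  by move=> y; apply: (continuous_comp (cB y)); exact: sqnorm_continuous.
have cv : continuous (fun y : 'rV[R]_p => C * sqnorm (x - y)).
  by move=> y; apply: (continuous_comp (cN y)); exact: mulrl_continuous.
have {}cv := cv x.
rewrite /continuous_at subrr sqnorm0 mulr0 in cv.
have e20 : 0 < e ^+ 2 by rewrite exprn_gt0.
move/cvgrPdist_lt : cv => /(_ _ e20); apply: filterS => y.
rewrite sub0r normrN => h.
have := le_trans (coord_le_sqnorm (f x - f y) c) (lf x y); rewrite !mxE => h1.
rewrite -ltr_sqr ?nnegrE ?normr_ge0 ?(ltW e0)// real_normK ?num_real//.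
exact: le_lt_trans h1 (le_lt_trans (ler_norm _) h).
Qed.

(** The route by which gradients and prox maps preserve measurability; it applies to any
    sigma-algebra on [T], hence also yields adaptedness. *)
Lemma random_vector_lipschitz (f : 'rV[R]_p -> 'rV[R]_p) (C : R) X :
  (forall x y, sqnorm (f x - f y) <= C * sqnorm (x - y)) ->
  random_vector X -> random_vector (f \o X).
Proof.
move=> lf mX; apply/random_vectorP => c.
apply: (@measurable_continuous_comp (fun x => f x 0 c) X _ mX).
exact: lipschitz_sqnorm_continuous lf.
Qed.

End RandomVector.

(** * Expectations and square-integrable vectors *)

Section SquareIntegrable.
Context {d : measure_display} {T : measurableType d} {R : realType}.
Variable P : probability T R.
Implicit Types (f g h : T -> R).

Definition intg f := P.-integrable setT (EFin \o f).

(** Real-valued, so that expectations can be compared by linear arithmetic. An infinite integral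
    would default to 0, which is why integrability is carried along. *)
Definition Ex f : R := \int[P]_w f w.

Lemma intg_measurable f : intg f -> measurable_fun setT f.
Proof. by move=> /(measurable_int P) /measurable_EFinP. Qed.

Lemma intg_le f g : measurable_fun setT f -> (forall w, `|f w| <= g w) -> intg g -> intg f.
Proof.
move=> mf fg; apply: le_integrable => //; first exact/measurable_EFinP.
by move=> w _; rewrite /= lee_fin (le_trans (fg w))// ler_norm.
Qed.

Lemma intgD f g : intg f -> intg g -> intg (fun w => f w + g w).
Proof.
move=> fi gi; rewrite /intg (_ : _ \o _ = (EFin \o f) \+ (EFin \o g))%E//.
exact: integrableD.
Qed.

Lemma intgZ (k : R) f : intg f -> intg (fun w => k * f w).
Proof.
move=> fi; rewrite /intg (_ : _ \o _ = (fun w => k%:E * (EFin \o f) w))%E//.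
exact: integrableZl.
Qed.

Lemma intgB f g : intg f -> intg g -> intg (fun w => f w - g w).
Proof.
move=> fi gi; rewrite /intg (_ : _ \o _ = (EFin \o f) \- (EFin \o g))%E//.
exact: integrableB.
Qed.

Lemma intg_cst (k : R) : intg (cst k).
Proof. by apply: finite_measure_integrable_cst. Qed.

Lemma intg_sum (I : Type) (r : seq I) (F : I -> T -> R) :
  (forall i, intg (F i)) -> intg (fun w => \sum_(i <- r) F i w).
Proof.
move=> Fi; elim: r => [|i r IH].
  by under eq_fun do rewrite big_nil; exact: intg_cst.
by under eq_fun do rewrite big_cons; exact: intgD.
Qed.

Lemma ExD f g : intg f -> intg g -> Ex (fun w => f w + g w) = Ex f + Ex g.
Proof. by move=> fi gi; rewrite /Ex RintegralD. Qed.

Lemma ExB f g : intg f -> intg g -> Ex (fun w => f w - g w) = Ex f - Ex g.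
Proof. by move=> fi gi; rewrite /Ex RintegralB. Qed.

Lemma ExZ (k : R) f : intg f -> Ex (fun w => k * f w) = k * Ex f.
Proof. by move=> fi; rewrite /Ex RintegralZl. Qed.

Lemma Ex_cst (k : R) : Ex (cst k) = k.
Proof.
rewrite /Ex Rintegral_cst// -[RHS]mulr1; congr (_ * _).
exact: (congr1 fine (probability_setT P)).
Qed.

Lemma Ex_sum (I : Type) (r : seq I) (F : I -> T -> R) :
  (forall i, intg (F i)) -> Ex (fun w => \sum_(i <- r) F i w) = \sum_(i <- r) Ex (F i).
Proof.
move=> Fi; elim: r => [|i r IH].
  by rewrite big_nil; under eq_fun do rewrite big_nil; exact: Ex_cst.
rewrite big_cons -IH -ExD//; last exact: intg_sum.
by congr Ex; apply/funext => w; rewrite big_cons.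
Qed.

Lemma Ex_le f g : intg f -> intg g -> (forall w, f w <= g w) -> Ex f <= Ex g.
Proof. by move=> fi gi fg; apply: le_Rintegral. Qed.

Lemma Ex_ge0 f : (forall w, 0 <= f w) -> 0 <= Ex f.
Proof. by move=> f0; apply: Rintegral_ge0. Qed.

Lemma EFin_Ex f : intg f -> (Ex f)%:E = (\int[P]_w (f w)%:E)%E.
Proof. by move=> fi; rewrite /Ex fineK//; exact: integrable_fin_num. Qed.

Lemma indicM_intg f (A : set T) : measurable A -> intg f ->
  intg (fun w => \1_A w * f w).
Proof.
move=> mA fi; apply: (@intg_le _ (fun w => `|f w|)).
- by apply: measurable_funM; [exact: measurable_indic | exact: intg_measurable].
- by move=> w; rewrite normrM indicE; case: (w \in A); rewrite ?normr1 ?mul1r// normr0 mul0r.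
- exact: (integrable_norm fi).
Qed.

Lemma integral_indicM f (A : set T) :
  (\int[P]_(w in A) (f w)%:E)%E = (\int[P]_w (\1_A w * f w)%:E)%E.
Proof.
rewrite integral_mkcond; apply: eq_integral => w _.
by rewrite patchE indicE; case: ifP => _ /=; rewrite ?mul1r ?mul0r.
Qed.

Section Vectors.
Context {p : nat}.
Implicit Types (X Y : T -> 'rV[R]_p).

Definition L2 X := random_vector X /\ intg (fun w => sqnorm (X w)).

Lemma L2_cst u : L2 (cst u).
Proof. by split; [exact: random_vector_cst | exact: (intg_cst (sqnorm u))]. Qed.

Lemma L2D X Y : L2 X -> L2 Y -> L2 (fun w => X w + Y w).
Proof.
move=> [mX iX] [mY iY]; have mXY := random_vectorD mX mY; split => //.
apply: (@intg_le _ (fun w => 2 * sqnorm (X w) + 2 * sqnorm (Y w))).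
- exact: measurable_sqnorm.
- by move=> w; rewrite ger0_norm ?sqnorm_ge0// sqnormD_le.
- by apply: intgD; exact: intgZ.
Qed.

Lemma L2Z X (a : T -> R) (M : R) : measurable_fun setT a ->
  (forall w, `|a w| <= M) -> L2 X -> L2 (fun w => a w *: X w).
Proof.
move=> ma aM [mX iX]; have maX := random_vectorZ ma mX; split => //.
apply: (@intg_le _ (fun w => M ^+ 2 * sqnorm (X w))).
- exact: measurable_sqnorm.
- move=> w; rewrite ger0_norm ?sqnorm_ge0// sqnormZ ler_wpM2r ?sqnorm_ge0//.
  rewrite -real_normK ?num_real// ler_sqr ?nnegrE ?normr_ge0//.
  exact: le_trans (aM w).
- exact: intgZ.
Qed.

Lemma L2Zc X (k : R) : L2 X -> L2 (fun w => k *: X w).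
Proof. by apply: (@L2Z _ (cst k) `|k|) => //; exact: measurable_cst. Qed.

Lemma L2B X Y : L2 X -> L2 Y -> L2 (fun w => X w - Y w).
Proof.
move=> hX hY; under eq_fun do rewrite -scaleN1r.
by apply: L2D => //; exact: L2Zc.
Qed.

Lemma L2_sum (I : Type) (r : seq I) (X : I -> T -> 'rV[R]_p) :
  (forall i, L2 (X i)) -> L2 (fun w => \sum_(i <- r) X i w).
Proof.
move=> hX; elim: r => [|i r IH].
  by under eq_fun do rewrite big_nil; exact: L2_cst.
by under eq_fun do rewrite big_cons; exact: L2D.
Qed.

Lemma L2_if (b : T -> bool) X Y : measurable [set w | b w] -> L2 X -> L2 Y ->
  L2 (fun w => if b w then X w else Y w).
Proof.
move=> mb [mX iX] [mY iY]; have m := random_vector_if mb mX mY; split => //.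
apply: (@intg_le _ (fun w => sqnorm (X w) + sqnorm (Y w))).
- exact: measurable_sqnorm.
- by move=> w; rewrite ger0_norm ?sqnorm_ge0//; case: (b w); rewrite ?lerDl ?lerDr sqnorm_ge0.
- exact: intgD.
Qed.

Lemma L2_lipschitz (f : 'rV[R]_p -> 'rV[R]_p) (C : R) X :
  (forall x y, sqnorm (f x - f y) <= C * sqnorm (x - y)) -> L2 X -> L2 (f \o X).
Proof.
move=> lf hX; have mf := random_vector_lipschitz lf hX.1; split => //.
apply: (@intg_le _ (fun w => 2 * (C * sqnorm (X w - 0)) + 2 * sqnorm (f 0))).
- exact: measurable_sqnorm.
- move=> w /=; rewrite ger0_norm ?sqnorm_ge0//.
  have := sqnormD_le (f (X w) - f 0) (f 0); rewrite subrK.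
  by have := lf (X w) 0; lra.
- apply: intgD; last exact: intg_cst.
  by apply/intgZ/intgZ; exact: (L2B hX (L2_cst 0)).2.
Qed.

Lemma intg_dot X Y : L2 X -> L2 Y -> intg (fun w => dot (X w) (Y w)).
Proof.
move=> [mX iX] [mY iY]; apply: (@intg_le _ (fun w => sqnorm (X w) + sqnorm (Y w))).
- exact: measurable_dot.
- by move=> w; exact: normr_dot_le.
- exact: intgD.
Qed.

Lemma L2_coordM X Y c : L2 X -> L2 Y -> intg (fun w => X w 0 c * Y w 0 c).
Proof.
move=> [mX iX] [mY iY]; apply: (@intg_le _ (fun w => sqnorm (X w) + sqnorm (Y w))).
- by apply: measurable_funM; move/random_vectorP : mX => //; move/random_vectorP : mY.
- move=> w; have := coord_le_sqnorm (X w) c; have := coord_le_sqnorm (Y w) c.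
  have := sqr_ge0 (`|X w 0 c| - `|Y w 0 c|).
  rewrite normrM sqrrB !real_normK ?num_real//.
  move: (sqr_ge0 (X w 0 c)) (sqr_ge0 (Y w 0 c)); lra.
- exact: intgD.
Qed.

End Vectors.

End SquareIntegrable.

(** * Measurability for a generated sigma-algebra *)

Section Adapted.
Context {d : measure_display} {T : measurableType d} {R : realType}.
Implicit Types (S : set (T -> R)) (h : T -> R).

Local Notation generated S :=
  (g_sigma_algebraType (\bigcup_(X in S) preimage_set_system setT X measurable)).

(** The space is retyped with the sigma-algebra generated by [S]: adaptedness is then ordinary
    measurability, and the lemmas on random vectors apply to it unchanged. *)
Definition adapted S h := measurable_fun (setT : set (generated S)) h.

Lemma adapted_gen S h : S h -> adapted S h.
Proof.
move=> Sh _ B mB; apply: sub_sigma_algebra; exists h => //.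
by exists B.
Qed.

(** The sets with measurable preimage under [F] form a sigma-algebra containing the generators. With
    [F] the identity, the choice of sigma-algebra on its source gives the two comparison lemmas that
    follow. *)
Lemma adapted_trans d' (T' : measurableType d') S (F : T' -> T) h :
  (forall X, S X -> measurable_fun setT (X \o F)) -> adapted S h ->
  measurable_fun setT (h \o F).
Proof.
move=> SF ah _ B mB; rewrite setTI.
have : sigma_gen S (h @^-1` B) by rewrite -[_ @^-1` _]setTI; exact: ah.
rewrite -[(h \o F) @^-1` B]/(F @^-1` (h @^-1` B)); move: (h @^-1` B) => A; rewrite /sigma_gen.
have sa : sigma_algebra setT [set A | measurable (F @^-1` A)].
  split => /=.
  - by rewrite preimage_set0; exact: measurable0.
  - move=> A' mA'; rewrite setTD preimage_setC; exact: measurableC.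
  - by move=> A' mA'; rewrite preimage_bigcup; exact: bigcupT_measurable.
move=> /(_ [set A | measurable (F @^-1` A)]); apply; split=> //.
move=> _ [X SX [C mC <-]] /=.
by rewrite setTI -[_ @^-1` _]setTI; exact: (SF X SX).
Qed.

Lemma adapted_measurable S h : (forall X, S X -> measurable_fun setT X) ->
  adapted S h -> measurable_fun setT h.
Proof. by move=> SX; exact: (@adapted_trans _ T S id h). Qed.

Lemma adapted_le S S' h : (forall X, S X -> adapted S' X) -> adapted S h -> adapted S' h.
Proof. by move=> SS; exact: (@adapted_trans _ (generated S') S id h). Qed.

Lemma sigma_gen_measurable S A : (forall X, S X -> measurable_fun setT X) ->
  sigma_gen S A -> measurable A.
Proof.
move=> SX SA; have : adapted S (\1_A : T -> R) by exact: measurable_indic.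
move=> /(adapted_measurable SX) /measurable_indicP; exact.
Qed.

End Adapted.

(** * Conditional expectations tested against adapted weights *)

Section ConditionalExpectation.
Context {d : measure_display} {T : measurableType d} {R : realType}.
Variable P : probability T R.
Variable S : set (T -> R).
Hypothesis mS : forall X, S X -> measurable_fun setT X.
Implicit Types (f g h X Y : T -> R).

Local Notation generated :=
  (g_sigma_algebraType (\bigcup_(X in S) preimage_set_system setT X measurable)).

(** Dominated convergence with majorant [|h * X|]. *)
Lemma Ex_mul_cvg (s : nat -> T -> R) h X : (forall n, measurable_fun setT (s n)) ->
  (forall n w, 0 <= s n w <= h w) -> (forall w, s ^~ w @ \oo --> h w) ->
  measurable_fun setT X -> intg P (fun w => h w * X w) ->
  (fun n => Ex P (fun w => s n w * X w)) @ \oo --> Ex P (fun w => h w * X w).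
Proof.
move=> ms sh cs mX ihX.
have isX n : intg P (fun w => s n w * X w).
  apply: (@intg_le _ _ _ _ _ (fun w => `|h w * X w|)).
  - exact: measurable_funM.
  - move=> w; have /andP[s0 s1] := sh n w; rewrite !normrM ler_wpM2r//.
    by rewrite !ger0_norm// (le_trans s0).
  - exact: (integrable_norm ihX).
have [||||| _ _ cv] := @dominated_convergence _ T R P setT measurableT
    (fun n w => (s n w * X w)%:E) (fun w => (h w * X w)%:E) (fun w => `|h w * X w|%:E).
- by move=> n; exact: measurable_int (isX n).
- exact: measurable_int ihX.
- apply: aeW => w _; apply: cvg_EFin; first exact: nearW.
  by apply: cvgM; [exact: cs | exact: cvg_cst].
- exact: (integrable_norm ihX).
- apply: aeW => w n _; rewrite /= lee_fin !normrM ler_wpM2r//.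
  by have /andP[s0 s1] := sh n w; rewrite !ger0_norm// (le_trans s0).
rewrite -EFin_Ex// in cv; exact: (fine_cvg cv).
Qed.

Lemma Ex_cond_exp_indic X Y A : is_cond_exp P (sigma_gen S) X Y -> sigma_gen S A ->
  Ex P (fun w => \1_A w * X w) = Ex P (fun w => \1_A w * Y w).
Proof.
by move=> [_ _ _ h] /h; rewrite (integral_indicM P X) (integral_indicM P Y) => e; rewrite /Ex /Rintegral e.
Qed.

Import HBNNSimple.

Lemma Ex_cond_exp_nnsfun (s : {nnsfun generated >-> R}) X Y :
  is_cond_exp P (sigma_gen S) X Y ->
  Ex P (fun w => s w * X w) = Ex P (fun w => s w * Y w).
Proof.
move=> cXY; have [iX iY _ _] := cXY.
(* The finitely many values of [s]: this writes [s] as a combination of indicators of its level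
   sets, which belong to the sigma-algebra. *)
pose r := fset_set (s @` setT); pose c (i : nat) := r`_i.
pose A i : set T := s @^-1` [set c i].
have sA i : sigma_gen S (A i).
  rewrite /A -[_ @^-1` _]setTI.
  by apply: (@measurable_funP _ _ _ _ setT s) => //; exact: measurable_set1.
have E f : (fun w => s w * f w) =
    (fun w => \sum_(i < #|`r|) c i * (\1_(A i) w * f w)).
  apply/funext => w; rewrite (fimfunEord s) mulr_suml; apply: eq_bigr => i _.
  by rewrite mulrA.
have intA f i : intg P f -> intg P (fun w => c i * (\1_(A i) w * f w)).
  move=> fi; apply/intgZ/indicM_intg => //.
  exact: sigma_gen_measurable (sA i).
rewrite !E !Ex_sum; try by move=> i; exact: intA.
apply: eq_bigr => i _; rewrite !ExZ ?(Ex_cond_exp_indic cXY (sA i))//.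
all: by apply: indicM_intg => //; exact: sigma_gen_measurable (sA i).
Qed.

Lemma Ex_cond_exp_ge0 X Y h : is_cond_exp P (sigma_gen S) X Y -> adapted S h ->
  (forall w, 0 <= h w) -> intg P (fun w => h w * X w) -> intg P (fun w => h w * Y w) ->
  Ex P (fun w => h w * X w) = Ex P (fun w => h w * Y w).
Proof.
move=> cXY ah h0 ihX ihY; have [iX iY _ _] := cXY.
have mh : measurable_fun (setT : set generated) (EFin \o h) by exact/measurable_EFinP.
pose s := nnsfun_approx (measurableT : measurable (setT : set generated)) mh.
have h0' w : setT w -> (0 <= (EFin \o h) w)%E by rewrite lee_fin.
have ms n : measurable_fun setT (s n : T -> R).
  by apply: (adapted_measurable mS); exact: measurable_funP.
have sh n w : 0 <= s n w <= h w.
  by rewrite fun_ge0/= -lee_fin nnsfun_approxE; exact: (le_approx n h0').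
have cs w : s ^~ w @ \oo --> h w.
  exact: (fine_cvg (cvg_nnsfun_approx measurableT mh h0' (I : setT w))).
have cX := Ex_mul_cvg ms sh cs (intg_measurable iX) ihX.
have cY := Ex_mul_cvg ms sh cs (intg_measurable iY) ihY.
have E : (fun n => Ex P (fun w => s n w * X w)) = (fun n => Ex P (fun w => s n w * Y w)).
  by apply/funext => n; exact: Ex_cond_exp_nnsfun.
rewrite E in cX; exact: (cvg_unique _ cX cY).
Qed.

(** [is_cond_exp] tests only against sets. Indicators, simple functions and nonnegative weights
    lead, by [h = hp - hn], to every adapted [h] with integrable products; this generality matters
    because the weights are coordinates of square-integrable vectors, possibly unbounded. *)
Lemma Ex_cond_exp X Y h : is_cond_exp P (sigma_gen S) X Y -> adapted S h ->
  intg P (fun w => h w * X w) -> intg P (fun w => h w * Y w) ->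
  Ex P (fun w => h w * X w) = Ex P (fun w => h w * Y w).
Proof.
move=> cXY ah ihX ihY; have [iX iY _ _] := cXY.
pose hp w := Num.max (h w) 0; pose hn w := Num.max (- h w) 0.
have hE w : h w = hp w - hn w.
  by rewrite /hp /hn; case: (leP 0 (h w)) => h0; case: leP => //; lra.
have ahp : adapted S hp by exact: measurable_funrpos.
have ahn : adapted S hn by exact: measurable_funrneg.
have b f k : measurable_fun setT f -> adapted S k ->
    (forall w, `|k w| <= `|h w|) -> intg P (fun w => h w * f w) ->
    intg P (fun w => k w * f w).
  move=> mf ak kh ihf; apply: (@intg_le _ _ _ _ _ (fun w => `|h w * f w|)).
  - by apply: measurable_funM => //; exact: adapted_measurable ak.
  - by move=> w; rewrite !normrM ler_wpM2r.
  - exact: (integrable_norm ihf).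
have hp0 w : 0 <= hp w by rewrite /hp le_max lexx orbT.
have hn0 w : 0 <= hn w by rewrite /hn le_max lexx orbT.
have hph w : `|hp w| <= `|h w|.
  by rewrite ger0_norm// /hp ge_max ler_norm normr_ge0.
have hnh w : `|hn w| <= `|h w|.
  by rewrite ger0_norm// /hn ge_max -normrN ler_norm normr_ge0.
have mX := intg_measurable iX; have mY := intg_measurable iY.
have E f : (fun w => h w * f w) = (fun w => hp w * f w - hn w * f w).
  by apply/funext => w; rewrite hE mulrBl.
rewrite !E !ExB; try by apply: b.
by congr (_ - _); apply: Ex_cond_exp_ge0 => //; exact: b.
Qed.

Lemma Ex_dot_cond_exp (p : nat) (X Y H : T -> 'rV[R]_p) :
  is_cond_exp_vec P (sigma_gen S) X Y ->
  random_vector (H : generated -> _) -> L2 P X -> L2 P Y -> L2 P H ->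
  Ex P (fun w => dot (H w) (X w)) = Ex P (fun w => dot (H w) (Y w)).
Proof.
move=> cXY /random_vectorP aH hX hY hH.
rewrite /dot !Ex_sum; [|by move=> c; exact: (L2_coordM c hH hY)
  |by move=> c; exact: (L2_coordM c hH hX)].
apply: eq_bigr => c _; apply: (Ex_cond_exp (h := fun w => H w 0 c) (cXY c)) => //.
- exact: aH.
- exact: (L2_coordM c hH hX).
- exact: (L2_coordM c hH hY).
Qed.

End ConditionalExpectation.

(** * The algorithm *)

Section OneStep.
Context {R : realType} {p : nat}.
Implicit Types (v y g s : 'rV[R]_p).

(* [xb] stands for the prox point of [y - eta *: gf], so that [xk - xb] is controlled
   by the gradient error [g - gf]; [fy], [Ps], ... are values of [f] and [psi]. *)
Lemma one_step (mu eta del ni LQ fy fk fs ft Pk Ps Pt : R) v y xt xk xb xs g gf :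
  0 < mu -> 0 < eta -> 0 < del -> del <= ni -> del <= 1 ->
  del ^+ 2 = 5 / 3 * ni * eta * mu -> LQ * eta <= 3^-1 ->
  (del * (1 - del)) *: (v - y) = (ni - del) *: (y - xt) ->
  eta * Pk + dot (y - eta *: g - xk) (xs - xk) <= eta * Ps ->
  eta * Pk + dot (y - eta *: g - xk) (xt - xk) <= eta * Pt ->
  fk <= fy + dot gf (xk - y) + LQ / 2 * sqnorm (xk - y) ->
  fy + dot gf (xs - y) + mu / 2 * sqnorm (xs - y) <= fs ->
  sqnorm (xk - xb) <= eta ^+ 2 * sqnorm (g - gf) ->
  mu / 2 * sqnorm ((1 - del) *: v + del *: y + (del / (mu * eta)) *: (xk - y) - xs)
    + ni * (fk + Pk)
  <= (1 - del) * (mu / 2 * sqnorm (v - xs)) + del * (fs + Ps) + (ni - del) * (ft + Pt)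
    - (ni - del) * (ft - fy - dot gf (xt - y)) + eta * ni * sqnorm (g - gf)
    + dot (g - gf) (del *: (xs - y) + (ni - del) *: (xt - y) - ni *: (xb - y)).
Proof.
move=> mu0 eta0 del0 delni del1 del2 LQeta rel ps pt desc sc nonexp.
have ni0 : 0 < ni by exact: lt_le_trans delni.
(* As [|xk - xb| <= eta |g - gf|], this exchanges [xk] for [xb] in the inner product with the
   error. *)
have : eta * ni * sqnorm (g - gf) + ni * dot (g - gf) (xk - xb) >= 0.
  have nonexp' : sqnorm (- (xk - xb)) <= eta ^+ 2 * sqnorm (g - gf) by rewrite sqnormN.
  have := dot_le_scaled eta0 nonexp'; rewrite dotNl dotC.
  rewrite -(ler_pM2l ni0); lra.
have vE : (1 - del) *: v + del *: y + (del / (mu * eta)) *: (xk - y) - xs =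
    (1 - del) *: (v - y) + (del / (mu * eta)) *: (xk - y) - (xs - y).
  by apply/rowP => c; rewrite !mxE; ring.
have uE z : dot (y - eta *: g - xk) (z - xk) =
    dot (- (xk - y) - eta *: g) ((z - y) - (xk - y)).
  by congr dot; apply/rowP => c; rewrite !mxE; ring.
have bE : xk - xb = (xk - y) - (xb - y) by apply/rowP => c; rewrite !mxE; ring.
have vsE : v - xs = (v - y) - (xs - y) by apply/rowP => c; rewrite !mxE; ring.
rewrite vE vsE bE; move: ps pt; rewrite !uE; move: rel desc sc.
rewrite -(opprB xt y).
move: (v - y) (xt - y) (xk - y) (xb - y) (xs - y) => a b c bb s rel desc sc ps pt.
set w := g - gf.
have gE z : dot g z = dot gf z + dot w z by rewrite -dotDl /w addrC subrK.
clearbody w.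
have ieE : eta^-1 * eta = 1 by rewrite mulVf ?gt_eqF.
have ieE' z : eta * (eta^-1 * z) = z by rewrite mulrA mulfV ?mul1r// gt_eqF.
have ie0 : 0 < eta^-1 by rewrite invr_gt0.
have desc' : LQ <= 3^-1 * eta^-1 by rewrite ler_pdivlMr.
have px z Pz : eta * Pk + dot (- c - eta *: g) (z - c) <= eta * Pz ->
    Pk + eta^-1 * (sqnorm c - dot c z) + dot g c - dot g z <= Pz.
  move=> h; rewrite -(ler_pM2l eta0); apply: le_trans h.
  rewrite !(dotDl, dotDr, dotNl, dotNr, dotZl) -sqnormE.
  by have := ieE' (sqnorm c - dot c z); rewrite !mulrDr !mulrN; lra.
have {}ps := px _ _ ps; have {}pt := px _ _ pt; rewrite !gE in ps pt.
have [k kdef] : exists k, k = del / (mu * eta) by exists (del / (mu * eta)).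
rewrite -kdef.
have kE : mu * k = del * eta^-1 by rewrite kdef; field; rewrite !gt_eqF.
(* Here 5 / 3 is tuned: with [c = xk - y], the new distance carries [5 / 6 * ni / eta] times [|c|^2]
   and the descent lemma at most [1 / 6 * ni / eta], which together exhaust the [ni / eta] supplied
   by the two proximal inequalities. *)
have k2E : mu * k ^+ 2 = 5 / 3 * ni * eta^-1.
  by rewrite kdef expr_div_n del2; field; rewrite !gt_eqF.
move: (eta^-1) ie0 kE k2E desc' ps pt => ie ie0 kE k2E desc' ps pt {px}.
(* The cross term between [v - y] and [xk - y] in the new distance becomes one with [xt - y], and
   cancels that of the proximal inequality at [xt]. *)
have {}rel : del * (1 - del) * dot a c = - (ni - del) * dot b c.
  by rewrite -dotZl rel dotZl dotNl mulrN mulNr.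
have e1 : mu * k * (1 - del) * dot a c = ie * (del * (1 - del) * dot a c).
  by rewrite kE; ring.
have e2 : mu * k ^+ 2 * sqnorm c = 5 / 3 * ni * ie * sqnorm c by rewrite k2E.
have e3 : mu * k * dot c s = del * ie * dot c s by rewrite kE.
(* Slack in [|(1 - del) a - s|^2 <= (1 - del) |a - s|^2 + del |s|^2]; the last term is paid by the
   strong convexity of [f]. *)
have i1 : 0 <= mu * (del * (1 - del)) * sqnorm a.
  by rewrite !mulr_ge0 ?sqnorm_ge0 ?subr_ge0 ?(ltW mu0) ?(ltW del0).
have i2 : ni * LQ * sqnorm c <= ni * (3^-1 * ie) * sqnorm c.
  by rewrite ler_wpM2r ?sqnorm_ge0// ler_pM2l.
have i3 := ler_wpM2l (ltW del0) ps.
have i4 : (ni - del) * (Pk + ie * (sqnorm c - dot c b) + (dot gf c + dot w c)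
  - (dot gf b + dot w b)) <= (ni - del) * Pt by rewrite ler_wpM2l// subr_ge0.
have i5 := ler_wpM2l (ltW ni0) desc.
have i6 := ler_wpM2l (ltW del0) sc.
rewrite rel in e1.
rewrite !(sqnormB, sqnormD, sqnormZ) !(dotDl, dotDr, dotNl, dotNr, dotZl, dotZr).
move=> young; move: young e1 e2 e3 i1 i2 i3 i4 i5 i6 {desc sc ps pt rel kE k2E desc' gE uE}.
rewrite (dotC b c).
move: (sqnorm a) (sqnorm b) (sqnorm c) (sqnorm s) (sqnorm w) (dot a c) (dot a s) (dot c s)
  (dot c b) (dot gf c) (dot gf s) (dot gf b) (dot w c) (dot w s) (dot w b) (dot w bb).
move=> *; lra.
Qed.

End OneStep.

(** * Events independent of the past *)

Section Independence.
Context {d : measure_display} {T : measurableType d} {R : realType}.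
Variable P : probability T R.
Variable S : set (T -> R).
Hypothesis mS : forall X, S X -> measurable_fun setT X.
Implicit Types (h : T -> R) (A B : set T) (c : R).

Lemma intg_indic B : measurable B -> intg P (\1_B).
Proof. by move=> mB; apply: integrable_indic; rewrite // ltey_eq fin_num_measure. Qed.

Lemma Ex_indic B : measurable B -> Ex P (\1_B) = fine (P B).
Proof. by move=> mB; rewrite /Ex /Rintegral integral_indic// setIT. Qed.

Lemma is_cond_exp_indic B c : measurable B ->
  (forall A, sigma_gen S A -> P (A `&` B) = (P A * c%:E)%E) ->
  is_cond_exp P (sigma_gen S) \1_B (cst c).
Proof.
move=> mB indep; split.
- exact: intg_indic.
- exact: intg_cst.
- move=> _ [C mC <-].
  have : adapted S (cst c : T -> R) by exact: measurable_cst.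
  by apply.
- move=> A SA; have mA := sigma_gen_measurable mS SA.
  have -> : (\int[P]_(w in A) (cst c w)%:E = c%:E * P A)%E by exact: (integral_cst P mA c%:E).
  by rewrite integral_indic// (setIC B A) muleC; exact: indep.
Qed.

Lemma Ex_indep B c h : measurable B ->
  (forall A, sigma_gen S A -> P (A `&` B) = (P A * c%:E)%E) ->
  adapted S h -> intg P h -> Ex P (fun w => \1_B w * h w) = c * Ex P h.
Proof.
move=> mB indep ah ih.
have := Ex_cond_exp mS (is_cond_exp_indic mB indep) ah.
under eq_fun do rewrite mulrC; under [in X in _ -> _ -> _ = X]eq_fun do rewrite mulrC.
move=> ->; [by rewrite ExZ | exact: indicM_intg |].
by under eq_fun do rewrite mulrC; exact: intgZ.
Qed.

End Independence.

(** * Functions of a random index *)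

Section Selection.
Context {d : measure_display} {T : measurableType d} {R : realType} {n p : nat}.
Variable P : probability T R.
Variable I : T -> 'I_n.
Hypothesis mI : forall i, measurable [set w | I w = i].

Lemma indic_eq i w : \1_[set w | I w = i] w = (I w == i)%:R :> R.
Proof.
rewrite indicE; congr (nat_of_bool _)%:R.
by apply/idP/eqP => [/set_mem|h]; [|exact: mem_set].
Qed.

(** Splitting over the finitely many values of the index reduces randomly indexed functions to fixed
    ones multiplied by indicators. *)
Lemma select_sum (F : 'I_n -> R) w :
  F (I w) = \sum_(i < n) \1_[set w | I w = i] w * F i.
Proof.
rewrite (bigD1 (I w))//= big1 => [|i iI]; first by rewrite addr0 indic_eq eqxx mul1r.
by rewrite indic_eq eq_sym (negbTE iI) mul0r.
Qed.

Lemma select_sumv (F : 'I_n -> 'rV[R]_p) w :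
  F (I w) = \sum_(i < n) \1_[set w | I w = i] w *: F i.
Proof.
apply/rowP => c; rewrite summxE (select_sum (fun i => F i 0 c)).
by apply: eq_bigr => i _; rewrite mxE.
Qed.

Lemma measurable_select (F : 'I_n -> T -> R) : (forall i, measurable_fun setT (F i)) ->
  measurable_fun setT (fun w => F (I w) w).
Proof.
move=> mF; under eq_fun do rewrite (select_sum (fun i => F i _)).
by apply: measurable_sum => i; apply: measurable_funM => //; exact: measurable_indic.
Qed.

Lemma random_vector_select (F : 'I_n -> T -> 'rV[R]_p) : (forall i, random_vector (F i)) ->
  random_vector (fun w => F (I w) w).
Proof.
move=> mF; under eq_fun do rewrite (select_sumv (fun i => F i _)).
apply: random_vector_sum => i; apply: random_vectorZ => //; exact: measurable_indic.
Qed.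

Lemma intg_select (F : 'I_n -> T -> R) : (forall i, intg P (F i)) ->
  intg P (fun w => F (I w) w).
Proof.
move=> iF; under eq_fun do rewrite (select_sum (fun i => F i _)).
by apply: intg_sum => i; exact: indicM_intg.
Qed.

Lemma Ex_select (F : 'I_n -> T -> R) : (forall i, intg P (F i)) ->
  Ex P (fun w => F (I w) w) = \sum_(i < n) Ex P (fun w => \1_[set w | I w = i] w * F i w).
Proof.
move=> iF; under eq_fun do rewrite (select_sum (fun i => F i _)).
by rewrite Ex_sum// => i; exact: indicM_intg.
Qed.

Lemma L2_select (F : 'I_n -> T -> 'rV[R]_p) : (forall i, L2 P (F i)) ->
  L2 P (fun w => F (I w) w).
Proof.
move=> hF; split; first by apply: random_vector_select => i; have [] := hF i.
by apply: (intg_select (F := fun i w => sqnorm (F i w))) => i; have [] := hF i.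
Qed.

End Selection.

(** * Perturbed gradients *)

Section Noise.
Context {d : measure_display} {T : measurableType d} {R : realType} {n p : nat}.
Variable P : probability T R.
Variables (fi : 'I_n -> 'rV[R]_p -> R) (L sd : 'I_n -> R).
Hypothesis sfi : forall i, smooth (L i) (fi i).
Variable S : set (T -> R).
Hypothesis mS : forall X, S X -> measurable_fun setT X.
Variable I : T -> 'I_n.
Hypothesis mI : forall i, measurable [set w | I w = i].
Variables X W : T -> 'rV[R]_p.
Hypotheses (hX : L2 P X) (mW : random_vector W)
  (noise : noisy_gradient P fi sd (sigma_gen S) I X W).

Let zeta w := W w - grad (fi (I w)) (X w).

Lemma L2_grad i : L2 P (fun w => grad (fi i) (X w)).
Proof.
apply: (@L2_lipschitz _ _ _ _ _ (grad (fi i)) (L i ^+ 2)) => // x y.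
exact: smooth_sqnorm.
Qed.

Lemma L2_grad_select : L2 P (fun w => grad (fi (I w)) (X w)).
Proof. by apply: (L2_select mI (F := fun i w => grad (fi i) (X w))) => i; exact: L2_grad. Qed.

Lemma noise_L2 : L2 P zeta.
Proof.
have mz : random_vector zeta by apply: random_vectorB => //; have [] := L2_grad_select.
split => //; apply/integrableP; split.
  by apply/measurable_EFinP; exact: measurable_sqnorm.
under eq_integral do rewrite /= ger0_norm ?sqnorm_ge0//.
have [_ /(_ setT)] := noise.
have sT : sigma_gen S setT.
  by have : measurable (setT : set (g_sigma_algebraType
    (\bigcup_(X in S) preimage_set_system setT X measurable))) by exact: measurableT.
move=> /(_ sT) /le_lt_trans; apply.
have : intg P (fun w => sd (I w) ^+ 2).
  by apply: (intg_select mI (F := fun i _ => sd i ^+ 2)) => i; exact: intg_cst.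
by move=> /EFin_Ex <-; exact: ltry.
Qed.

Lemma noisy_L2 : L2 P W.
Proof.
have := L2D noise_L2 L2_grad_select; congr L2.
by apply/funext => w; rewrite /zeta subrK.
Qed.

(** Used on the events where the sampled index equals [i] and, with a constant index, on the whole
    space and on the event that the anchor is refreshed. *)
Lemma noise_moment A i : sigma_gen S A -> (forall w, A w -> I w = i) ->
  Ex P (fun w => \1_A w * sqnorm (zeta w)) <= sd i ^+ 2 * fine (P A).
Proof.
move=> SA AI; have mA := sigma_gen_measurable mS SA.
have [_ /(_ _ SA)] := noise; rewrite (integral_indicM P (fun w => sqnorm (zeta w))).
rewrite -EFin_Ex; last by apply: indicM_intg => //; have [] := noise_L2.
rewrite (eq_integral (fun=> (sd i ^+ 2)%:E)); last by move=> w /set_mem /AI ->.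
have -> : (\int[P]_(w in A) (sd i ^+ 2)%:E)%E = (sd i ^+ 2 * fine (P A))%:E.
  rewrite [RHS]EFinM fineK ?fin_num_measure//; exact: (integral_cst P mA (sd i ^+ 2)%:E).
by rewrite lee_fin.
Qed.

Lemma noise_orthogonal (H : T -> 'rV[R]_p) :
  random_vector (H : g_sigma_algebraType
    (\bigcup_(X in S) preimage_set_system setT X measurable) -> _) -> L2 P H ->
  Ex P (fun w => dot (H w) (zeta w)) = 0.
Proof.
move=> aH hH; have [cz _] := noise.
rewrite (Ex_dot_cond_exp mS cz aH noise_L2 (L2_cst P 0) hH).
by under eq_fun do rewrite dot0r; exact: Ex_cst.
Qed.

End Noise.

(** Scalar core of quadratic growth at a minimizer: [ft] and [gt] stand for the values at the point
    with weight [t] on [z]. *)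
Lemma segment_growth (R : realType) (c t s fz fs ft gz gs gt : R) :
  fs + gs <= ft + gt -> ft <= t * fz + (1 - t) * fs - c * t * (1 - t) * s ->
  gt <= t * gz + (1 - t) * gs ->
  0 <= t * (fz + gz - (fs + gs) - c * s + t * (c * s)).
Proof. lra. Qed.

Lemma convex_combination_gt (R : realType) (t tol a b : R) :
  0 < t -> t <= 1 -> tol < a -> tol < b -> tol < t * a + (1 - t) * b.
Proof.
move=> t0 t1 ha hb.
have : t * tol < t * a by rewrite ltr_pM2l.
have : (1 - t) * tol <= (1 - t) * b by rewrite ler_wpM2l ?subr_ge0// ltW.
lra.
Qed.

Lemma prox_argument_sub (R : realType) (p : nat) (y g h : 'rV[R]_p) (eta : R) :
  (y - eta *: g) - (y - eta *: h) = - (eta *: (g - h)).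
Proof. by apply/rowP => c; rewrite !mxE; ring. Qed.

(** Both bounds on the step meet here: 1 / (3 L_Q) keeps the variance coefficient below
    [2 / 3 * ni], and 1 / (15 mu n) keeps [del] below [ni / 3]. The Bregman term of the one-step
    inequality therefore absorbs the variance. *)
Lemma step_budget (R : realType) (del LQ eta ni : R) : 0 < ni ->
  LQ * eta <= 3^-1 -> del <= 3^-1 * ni -> 2 * (LQ * (eta * ni)) <= ni - del.
Proof. by move=> n0 h; have := ler_wpM2r (ltW n0) h; lra. Qed.

Lemma descent_budget (R : realType) (U en D G LQ s c : R) :
  0 <= en -> 0 <= D -> G <= 2 * LQ * D + 3 * s -> 2 * (LQ * en) <= c ->
  U - c * D + en * G <= U + 3 * s * en.
Proof.
move=> en0 D0 hG hc; have := ler_wpM2l en0 hG; have := ler_wpM2r D0 hc; lra.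
Qed.

Section Execution.
Context {d : measure_display} {T : measurableType d} {R : realType} {p n : nat}.
Variable P : probability T R.
Variables (fi : 'I_n -> 'rV[R]_p -> R) (psi : 'rV[R]_p -> \bar R) (mu : R).
Variables (L q sd : 'I_n -> R) (eta : nat -> R) (xstar : 'rV[R]_p).
Variable e : execution T R p n.
Hypotheses (n0 : (0 < n)%N) (mu0 : 0 < mu)
  (cfi : forall i, convex_function setT (fi i))
  (sfi : forall i, smooth (L i) (fi i)) (muL : forall i, mu <= L i)
  (scf : strongly_convex mu (average fi))
  (psiNy : forall x, psi x != -oo%E) (cvx : econvex psi)
  (lsc : lower_semicontinuous psi)
  (q0 : forall i, 0 < q i) (q1 : \sum_(i < n) q i = 1)
  (fstar : psi xstar \is a fin_num)
  (xmin : forall x, (objective fi psi xstar <= objective fi psi x)%E)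
  (run : accelerated_random_svrg P fi psi mu q sd eta mu e)
  (eta0 : forall k, 0 < eta k.+1)
  (etaL : forall k, eta k.+1 <= (3 * L_Q L q)^-1)
  (etamu : forall k, eta k.+1 <= (15 * mu * n%:R)^-1).

Let nR0 : 0 < n%:R :> R. Proof. by rewrite ltr0n. Qed.

Local Notation x := (iter_x e).
Local Notation v := (iter_v e).
Local Notation xt := (anchor e).
Local Notation y := (iter_y mu eta e).
Local Notation del k := (delta e k.+1).
Local Notation g := (estimate q e).

Lemma gamma_mu k : gamma e k = mu.
Proof.
elim: k => [|k IH]; first exact: (gamma_0 run).
by rewrite (gamma_S run) IH; ring.
Qed.

Lemma delta_sqr k : del k ^+ 2 = 5 / 3 * n%:R^-1 * eta k.+1 * mu.
Proof.
rewrite (delta_S run) gamma_mu sqr_sqrtr; last first.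
  by rewrite divr_ge0 ?mulr_ge0 ?ltW.
by field; rewrite gt_eqF.
Qed.

Lemma delta_gt0 k : 0 < del k.
Proof.
by rewrite (delta_S run) gamma_mu sqrtr_gt0 divr_gt0// !mulr_gt0.
Qed.

(** With [eta <= 1 / (15 mu n)], the square of [delta] is at most [1 / (9 n^2)]. *)
Lemma delta_le k : del k <= 3^-1 * n%:R^-1.
Proof.
have h0 : 0 <= 3^-1 * n%:R^-1 :> R by rewrite mulr_ge0// invr_ge0 ltW.
rewrite -ler_sqr ?nnegrE ?(ltW (delta_gt0 k))// delta_sqr.
apply: (@le_trans _ _ (5 / 3 * n%:R^-1 * (15 * mu * n%:R)^-1 * mu)).
  by rewrite ler_wpM2r ?(ltW mu0)// ler_wpM2l// mulr_ge0// invr_ge0 ltW.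
by rewrite le_eqVlt; apply/orP; left; apply/eqP; field; rewrite !gt_eqF.
Qed.

Lemma ninv_le1 : n%:R^-1 <= 1 :> R.
Proof. by rewrite invf_le1// ler1n. Qed.

Lemma delta_le_ninv k : del k <= n%:R^-1.
Proof.
by apply: le_trans (delta_le k) _; rewrite ler_piMl ?invr_ge0 ?ltW//; lra.
Qed.

Lemma delta_le1 k : del k <= 1.
Proof. exact: le_trans (delta_le_ninv k) ninv_le1. Qed.

(** Substituting [5 mu eta = 3 n del^2] turns [theta] into [n del (1 - del) / (1 - n del^2)]. Both
    sides are multiples of [v - xt], so a scalar identity remains; the denominator is positive by
    [delta_le]. *)
Lemma theta_relation k w :
  (del k * (1 - del k)) *: (v k w - y k w) = (n%:R^-1 - del k) *: (y k w - xt k w).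
Proof.
have dn : n%:R * del k ^+ 2 < 1.
  have h1 : n%:R * del k <= 3^-1.
    by rewrite mulrC -ler_pdivlMr//; exact: delta_le.
  have := ler_wpM2r (ltW (delta_gt0 k)) h1; have := delta_le1 k; lra.
have E : 5 * mu * eta k.+1 = 3 * n%:R * del k ^+ 2.
  by rewrite delta_sqr; field; rewrite gt_eqF.
have tE : theta mu eta e k.+1 = n%:R * del k * (1 - del k) / (1 - n%:R * del k ^+ 2).
  by rewrite /theta E; field; rewrite !gt_eqF// ?subr_gt0//; lra.
have -> : v k w - y k w = (1 - theta mu eta e k.+1) *: (v k w - xt k w).
  by apply/rowP => c; rewrite !mxE; ring.
have -> : y k w - xt k w = theta mu eta e k.+1 *: (v k w - xt k w).
  by apply/rowP => c; rewrite !mxE; ring.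
rewrite !scalerA tE; congr (_ *: _); field.
by rewrite !gt_eqF ?subr_gt0.
Qed.

Lemma iter_vE k w : v k.+1 w = (1 - del k) *: v k w + del k *: y k w
  + (del k / (mu * eta k.+1)) *: (x k.+1 w - y k w).
Proof.
rewrite (iter_v_S run) gamma_mu; congr (_ *: _ + _ *: _ + _).
- by rewrite mulrAC divff ?mul1r// gt_eqF.
- by rewrite mulrAC divff ?mul1r// gt_eqF.
Qed.

(** Makes the prox operator a function on the whole space, so that measurability and square
    integrability of the iterates follow from its Lipschitz property. *)
Lemma prox_map k : exists2 phi : 'rV[R]_p -> 'rV[R]_p,
  (forall u, is_prox (eta k.+1) psi u (phi u)) &
  forall u u', sqnorm (phi u - phi u') <= 1 * sqnorm (u - u').
Proof.
have ex u : exists z, is_prox (eta k.+1) psi u z.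
  (* The first iterate, at an arbitrary outcome, is the one known prox point from which existence
     everywhere is deduced. *)
  exact: (prox_exists psiNy cvx lsc u (eta0 k) (eta0 0) (iter_x_S run 0 point) fstar).
exists (fun u => projT1 (cid (ex u))) => [u|u u']; first by case: cid.
rewrite mul1r; case: (cid (ex u)) => z pz; case: (cid (ex u')) => z' pz' /=.
exact: (prox_nonexpansive psiNy cvx (eta0 k) pz pz' (prox_fin psiNy (eta0 k) pz fstar)).
Qed.

Lemma iter_x_prox k (phi : 'rV[R]_p -> 'rV[R]_p) :
  (forall u, is_prox (eta k.+1) psi u (phi u)) ->
  x k.+1 = phi \o (fun w => y k w - eta k.+1 *: g k w).
Proof.
move=> hphi; apply/funext => w /=; have px := iter_x_S run k w.
apply/eqP; rewrite -subr_eq0; apply/eqP/sqnorm_le0.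
apply: (le_trans (prox_nonexpansive psiNy cvx (eta0 k) px (hphi _)
  (prox_fin psiNy (eta0 k) px fstar))).
by rewrite subrr sqnorm0.
Qed.

(** * Adaptedness of the iterates to the draws *)

Local Notation gen S :=
  (g_sigma_algebraType (\bigcup_(X in S) preimage_set_system setT X measurable)).
Local Notation adaptedv S X := (random_vector (X : gen S -> 'rV[R]_p)).

Lemma adaptedv_le (S S' : set (T -> R)) (X : T -> 'rV[R]_p) : (forall Y, S Y -> adapted S' Y) ->
  adaptedv S X -> adaptedv S' X.
Proof.
move=> SS /random_vectorP aX; apply/random_vectorP => c.
exact: (adapted_le SS (aX c)).
Qed.

Lemma adaptedv_sub (S S' : set (T -> R)) (X : T -> 'rV[R]_p) : S `<=` S' -> adaptedv S X -> adaptedv S' X.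
Proof. by move=> SS; apply: adaptedv_le => Y /SS; exact: adapted_gen. Qed.

Lemma adaptedv_gen (S : set (T -> R)) (X : T -> 'rV[R]_p) : coords X `<=` S -> adaptedv S X.
Proof.
by move=> XS; apply/random_vectorP => c; apply: adapted_gen; apply: XS; exists c.
Qed.

(** The index enters the sigma-algebras as a real variable, and the event is one of its level
    sets. *)
Lemma idx_gen k i (S : set (T -> R)) : S (fun w => (idx e k.+1 w)%:R) ->
  sigma_gen S [set w | idx e k.+1 w = i].
Proof.
move=> SI; have aI : adapted S (fun w => (idx e k.+1 w)%:R : R) by exact: adapted_gen.
have := aI measurableT [set (nat_of_ord i)%:R] (measurable_set1 _).
rewrite setTI; congr (sigma_gen S _); apply/seteqP; split=> w /=.
  by move=> /eqP; rewrite eqr_nat => /eqP/val_inj.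
by move=> ->.
Qed.

Lemma coin_gen k (S : set (T -> R)) : S (fun w => (coin e k.+1 w)%:R) ->
  sigma_gen S [set w | coin e k.+1 w].
Proof.
move=> SC; have aC : adapted S (fun w => (coin e k.+1 w)%:R : R) by exact: adapted_gen.
have := aC measurableT [set 1] (measurable_set1 _).
rewrite setTI; congr (sigma_gen S _); apply/seteqP; split=> w /=.
  by case: (coin e k.+1 w) => // /eqP; rewrite eq_sym oner_eq0.
by move=> ->.
Qed.

Lemma drawn_measurable k X : drawn e k X -> measurable_fun setT X.
Proof.
case=> [[|[j _ [i _]]]|[[//|j] /= _ [[[->|->]|]|]]].
- exact: (start_measurable run).
- exact: (draw_anchor_measurable run).
- exact: (measurable_select (idx_measurable run j) (F := fun i _ => i%:R : R)).
- rewrite (_ : (fun _ => _) = (\1_[set w | coin e j.+1 w] : T -> R)).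
    by apply: measurable_indic; exact: (coin_measurable run).
  apply/funext => w; rewrite indicE; congr (nat_of_bool _)%:R.
  by apply/idP/idP => [h|/set_mem//]; exact: mem_set.
- exact: (draw_y_measurable run).
- exact: (draw_xt_measurable run).
Qed.

Lemma drawn_idx_measurable k X : drawn_idx e k X -> measurable_fun setT X.
Proof.
case=> [|->]; first exact: drawn_measurable.
exact: (measurable_select (idx_measurable run k) (F := fun i _ => i%:R : R)).
Qed.

Lemma drawn_y_measurable k X : drawn_y e k X -> measurable_fun setT X.
Proof.
case; [exact: drawn_idx_measurable | exact: (draw_y_measurable run)].
Qed.

Lemma drawn_xt_measurable k X : drawn_xt e k X -> measurable_fun setT X.
Proof.
case; [exact: drawn_y_measurable | exact: (draw_xt_measurable run)].
Qed.

Lemma drawn_S k : drawn_coin e k `|`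
  (\bigcup_(i in [set: 'I_n]) coords (draw_anchor e k.+1 i)) `<=` drawn e k.+1.
Proof.
move=> X [[[[[[[X0|[j jk Xj]]|[j jk Xj]]|->]|XY]|XT]|->]|XA].
- by left; left.
- by left; right; exists j => //; exact: leqW jk.
- by right; exists j => //=; move: jk => /= /andP[-> /leqW ->].
- by right; exists k.+1 => /=; [rewrite leqnn | do 3 left].
- by right; exists k.+1 => /=; [rewrite leqnn | left; right].
- by right; exists k.+1 => /=; [rewrite leqnn | right].
- by right; exists k.+1 => /=; [rewrite leqnn | left; left; right].
- by left; right; exists k.+1 => //=.
Qed.

Lemma drawn_coin_measurable k X : drawn_coin e k X -> measurable_fun setT X.
Proof. by move=> h; apply: (@drawn_measurable k.+1); apply: drawn_S; left. Qed.

Definition drawn_adapted k := [/\ adaptedv (drawn e k) (x k), adaptedv (drawn e k) (v k),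
  adaptedv (drawn e k) (xt k) & adaptedv (drawn e k) (zbar e k)].

Lemma iter_y_adapted (S : set (T -> R)) k : adaptedv S (v k) -> adaptedv S (xt k) -> adaptedv S (y k).
Proof. by move=> av at_; apply: random_vectorD; exact: random_vectorZc. Qed.

Lemma estimate_adapted k : drawn_adapted k -> adaptedv (drawn_xt e k) (g k).
Proof.
move=> [_ _ _ az]; apply: random_vectorD; last first.
  by apply: adaptedv_sub az => X; do 3 left.
apply: random_vectorZ; last first.
  by apply: random_vectorB; apply: adaptedv_gen => X; [left; right | right].
have mI i : sigma_gen (drawn_xt e k) [set w | idx e k.+1 w = i].
  by apply: idx_gen; left; left; right.
exact: (@measurable_select _ (gen (drawn_xt e k)) _ _ (idx e k.+1) mI
  (fun i _ => (q i * n%:R)^-1)).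
Qed.

Lemma iter_x_adapted k : drawn_adapted k -> adaptedv (drawn_xt e k) (x k.+1).
Proof.
move=> ak; have [_ av at_ _] := ak; have ag := estimate_adapted ak.
have [phi hphi lphi] := prox_map k; rewrite (iter_x_prox hphi).
apply: (random_vector_lipschitz lphi); apply: random_vectorB.
  apply: (@adaptedv_sub (drawn e k)); first by move=> X; do 3 left.
  exact: iter_y_adapted.
exact: random_vectorZc.
Qed.

Lemma anchor_gradient_adapted k : adaptedv (drawn e k) (anchor_gradient e k).
Proof.
apply: random_vectorZc; apply: random_vector_sum => i.
by apply: adaptedv_gen => X Xi; left; right; exists k => //=; exists i.
Qed.

Lemma drawn_adaptedP k : drawn_adapted k.
Proof.
elim: k => [|k IH].
  have a0 : adaptedv (drawn e 0) (x 0) by apply: adaptedv_gen => X; do 2 left.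
  split=> //; first by rewrite (iter_v_0 run).
    by rewrite (anchor_0 run).
  by rewrite (zbar_0 run); exact: anchor_gradient_adapted.
have [ax av at_ az] := IH.
have up X : adaptedv (drawn_xt e k) X -> adaptedv (drawn e k.+1) X.
  by apply: adaptedv_sub => Y ?; apply: drawn_S; do 2 left.
have up' X : adaptedv (drawn e k) X -> adaptedv (drawn e k.+1) X.
  by move=> aX; apply: up; apply: adaptedv_sub aX => Y; do 3 left.
have ax1 := up _ (iter_x_adapted IH).
have mc : sigma_gen (drawn e k.+1) [set w | coin e k.+1 w].
  by apply: coin_gen; apply: drawn_S; left; right.
split=> //.
- rewrite (_ : v k.+1 = fun w => (1 - del k) *: v k w + del k *: y k w
    + (del k / (mu * eta k.+1)) *: (x k.+1 w - y k w)); last first.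
    by apply/funext => w; exact: iter_vE.
  have ay : adaptedv (drawn e k.+1) (y k) by apply: iter_y_adapted; exact: up'.
  apply: random_vectorD; last by apply: random_vectorZc; exact: random_vectorB.
  by apply: random_vectorD; apply: random_vectorZc => //; exact: up'.
- rewrite (_ : xt k.+1 = fun w => if coin e k.+1 w then x k.+1 w else xt k w).
    by apply: random_vector_if => //; exact: up'.
  by apply/funext => w; exact: (anchor_S run).
- rewrite (_ : zbar e k.+1 =
    fun w => if coin e k.+1 w then anchor_gradient e k.+1 w else zbar e k w).
    by apply: random_vector_if => //; [exact: anchor_gradient_adapted | exact: up'].
  by apply/funext => w; exact: (zbar_S run).
Qed.

(** * Square integrability of a run from a possibly random start *)

Hypotheses (hx0 : L2 P (x 0)) (psi0 : forall w, psi (x 0 w) \is a fin_num)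
  (ipsi0 : intg P (fun w => fine (psi (x 0 w)))).

Local Notation f := (average fi).
Local Notation LQ := (L_Q L q).
Local Notation s2 := (noise_level q sd).
Local Notation ni := (n%:R^-1 : R).
Local Notation gf := (grad (average fi)).

Let ni0 : 0 < ni. Proof. by rewrite invr_gt0. Qed.

Definition square_integrable k := [/\ L2 P (x k), L2 P (v k), L2 P (xt k) & L2 P (zbar e k)].

Let mcst (i j : 'I_n) : measurable [set w : T | i = j].
Proof.
have [->|ij] := pselect (i = j).
  by rewrite (_ : mkset _ = setT)//; apply/seteqP; split.
rewrite (_ : mkset _ = set0); first exact: measurable0.
by apply/seteqP; split.
Qed.

Lemma L2_draw_anchor0 i : L2 P (draw_anchor e 0 i).
Proof.
have mS X : coords (x 0) X -> measurable_fun setT X by exact: (start_measurable run).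
apply: (noisy_L2 sfi (mcst i) _ _ (anchor0_noise run i)) => //.
- by rewrite (anchor_0 run).
- exact: (draw_anchor_measurable run).
Qed.

Lemma L2_draw_anchor k i : L2 P (xt k.+1) -> L2 P (draw_anchor e k.+1 i).
Proof.
move=> hxt; apply: (noisy_L2 sfi (mcst i) hxt _ (anchor_noise run k i)).
exact: (draw_anchor_measurable run).
Qed.

Lemma L2_draw_y k : L2 P (y k) -> L2 P (draw_y e k.+1).
Proof.
move=> hy; apply: (noisy_L2 sfi (idx_measurable run k) hy _ (draw_y_noise run k)).
exact: (draw_y_measurable run).
Qed.

Lemma L2_draw_xt k : L2 P (xt k) -> L2 P (draw_xt e k.+1).
Proof.
move=> hy; apply: (noisy_L2 sfi (idx_measurable run k) hy _ (draw_xt_noise run k)).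
exact: (draw_xt_measurable run).
Qed.

Lemma L2_scale_idx k (X : T -> 'rV[R]_p) : L2 P X ->
  L2 P (fun w => (q (idx e k.+1 w) * n%:R)^-1 *: X w).
Proof.
move=> hX; apply: (L2_select (idx_measurable run k)
  (F := fun i w => (q i * n%:R)^-1 *: X w)) => i.
exact: L2Zc.
Qed.

Lemma L2_y k : L2 P (v k) -> L2 P (xt k) -> L2 P (y k).
Proof. by move=> hv hxt; apply: L2D; exact: L2Zc. Qed.

Lemma L2_estimate k : square_integrable k -> L2 P (g k).
Proof.
move=> [hx hv hxt hz]; apply: L2D => //; apply: L2_scale_idx.
by apply: L2B; [apply: L2_draw_y; exact: L2_y | exact: L2_draw_xt].
Qed.

(** Lipschitz prox maps and gradients, importance weights with finitely many values, and noise of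
    bounded second moment all preserve square integrability. *)
Lemma square_integrableP k : square_integrable k.
Proof.
elim: k => [|k IH].
  split=> //; rewrite ?(iter_v_0 run) ?(anchor_0 run) ?(zbar_0 run)//.
  by apply: L2Zc; apply: L2_sum => i; exact: L2_draw_anchor0.
have [hx hv hxt hz] := IH; have hg := L2_estimate IH; have hy := L2_y hv hxt.
have [phi hphi lphi] := prox_map k.
have hx1 : L2 P (x k.+1).
  rewrite (iter_x_prox hphi); apply: (L2_lipschitz lphi).
  by apply: L2B => //; exact: L2Zc.
have hxt1 : L2 P (xt k.+1).
  rewrite (_ : xt k.+1 = fun w => if coin e k.+1 w then x k.+1 w else xt k w).
    by apply: L2_if => //; exact: (coin_measurable run).
  by apply/funext => w; exact: (anchor_S run).
split=> //.
- rewrite (_ : v k.+1 = fun w => (1 - del k) *: v k w + del k *: y k w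
    + (del k / (mu * eta k.+1)) *: (x k.+1 w - y k w)); last first.
    by apply/funext => w; exact: iter_vE.
  by apply: L2D; [apply: L2D; exact: L2Zc | apply: L2Zc; exact: L2B].
- rewrite (_ : zbar e k.+1 =
    fun w => if coin e k.+1 w then anchor_gradient e k.+1 w else zbar e k w).
    apply: L2_if => //; first exact: (coin_measurable run).
    by apply: L2Zc; apply: L2_sum => i; exact: L2_draw_anchor.
  by apply/funext => w; exact: (zbar_S run).
Qed.

Let hx k : L2 P (x k). Proof. by have [] := square_integrableP k. Qed.
Let hv k : L2 P (v k). Proof. by have [] := square_integrableP k. Qed.
Let hxt k : L2 P (xt k). Proof. by have [] := square_integrableP k. Qed.
Let hz k : L2 P (zbar e k). Proof. by have [] := square_integrableP k. Qed.
Let hy k : L2 P (y k). Proof. exact: L2_y. Qed.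
Let hg k : L2 P (g k). Proof. by apply: L2_estimate; exact: square_integrableP. Qed.

(** The constant is crude; it is meant only for measurability and square integrability of the
    gradient along the iterates. *)
Lemma grad_average_lipschitz : exists C : R,
  forall a b, sqnorm (gf a - gf b) <= C * sqnorm (a - b).
Proof.
exists (\sum_(i < n) ((q i)^-1 * ni ^+ 2 * L i ^+ 2)) => a b.
have -> : gf a - gf b = \sum_(i < n) ni *: (grad (fi i) a - grad (fi i) b).
  by rewrite !(grad_average sfi) -scalerBr -sumrB scaler_sumr.
apply: le_trans (jensen_sqnorm _ q0 q1) _.
rewrite mulr_suml; apply: ler_sum => i _; rewrite sqnormZ.
rewrite [leLHS]mulrA -[leRHS]mulrA ler_wpM2l ?smooth_sqnorm//.
by rewrite mulr_ge0 ?sqr_ge0// invr_ge0 ltW.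
Qed.

Lemma L2_gf (X : T -> 'rV[R]_p) : L2 P X -> L2 P (fun w => gf (X w)).
Proof. by have [C hC] := grad_average_lipschitz; exact: L2_lipschitz hC. Qed.

Lemma gf_adapted (S : set (T -> R)) (X : T -> 'rV[R]_p) : adaptedv S X -> adaptedv S (fun w => gf (X w)).
Proof. by have [C hC] := grad_average_lipschitz; exact: random_vector_lipschitz hC. Qed.

(** * Second moment of the estimation error *)

Lemma noise_levelE : s2 = \sum_(i < n) (q i * n%:R ^+ 2)^-1 * sd i ^+ 2.
Proof.
rewrite /noise_level mulr_sumr; apply: eq_bigr => i _.
by field; rewrite !gt_eqF.
Qed.

Lemma noise_level_ge0 : 0 <= s2.
Proof.
rewrite noise_levelE; apply: sumr_ge0 => i _.
by rewrite mulr_ge0 ?sqr_ge0// invr_ge0 mulr_ge0 ?ltW// exprn_gt0.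
Qed.

Let noise_anchor k i w := draw_anchor e k i w - grad (fi i) (xt k w).

Let L2_noise_anchor k i : L2 P (noise_anchor k i).
Proof.
apply: L2B; last exact: (L2_grad sfi (hxt k)).
by case: k => [|k]; [exact: L2_draw_anchor0 | exact: L2_draw_anchor].
Qed.

Lemma anchor_error_le k w : sqnorm (anchor_gradient e k w - gf (xt k w)) <=
  \sum_(i < n) (q i * n%:R ^+ 2)^-1 * sqnorm (noise_anchor k i w).
Proof.
have -> : anchor_gradient e k w - gf (xt k w) = \sum_(i < n) ni *: noise_anchor k i w.
  by rewrite (grad_average sfi) -scalerBr -sumrB scaler_sumr.
apply: le_trans (jensen_sqnorm _ q0 q1) _.
apply: ler_sum => i _; rewrite sqnormZ mulrA ler_wpM2r ?sqnorm_ge0//.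
by rewrite le_eqVlt; apply/orP; left; apply/eqP; field; rewrite !gt_eqF.
Qed.

Let salgT (S : set (T -> R)) : sigma_gen S (setT : set T).
Proof.
by have : measurable (setT : set (gen S)) by exact: measurableT.
Qed.

Let zerr k w := zbar e k w - gf (xt k w).
Let hzerr k : L2 P (zerr k). Proof. by apply: L2B => //; exact: L2_gf. Qed.

(** At each iteration the error is renewed with probability 1/n or kept. As the coin is independent
    of the kept error, the bound for the next error is a convex combination of [s2] and the previous
    bound. *)
Lemma zbar_variance k : Ex P (fun w => sqnorm (zerr k w)) <= s2.
Proof.
have mdraw j i : random_vector (draw_anchor e j i) by exact: (draw_anchor_measurable run).
elim: k => [|k IH].
  apply: (@le_trans _ _ (Ex P (fun w =>
      \sum_(i < n) (q i * n%:R ^+ 2)^-1 * sqnorm (noise_anchor 0 i w)))).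
    apply: Ex_le => [||w].
    - by have [] := hzerr 0.
    - by apply: intg_sum => i; apply: intgZ; have [] := L2_noise_anchor 0 i.
    - by rewrite /zerr (zbar_0 run) anchor_error_le.
  rewrite Ex_sum; last by move=> i; apply: intgZ; have [] := L2_noise_anchor 0 i.
  rewrite noise_levelE; apply: ler_sum => i _; rewrite ExZ; last first.
    by have [] := L2_noise_anchor 0 i.
  rewrite ler_wpM2l//; first by rewrite invr_ge0 mulr_ge0 ?ltW// exprn_gt0.
  have mS X : coords (x 0) X -> measurable_fun setT X by exact: (start_measurable run).
  have h0 : L2 P (anchor e 0) by [].
  have := noise_moment sfi mS (mcst i) h0 (mdraw 0 i)
    (anchor0_noise run i) (@salgT _) (fun _ _ => erefl i).
  rewrite (_ : fine (P setT) = 1); last exact: (congr1 fine (probability_setT P)).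
  have E1 (h : T -> R) : (fun w => \1_[set: T] w * h w) = h.
    by apply/funext => w; rewrite indicE in_setT mul1r.
  rewrite mulr1 E1; exact.
pose C := [set w | coin e k.+1 w].
have mC : measurable C by exact: (coin_measurable run).
have mSc := @drawn_coin_measurable k; have mSx := @drawn_xt_measurable k.
have indep A : sigma_gen (drawn_xt e k) A -> P (A `&` C) = (P A * ni%:E)%E.
  exact: (coin_law run).
have PC : fine (P C) = ni.
  have := indep _ (@salgT (drawn_xt e k)).
  rewrite setTI => h; rewrite (h : P C = _).
  by rewrite (_ : P setT = 1%E) ?mul1e//; exact: (probability_setT P).
have iN i : intg P (fun w => \1_C w * sqnorm (noise_anchor k.+1 i w)).
  by have [_ iNi] := L2_noise_anchor k.+1 i; exact: indicM_intg iNi.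
pose A w := \sum_(i < n) (q i * n%:R ^+ 2)^-1 * (\1_C w * sqnorm (noise_anchor k.+1 i w)).
have iA : intg P A by apply: intg_sum => i; exact: intgZ (iN i).
have iz : intg P (fun w => sqnorm (zerr k w)) by have [] := hzerr k.
have icz : intg P (fun w => \1_C w * sqnorm (zerr k w)) by exact: indicM_intg.
have step : Ex P (fun w => sqnorm (zerr k.+1 w)) <=
    Ex P (fun w => A w + (sqnorm (zerr k w) - \1_C w * sqnorm (zerr k w))).
  apply: Ex_le => [||w].
  - by have [] := hzerr k.+1.
  - by apply: intgD => //; exact: intgB.
  rewrite /A /zerr (zbar_S run) (anchor_S run).
  rewrite indicE; have [c|c] := boolP (coin e k.+1 w).
    rewrite mem_set// !mul1r subrr addr0.
    have := anchor_error_le k.+1 w; rewrite (anchor_S run) c => h.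
    apply: le_trans h _; apply: ler_sum => i _.
    by rewrite /noise_anchor (anchor_S run) c mul1r.
  rewrite memNset//=; last by apply/negP.
  rewrite mul0r subr0 lerDr; apply: sumr_ge0 => i _.
  by rewrite mul0r mulr0.
apply: le_trans step _; rewrite ExD//; last exact: intgB.
rewrite ExB// (Ex_indep mSx mC indep) //; last first.
  apply: measurable_sqnorm; have [_ _ at_ az] := drawn_adaptedP k.
  have sub : drawn e k `<=` drawn_xt e k by move=> X; do 3 left.
  apply: random_vectorB; first exact: (adaptedv_sub sub az).
  by apply: gf_adapted; exact: (adaptedv_sub sub at_).
have EA : Ex P A <= ni * s2.
  rewrite (Ex_sum _ (fun i => intgZ _ (iN i))).
  rewrite noise_levelE mulr_sumr; apply: ler_sum => i _.
  rewrite (ExZ _ (iN i)).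
  rewrite [leRHS]mulrCA ler_wpM2l//; first by rewrite invr_ge0 mulr_ge0 ?ltW// exprn_gt0.
  (* The fresh perturbations are controlled given the coin too, so their second moment can be
     bounded on the refresh event alone, whose probability gives the factor 1/n. *)
  have gC : sigma_gen (drawn_coin e k) C by apply: coin_gen; right.
  have := noise_moment sfi mSc (mcst i) (hxt k.+1) (mdraw k.+1 i)
    (anchor_noise run k i) gC (fun _ _ => erefl i).
  by rewrite PC mulrC.
have : 0 <= (1 - ni) * (s2 - Ex P (fun w => sqnorm (zerr k w))).
  by rewrite mulr_ge0// subr_ge0// ninv_le1.
lra.
Qed.

(** Bregman divergence of the average at the anchor relative to [y]. *)
Let descr (k : nat) (w : T) : R :=
  f (xt k w) - f (y k w) - dot (gf (y k w)) (xt k w - y k w).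

(** Strong convexity below and the descent lemma above, both at [xstar], dominate [f] by an
    integrable quadratic. *)
Lemma intg_f (X : T -> 'rV[R]_p) : L2 P X -> intg P (fun w => f (X w)).
Proof.
move=> hX; have [mX _] := hX; have hXs := L2B hX (L2_cst P xstar).
have cf : continuous f.
  by move=> z; apply: differentiable_continuous; exact: (differentiable_average sfi).
apply: (@intg_le _ _ _ _ _ (fun w => `|f xstar| + `|dot (cst (gf xstar) w) (X w - xstar)|
   + LQ / 2 * sqnorm (X w - xstar))).
- exact: measurable_continuous_comp.
- move=> w /=.
  have up := average_descent n0 mu0 q0 q1 muL sfi xstar (X w).
  have lo := strongly_convex_grad (X w) (differentiable_average sfi xstar) scf.
  have h1 := ler_norm (f xstar); have h2 := ler_norm (- f xstar).
  have h3 := ler_norm (dot (gf xstar) (X w - xstar)).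
  have h4 := ler_norm (- dot (gf xstar) (X w - xstar)).
  rewrite !normrN in h2 h4.
  have h5 : 0 <= LQ / 2 * sqnorm (X w - xstar).
    by rewrite mulr_ge0 ?sqnorm_ge0// divr_ge0// ltW// (L_Q_gt0 n0 mu0 q0 muL).
  have h6 : 0 <= mu / 2 * sqnorm (X w - xstar) by rewrite mulr_ge0 ?sqnorm_ge0// divr_ge0// ltW.
  by rewrite ler_norml; apply/andP; split; lra.
- apply: intgD; last by apply: intgZ; have [] := hXs.
  apply: intgD; first exact: intg_cst.
  exact: (integrable_norm (intg_dot (L2_cst P (gf xstar)) hXs)).
Qed.

Lemma intg_descr k : intg P (descr k).
Proof.
apply: intgB; first by apply: intgB; exact: intg_f.
by apply: intg_dot; [exact: L2_gf | exact: L2B].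
Qed.

Let weighted k w : R := (q (idx e k.+1 w) * n%:R)^-1.
Let noise_y k w := draw_y e k.+1 w - grad (fi (idx e k.+1 w)) (y k w).
Let noise_xt k w := draw_xt e k.+1 w - grad (fi (idx e k.+1 w)) (xt k w).
(** Error of the estimate with the index frozen at [i] and both fresh perturbations removed; the
    noise stored at the anchor remains, through [zerr]. *)
Let snapshot_diff k i w :=
  (q i * n%:R)^-1 *: (grad (fi i) (y k w) - grad (fi i) (xt k w))
  - (gf (y k w) - gf (xt k w)) + zerr k w.

Let L2_snapshot_diff k i : L2 P (snapshot_diff k i).
Proof.
apply: L2D => //; apply: L2B.
  by apply: L2Zc; apply: L2B; exact: (L2_grad sfi).
by apply: L2B; exact: L2_gf.
Qed.

Lemma idx_prob k i A : sigma_gen (drawn e k) A ->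
  P (A `&` [set w | idx e k.+1 w = i]) = (P A * (q i)%:E)%E.
Proof. exact: (idx_law run). Qed.

Lemma idx_probT k i : fine (P [set w | idx e k.+1 w = i]) = q i.
Proof.
have := idx_prob i (@salgT (drawn e k)); rewrite setTI => h.
rewrite (h : P [set w | idx e k.+1 w = i] = _).
by rewrite (_ : P setT = 1%E) ?mul1e//; exact: (probability_setT P).
Qed.

Lemma Ex_idx k (F : 'I_n -> T -> R) : (forall i, intg P (F i)) ->
  (forall i, adapted (drawn e k) (F i)) ->
  Ex P (fun w => F (idx e k.+1 w) w) = Ex P (fun w => \sum_(i < n) q i * F i w).
Proof.
move=> iF aF; rewrite (Ex_select (idx_measurable run k) iF).
rewrite Ex_sum; last by move=> i; exact: intgZ.
apply: eq_bigr => i _; rewrite ExZ//.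
by apply: (Ex_indep (@drawn_measurable k) (idx_measurable run k i) (idx_prob i)).
Qed.

(** Index [i] occurs with probability [q i], and [q i * (q i * n)^-2] is the coefficient
    [(q i * n^2)^-1] of [sd i ^+ 2] in the noise level. *)
Lemma weighted_noise_moment k (S : set (T -> R)) (X W : T -> 'rV[R]_p) :
  (forall Y, S Y -> measurable_fun setT Y) -> S (fun w => (idx e k.+1 w)%:R) ->
  L2 P X -> random_vector W ->
  noisy_gradient P fi sd (sigma_gen S) (idx e k.+1) X W ->
  Ex P (fun w => sqnorm (weighted k w *: (W w - grad (fi (idx e k.+1 w)) (X w)))) <= s2.
Proof.
move=> mS SI hX mW noise; have mI := idx_measurable run k.
have [_ iz] := noise_L2 sfi mI hX mW noise.
under eq_fun do rewrite sqnormZ.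
rewrite (Ex_select mI (F := fun i w => (q i * n%:R)^-1 ^+ 2 *
  sqnorm (W w - grad (fi (idx e k.+1 w)) (X w)))); last by move=> i; exact: intgZ.
rewrite noise_levelE; apply: ler_sum => i _.
rewrite (_ : (fun w => _) = (fun w => (q i * n%:R)^-1 ^+ 2 * (\1_[set w | idx e k.+1 w = i] w *
  sqnorm (W w - grad (fi (idx e k.+1 w)) (X w))))); last first.
  by apply/funext => w; rewrite mulrCA.
rewrite ExZ; last exact: indicM_intg.
have := noise_moment sfi mS mI hX mW noise (idx_gen i SI) (fun _ h => h).
rewrite idx_probT => h.
apply: (@le_trans _ _ ((q i * n%:R)^-1 ^+ 2 * (sd i ^+ 2 * q i))).
  by rewrite ler_wpM2l ?sqr_ge0.
by rewrite le_eqVlt; apply/orP; left; apply/eqP; field; rewrite !gt_eqF.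
Qed.

Lemma Ex_sqnormD (X Y : T -> 'rV[R]_p) : L2 P X -> L2 P Y ->
  Ex P (fun w => dot (X w) (Y w)) = 0 ->
  Ex P (fun w => sqnorm (X w + Y w)) = Ex P (fun w => sqnorm (X w)) + Ex P (fun w => sqnorm (Y w)).
Proof.
move=> hX hY h0; have [_ iX] := hX; have [_ iY] := hY; have iXY := intg_dot hX hY.
under eq_fun do rewrite sqnormD.
rewrite ExD ?ExD ?ExZ ?h0 ?mulr0 ?addr0//; try exact: intgZ.
by apply: intgD => //; exact: intgZ.
Qed.

(** Moves the importance weight onto the factor known before the draw, so that orthogonality applies
    to the bare perturbation. *)
Let scaled_dotC k (X Z : T -> 'rV[R]_p) :
  (fun w => dot (X w) (weighted k w *: Z w)) = (fun w => dot (weighted k w *: X w) (Z w)).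
Proof. by apply/funext => w; rewrite dotZl dotZr. Qed.

Lemma weighted_adapted k (S : set (T -> R)) (X : T -> 'rV[R]_p) :
  S (fun w => (idx e k.+1 w)%:R) -> adaptedv S X -> adaptedv S (fun w => weighted k w *: X w).
Proof.
move=> SI; apply: random_vectorZ.
exact: (@measurable_select _ (gen S) _ _ (idx e k.+1) (fun i => idx_gen i SI)
  (fun i _ => (q i * n%:R)^-1)).
Qed.

Lemma grad_select_adapted k (S : set (T -> R)) (X : T -> 'rV[R]_p) :
  S (fun w => (idx e k.+1 w)%:R) -> adaptedv S X ->
  adaptedv S (fun w => grad (fi (idx e k.+1 w)) (X w)).
Proof.
move=> SI aX; apply: (@random_vector_select _ (gen S) _ _ _ (idx e k.+1)
  (fun i => idx_gen i SI) (fun i w => grad (fi i) (X w))) => i.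
apply: (@random_vector_lipschitz _ _ _ _ (grad (fi i)) (L i ^+ 2)) aX => a b.
exact: smooth_sqnorm.
Qed.

(** The three [s2] come from the draw at [y], the draw at the anchor and the stored average. Each
    fresh perturbation is orthogonal to the sum of the terms before it: [A] is known once the index
    is, and [A] plus the noise at [y] is known before the draw at the anchor. *)
Lemma estimate_variance k : Ex P (fun w => sqnorm (g k w - gf (y k w)))
  <= 2 * LQ * Ex P (descr k) + 3 * s2.
Proof.
have mI := idx_measurable run k.
have my : random_vector (draw_y e k.+1) by exact: (draw_y_measurable run).
have mxt : random_vector (draw_xt e k.+1) by exact: (draw_xt_measurable run).
have ny := draw_y_noise run k; have nxt := draw_xt_noise run k.
have [ax av at_ az] := drawn_adaptedP k.
have ay : adaptedv (drawn e k) (y k) by exact: iter_y_adapted.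
have SIi : drawn_idx e k (fun w => (idx e k.+1 w)%:R) by right.
have SIy : drawn_y e k (fun w => (idx e k.+1 w)%:R) by left.
pose A w := snapshot_diff k (idx e k.+1 w) w.
have hA : L2 P A by apply: (L2_select mI (F := snapshot_diff k)).
have hny : L2 P (noise_y k) := noise_L2 sfi mI (hy k) my ny.
have hnx : L2 P (noise_xt k) := noise_L2 sfi mI (hxt k) mxt nxt.
have hN1 : L2 P (fun w => weighted k w *: noise_y k w) by exact: L2_scale_idx.
have hN2 : L2 P (fun w => weighted k w *: noise_xt k w) by exact: L2_scale_idx.
have hAN1 := L2D hA hN1.
have up (X : T -> 'rV[R]_p) : adaptedv (drawn e k) X -> adaptedv (drawn_idx e k) X.
  by apply: adaptedv_sub => Z; left.
have aSi (i : 'I_n) : adaptedv (drawn e k) (snapshot_diff k i).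
  have agr (X : T -> 'rV[R]_p) : adaptedv (drawn e k) X ->
      adaptedv (drawn e k) (fun w => grad (fi i) (X w)).
    move=> aX; apply: (@random_vector_lipschitz _ _ _ _ (grad (fi i)) (L i ^+ 2)) aX => a b.
    exact: smooth_sqnorm.
  apply: random_vectorD; last by apply: random_vectorB => //; exact: gf_adapted.
  apply: random_vectorB; last by apply: random_vectorB; exact: gf_adapted.
  by apply: random_vectorZc; apply: random_vectorB; exact: agr.
have aA : adaptedv (drawn_idx e k) A.
  apply: (@random_vector_select _ (gen (drawn_idx e k)) _ _ _ (idx e k.+1)
    (fun i => idx_gen i SIi) (snapshot_diff k)) => i.
  exact: up.
have gE : (fun w => sqnorm (g k w - gf (y k w))) =
    (fun w => sqnorm ((A w + weighted k w *: noise_y k w)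
       + (- (weighted k w *: noise_xt k w)))).
  apply/funext => w; congr sqnorm; rewrite /A /snapshot_diff /noise_y /noise_xt /zerr
    /estimate -/(weighted k w).
  by apply/rowP => c; rewrite !mxE; ring.
have oy : Ex P (fun w => dot (A w) (weighted k w *: noise_y k w)) = 0.
  rewrite scaled_dotC.
  apply: (noise_orthogonal sfi (@drawn_idx_measurable k) mI (hy k) my ny).
    exact: weighted_adapted.
  exact: L2_scale_idx.
have ox : Ex P (fun w => dot (A w + weighted k w *: noise_y k w)
    (- (weighted k w *: noise_xt k w))) = 0.
  under eq_fun do rewrite dotNr -mulN1r.
  rewrite ExZ; last exact: intg_dot.
  rewrite scaled_dotC (noise_orthogonal sfi (@drawn_y_measurable k) mI (hxt k) mxt nxt)
    ?mulr0//; last exact: L2_scale_idx.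
  have upy (X : T -> 'rV[R]_p) : adaptedv (drawn_idx e k) X -> adaptedv (drawn_y e k) X.
    by apply: adaptedv_sub => Z; left.
  apply: weighted_adapted => //; apply: random_vectorD; first exact: upy.
  apply: weighted_adapted => //; apply: random_vectorB.
    by apply: adaptedv_gen => X; right.
  by apply: grad_select_adapted => //; apply: upy; exact: up.
have hN2' : L2 P (fun w => - (weighted k w *: noise_xt k w)).
  by under eq_fun do rewrite -scaleN1r; exact: L2Zc.
rewrite gE (Ex_sqnormD hAN1 hN2' ox) (Ex_sqnormD hA hN1 oy).
have b1 := weighted_noise_moment (@drawn_idx_measurable k) SIi (hy k) my ny.
have b2 := weighted_noise_moment (@drawn_y_measurable k) SIy (hxt k) mxt nxt.
have iSi i : intg P (fun w => sqnorm (snapshot_diff k i w)) by have [] := L2_snapshot_diff k i.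
have b3 : Ex P (fun w => sqnorm (A w)) <= 2 * LQ * Ex P (descr k) + s2.
  rewrite (Ex_idx (F := fun i w => sqnorm (snapshot_diff k i w)) iSi); last first.
    by move=> i; exact: measurable_sqnorm (aSi i).
  have [_ iz] := hzerr k; have iD := intg_descr k.
  apply: (@le_trans _ _ (Ex P (fun w => 2 * LQ * descr k w + sqnorm (zerr k w)))).
    apply: Ex_le => [||w].
    - by apply: intg_sum => i; exact: intgZ.
    - by apply: intgD => //; exact: intgZ.
    pose a i := (q i * n%:R)^-1 *: (grad (fi i) (y k w) - grad (fi i) (xt k w)).
    pose b := gf (y k w) - gf (xt k w).
    have ab : \sum_(i < n) q i *: a i = b.
      rewrite /b !(grad_average sfi) -scalerBr -sumrB scaler_sumr.
      apply: eq_bigr => i _; rewrite /a scalerA; congr (_ *: _).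
      by field; rewrite !gt_eqF.
    (* Centring the sampled differences removes the cross term with [zerr]; the gain of [|b|^2] is
       then given up. *)
    rewrite [leLHS](sum_sqnorm_shift (zerr k w) q1 ab) lerD2r lerBlDr.
    apply: (@le_trans _ _ (2 * LQ * descr k w)); last by rewrite lerDl sqnorm_ge0.
    have := gradient_variance n0 mu0 q0 muL cfi sfi (xt k w) (y k w).
    apply: le_trans; rewrite le_eqVlt; apply/orP; left; apply/eqP.
    by apply: eq_bigr => i _; rewrite /a !sqnormZ sqnorm_subC.
  rewrite ExD ?ExZ//; last exact: intgZ.
  by rewrite lerD2l; exact: zbar_variance.
have -> : Ex P (fun w => sqnorm (- (weighted k w *: noise_xt k w))) =
    Ex P (fun w => sqnorm (weighted k w *: noise_xt k w)).
  by under eq_fun do rewrite sqnormN.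
apply: le_trans (lerD (lerD b3 b1) b2) _.
by rewrite le_eqVlt; apply/orP; left; apply/eqP; ring.
Qed.

(** * The optimality gap as an integrable real variable *)

Definition composite (z : 'rV[R]_p) : R := f z + fine (psi z).

Definition gap (X : T -> 'rV[R]_p) (w : T) : R := composite (X w) - composite xstar.

Lemma psi_x_fin k w : psi (x k w) \is a fin_num.
Proof. by case: k => [|k]; [exact: psi0 | exact: prox_fin (iter_x_S run k w) fstar]. Qed.

Lemma psi_xt_fin k w : psi (xt k w) \is a fin_num.
Proof.
elim: k => [|k IH]; first by rewrite (anchor_0 run) psi0.
by rewrite (anchor_S run); case: ifP => // _; exact: psi_x_fin.
Qed.

Lemma objectiveE z : psi z \is a fin_num -> objective fi psi z = (composite z)%:E.
Proof. by move=> fz; rewrite /objective /composite EFinD fineK. Qed.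

Lemma composite_min z : psi z \is a fin_num -> composite xstar <= composite z.
Proof. by move=> fz; have := xmin z; rewrite !objectiveE// lee_fin. Qed.

(** Minimality of [xstar] against the segment towards [z], divided by [t], with [t -> 0]. *)
Lemma composite_growth z : psi z \is a fin_num ->
  mu / 2 * sqnorm (z - xstar) <= composite z - composite xstar.
Proof.
move=> fz; rewrite -subr_ge0; apply: (@ge0_of_affine _ _ (mu / 2 * sqnorm (z - xstar))).
move=> t t01; have [t0 t1] := andP t01.
have [fzt cz] := econvex_fine psiNy cvx fz fstar t01.
have t01' : 0 <= t <= 1 by rewrite !ltW.
rewrite -(pmulr_rge0 _ t0).
exact: segment_growth (composite_min fzt) (scf z xstar t01') cz.
Qed.

Lemma continuous_average : continuous f.
Proof. by move=> z; apply: differentiable_continuous; exact: (differentiable_average sfi). Qed.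

Lemma psi_adapted (S : set (T -> R)) (X : T -> 'rV[R]_p) : adaptedv S X ->
  adapted S (fun w => fine (psi (X w))).
Proof.
move=> aX; apply: (measurableT_comp (fine_measurable measurableT)).
exact: measurable_lsc_comp.
Qed.

Lemma gap_adapted (S : set (T -> R)) (X : T -> 'rV[R]_p) : adaptedv S X -> adapted S (gap X).
Proof.
move=> aX; apply: measurable_funB; last exact: measurable_cst.
apply: measurable_funD; last exact: psi_adapted.
exact: (measurable_continuous_comp continuous_average aX).
Qed.

(** From above, comparing the prox point with [xstar] bounds [psi] by a squared distance; from
    below, minimality of [xstar] bounds it by [F xstar - f]. Both bounds are integrable. *)
Lemma intg_psi_x k : intg P (fun w => fine (psi (x k w))).
Proof.
case: k => [//|k]; have [ax _ _ _] := drawn_adaptedP k.+1.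
pose u w := y k w - eta k.+1 *: g k w.
have hu : L2 P u by apply: L2B => //; exact: L2Zc.
have [_ iu] := L2B (L2_cst P xstar) hu; have ifx := intg_f (hx k.+1).
pose c w := `|composite xstar - f (x k.+1 w)| +
  (`|fine (psi xstar)| + (eta k.+1)^-1 * (2^-1 * sqnorm (cst xstar w - u w))).
apply: (@intg_le _ _ _ _ _ c).
- exact: (adapted_measurable (@drawn_measurable k.+1) (psi_adapted ax)).
- move=> w; have lo := composite_min (psi_x_fin k.+1 w); rewrite {2}/composite in lo.
  have up := prox_le psiNy (eta0 k) (iter_x_S run k w) fstar.
  rewrite -/(u w) in up.
  have {}up : fine (psi (x k.+1 w)) <=
      fine (psi xstar) + (eta k.+1)^-1 * (2^-1 * sqnorm (xstar - u w)).
    have ie z : eta k.+1 * ((eta k.+1)^-1 * z) = z.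
      by rewrite mulrA divff ?mul1r// gt_eqF.
    rewrite -(ler_pM2l (eta0 k)) mulrDr ie.
    by apply: le_trans up; rewrite lerDl mulr_ge0 ?sqnorm_ge0.
  rewrite /c /cst; set a := _ - f _; set b := fine (psi xstar) in up *.
  have h0 : 0 <= (eta k.+1)^-1 * (2^-1 * sqnorm (xstar - u w)).
    by rewrite mulr_ge0 ?invr_ge0 ?(ltW (eta0 k))// mulr_ge0 ?sqnorm_ge0.
  rewrite ler_norml; apply/andP; split.
    rewrite lerNl (le_trans (_ : _ <= - a))//; first by rewrite lerN2 /a lerBlDl.
    by rewrite -normrN (le_trans (ler_norm _))// lerDl addr_ge0.
  by apply: (le_trans up); rewrite addrA lerD2r (le_trans (ler_norm b))// lerDr.
- apply: intgD; first by apply: integrable_norm; apply: intgB => //; exact: intg_cst.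
  by apply: intgD; [exact: intg_cst | apply: intgZ; exact: intgZ].
Qed.

Lemma intg_gap_x k : intg P (gap (x k)).
Proof.
apply: intgB; last exact: intg_cst.
by apply: intgD; [exact: intg_f | exact: intg_psi_x].
Qed.

Lemma gap_anchor_S k : gap (xt k.+1) = fun w => gap (xt k) w +
  (\1_[set w | coin e k.+1 w] w * gap (x k.+1) w - \1_[set w | coin e k.+1 w] w * gap (xt k) w).
Proof.
apply/funext => w; rewrite {1}/gap (anchor_S run) indicE; have [c|c] := boolP (coin e k.+1 w).
  by rewrite mem_set// !mul1r [RHS]addrC subrK.
by rewrite memNset ?mul0r ?subr0 ?addr0//=; apply/negP.
Qed.

Lemma intg_gap_xt k : intg P (gap (xt k)).
Proof.
elim: k => [|k IH]; first by rewrite (anchor_0 run); exact: intg_gap_x.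
have mC := coin_measurable run k.
rewrite gap_anchor_S.
apply: intgD => //; apply: intgB; apply: indicM_intg => //.
exact: intg_gap_x.
Qed.

Lemma Ex_gap_anchor k : Ex P (gap (xt k.+1)) =
  ni * Ex P (gap (x k.+1)) + (1 - ni) * Ex P (gap (xt k)).
Proof.
have mC := coin_measurable run k; have mSx := @drawn_xt_measurable k.
have ix := intg_gap_x k.+1; have it := intg_gap_xt k.
have indep A : sigma_gen (drawn_xt e k) A ->
    P (A `&` [set w | coin e k.+1 w]) = (P A * ni%:E)%E.
  exact: (coin_law run).
have [_ _ at_ _] := drawn_adaptedP k.
have ax := iter_x_adapted (drawn_adaptedP k).
have at' : adaptedv (drawn_xt e k) (xt k) by apply: adaptedv_sub at_ => X; do 3 left.
have icx := indicM_intg mC ix; have ict := indicM_intg mC it.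
rewrite gap_anchor_S (ExD it (intgB icx ict)) (ExB icx ict).
rewrite (Ex_indep mSx mC indep (gap_adapted ax) ix).
rewrite (Ex_indep mSx mC indep (gap_adapted at') it).
by ring.
Qed.

(** * One-step inequality in expectation and the potential *)

Let vdist k w : R := mu / 2 * sqnorm (v k w - xstar).

Let L2_vdist k : L2 P (fun w => v k w - xstar).
Proof. by apply: L2B => //; exact: L2_cst. Qed.

Lemma intg_vdist k : intg P (vdist k).
Proof. by apply: intgZ; have [] := L2_vdist k. Qed.

(** The sigma-algebra is the one for which [g] is unbiased, so [H] may depend on the past only
    through the iterates and anchors up to [k]. *)
Lemma information_orthogonal k (H : T -> 'rV[R]_p) : L2 P H ->
  adaptedv (\bigcup_(j in [set j | (j <= k)%N])
    (coords (x j) `|` coords (v j) `|` coords (xt j))) H ->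
  Ex P (fun w => dot (g k w - gf (y k w)) (H w)) = 0.
Proof.
move=> hH aH.
have mS Y : (\bigcup_(j in [set j | (j <= k)%N])
    (coords (x j) `|` coords (v j) `|` coords (xt j))) Y -> measurable_fun setT Y.
  case=> j _ [[|]|].
  - by have [m _] := hx j; exact: m.
  - by have [m _] := hv j; exact: m.
  - by have [m _] := hxt j; exact: m.
have hgf := L2_gf (hy k).
have := Ex_dot_cond_exp mS (estimate_unbiased run k) aH (hg k) hgf hH => E.
have -> : (fun w => dot (g k w - gf (y k w)) (H w)) =
    (fun w => dot (H w) (g k w) - dot (H w) (gf (y k w))).
  by apply/funext => w; rewrite dotC dotDr dotNr.
by rewrite (ExB (intg_dot hH (hg k)) (intg_dot hH hgf)) E subrr.
Qed.

Lemma Ex_step k :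
  Ex P (vdist k.+1) + ni * Ex P (gap (x k.+1)) <=
  (1 - del k) * Ex P (vdist k) + (ni - del k) * Ex P (gap (xt k))
    + 3 * s2 * eta k.+1 * ni.
Proof.
have [phi hphi lphi] := prox_map k.
pose xb w := phi (y k w - eta k.+1 *: gf (y k w)).
pose H w := del k *: (cst xstar w - y k w) + (ni - del k) *: (xt k w - y k w)
  - ni *: (xb w - y k w).
have hgf := L2_gf (hy k).
have hxb : L2 P xb by apply: (L2_lipschitz lphi); apply: L2B => //; exact: L2Zc.
have hH : L2 P H.
  apply: L2B; last by apply: L2Zc; exact: L2B.
  by apply: L2D; apply: L2Zc; apply: L2B => //; exact: L2_cst.
have aH : adaptedv (\bigcup_(j in [set j | (j <= k)%N])
    (coords (x j) `|` coords (v j) `|` coords (xt j))) H.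
  have av : adaptedv (\bigcup_(j in [set j | (j <= k)%N])
    (coords (x j) `|` coords (v j) `|` coords (xt j))) (v k).
    by apply: adaptedv_gen => X Xk; exists k => //=; left; right.
  have at_ : adaptedv (\bigcup_(j in [set j | (j <= k)%N])
    (coords (x j) `|` coords (v j) `|` coords (xt j))) (xt k).
    by apply: adaptedv_gen => X Xk; exists k => //=; right.
  have ay := iter_y_adapted av at_.
  apply: random_vectorB; last first.
    apply: random_vectorZc; apply: random_vectorB => //.
    apply: (random_vector_lipschitz lphi); apply: random_vectorB => //.
    by apply: random_vectorZc; exact: gf_adapted.
  apply: random_vectorD; apply: random_vectorZc; apply: random_vectorB => //.
  exact: random_vector_cst.
have etaLQ : LQ * eta k.+1 <= 3^-1.
  rewrite mulrC -ler_pdivlMr ?(L_Q_gt0 n0 mu0 q0 muL)//.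
  by apply: le_trans (etaL k) _; rewrite invfM.
have path w : vdist k.+1 w + ni * gap (x k.+1) w <=
    (1 - del k) * vdist k w + (ni - del k) * gap (xt k) w
    - (ni - del k) * descr k w + eta k.+1 * ni * sqnorm (g k w - gf (y k w))
    + dot (g k w - gf (y k w)) (H w).
  have px := iter_x_S run k w.
  have fx := psi_x_fin k.+1 w.
  have nonexp : sqnorm (x k.+1 w - xb w) <= eta k.+1 ^+ 2 * sqnorm (g k w - gf (y k w)).
    apply: le_trans (prox_nonexpansive psiNy cvx (eta0 k) px (hphi _) fx) _.
    rewrite (prox_argument_sub (y k w)) sqnormN sqnormZ.
    exact: lexx.
  have := one_step (f (xt k w)) mu0 (eta0 k) (delta_gt0 k) (delta_le_ninv k) (delta_le1 k)
    (delta_sqr k) etaLQ (theta_relation k w)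
    (prox_subgradient psiNy cvx (eta0 k) px fstar)
    (prox_subgradient psiNy cvx (eta0 k) px (psi_xt_fin k w))
    (average_descent n0 mu0 q0 q1 muL sfi (y k w) (x k.+1 w))
    (strongly_convex_grad xstar (differentiable_average sfi (y k w)) scf) nonexp.
  rewrite -iter_vE /vdist /gap /composite /descr /H /cst => h.
  rewrite mulrBr addrA lerBlDr; apply: le_trans h _.
  by rewrite le_eqVlt; apply/orP; left; apply/eqP; ring.
have iv1 := intg_vdist k.+1; have iv := intg_vdist k; have ix := intg_gap_x k.+1.
have it := intg_gap_xt k; have iD := intg_descr k.
have [_ ig] := L2B (hg k) hgf.
have iH := intg_dot (L2B (hg k) hgf) hH.
have i1 := intgD (intgZ (1 - del k) iv) (intgZ (ni - del k) it).
have i2 := intgB i1 (intgZ (ni - del k) iD).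
have i3 := intgD i2 (intgZ (eta k.+1 * ni) ig).
have := Ex_le (intgD iv1 (intgZ ni ix)) (intgD i3 iH) path.
rewrite (ExD iv1 (intgZ ni ix)) (ExZ _ ix) (ExD i3 iH) (ExD i2 (intgZ _ ig)).
rewrite (ExB i1 (intgZ _ iD)) (ExD (intgZ _ iv) (intgZ _ it)).
rewrite (ExZ _ iv) (ExZ _ it) (ExZ _ iD) (ExZ _ ig) (information_orthogonal hH aH) addr0.
move=> h; apply: le_trans h _.
have var := estimate_variance k.
have D0 : 0 <= Ex P (descr k).
  apply: Ex_ge0 => w.
  have := strongly_convex_grad (xt k w) (differentiable_average sfi (y k w)) scf.
  move=> h; rewrite /descr -addrA -opprD subr_ge0; apply: le_trans h; rewrite lerDl.
  by rewrite mulr_ge0 ?sqnorm_ge0// divr_ge0// ltW.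
rewrite -(mulrA (3 * s2)).
have budget := step_budget ni0 etaLQ (delta_le k).
pose en := descent_budget ((1 - del k) * Ex P (vdist k) + (ni - del k) * Ex P (gap (xt k)))
  (ltW (mulr_gt0 (eta0 k) ni0)) D0 var budget.
exact: en.
Qed.

Definition potential k : R := Ex P (vdist k) + Ex P (gap (xt k)).

(** Adding [(1 - ni) * E gap (xt k)] to [Ex_step] completes the new anchor gap on the left and turns
    the coefficient [ni - del] into [1 - del] on the right. *)
Lemma potential_step k :
  potential k.+1 <= (1 - del k) * potential k + 3 * s2 * eta k.+1 * ni.
Proof.
rewrite /potential Ex_gap_anchor addrA.
apply: (le_trans (lerD (Ex_step k) (lexx _))).
by rewrite le_eqVlt; apply/orP; left; apply/eqP; ring.
Qed.

(** Since [v] starts at [x 0], quadratic growth bounds the distance term by one more copy of the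
    gap. *)
Lemma potential0 : potential 0 <= 2 * Ex P (gap (x 0)).
Proof.
rewrite /potential (anchor_0 run) mulr_natl mulr2n lerD2r.
apply: (Ex_le (intg_vdist 0) (intg_gap_x 0)) => w.
by rewrite /vdist (iter_v_0 run) composite_growth.
Qed.

Lemma gap_anchor_le_potential k : Ex P (gap (xt k)) <= potential k.
Proof.
rewrite /potential lerDr Ex_ge0// => w.
by rewrite mulr_ge0 ?sqnorm_ge0// divr_ge0// ltW.
Qed.

Lemma gap_anchor_gt (tol : R) k : (forall j, (j <= k)%N -> tol < Ex P (gap (x j))) ->
  tol < Ex P (gap (xt k)).
Proof.
elim: k => [h|k IH h]; first by rewrite (anchor_0 run) h.
have h1 := h k.+1 (leqnn _); have h2 : tol < Ex P (gap (xt k)).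
  by apply: IH => j jk; exact: h (leqW jk).
rewrite Ex_gap_anchor; exact: convex_combination_gt ni0 ninv_le1 h1 h2.
Qed.

(* The law of the anchor is a mixture of the laws of the iterates up to [k]. *)
Lemma exists_gap_le (tol : R) k : potential k <= tol ->
  exists2 j, (j <= k)%N & Ex P (gap (x j)) <= tol.
Proof.
move=> pk; apply/not_exists2P => h.
have : tol < Ex P (gap (xt k)).
  by apply: gap_anchor_gt => j jk; rewrite ltNge; apply/negP; case: (h j).
by apply/negP; rewrite -leNgt (le_trans (gap_anchor_le_potential k)).
Qed.

Lemma expected_gapE k :
  expected_gap P (objective fi psi) xstar (x k) = (Ex P (gap (x k)))%:E.
Proof.
rewrite /expected_gap (EFin_Ex (intg_gap_x k)); apply: eq_integral => w _.
by rewrite !objectiveE ?psi_x_fin.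
Qed.

(** An iteration costs 2 evaluations and, with probability 1/n, another n: 3 on average. *)
Lemma evaluations_expectation k :
  intg P (fun w => (gradient_evaluations e k w)%:R) /\
  Ex P (fun w => (gradient_evaluations e k w)%:R) = n%:R + 3 * k%:R.
Proof.
elim: k => [|k [IHi IHe]].
  have -> : (fun w => (gradient_evaluations e 0 w)%:R) = cst (n%:R : R).
    by apply/funext => w; rewrite /gradient_evaluations big_geq// addn0.
  by split; [exact: intg_cst | rewrite Ex_cst mulr0 addr0].
have mC := coin_measurable run k.
have -> : (fun w => (gradient_evaluations e k.+1 w)%:R) =
    (fun w => (gradient_evaluations e k w)%:R + (2 + n%:R * \1_[set w | coin e k.+1 w] w) : R).
  apply/funext => w; rewrite /gradient_evaluations big_nat_recr//= addnA natrD; congr (_ + _).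
  rewrite natrD natrM; congr (_ + _ * _); rewrite indicE; congr (nat_of_bool _)%:R.
  by apply/idP/idP => [h|/set_mem//]; exact: mem_set.
have iC := intg_indic P mC; have i2 := intg_cst P (2 : R).
have i3 := intgD i2 (intgZ n%:R iC).
split; first exact: intgD.
rewrite (ExD IHi i3) IHe (ExD i2 (intgZ _ iC)) (ExZ _ iC) Ex_cst Ex_indic//.
have -> : fine (P [set w | coin e k.+1 w]) = ni.
  have := coin_law run (@salgT (drawn_xt e k)).
  rewrite setTI => h; rewrite (h : P [set w | coin e k.+1 w] = _).
  by rewrite (_ : P setT = 1%E) ?mul1e//; exact: (probability_setT P).
by rewrite divff ?gt_eqF// -(natr1 k); ring.
Qed.

(** Interface to the rates: only deterministic sequences remain, and the same statement serves the
    constant and the decreasing steps. *)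
Lemma svrg_convergence : exists a gp : nat -> R,
  [/\ forall k, expected_gap P (objective fi psi) xstar (x k) = (gp k)%:E,
      a 0 <= 2 * gp 0,
      forall k, a k.+1 <= (1 - Num.sqrt (5 / 3 * ni * eta k.+1 * mu)) * a k
        + 3 * s2 * eta k.+1 * ni &
      forall (tol : R) k, a k <= tol -> exists2 j, (j <= k)%N & gp j <= tol].
Proof.
exists potential, (fun k => Ex P (gap (x k))); split.
- exact: expected_gapE.
- exact: potential0.
- move=> k; rewrite -delta_sqr sqrtr_sqr ger0_norm ?(ltW (delta_gt0 k))//.
  exact: potential_step.
- exact: exists_gap_le.
Qed.

End Execution.

(** * Rates and complexity *)

Section Rates.
Context {R : realType}.
Implicit Types (a : nat -> R) (mu W r B S D : R).

Lemma square_step_le1 (n : nat) (mu base : R) : (0 < n)%N -> 0 < mu ->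
  base <= (15 * mu * n%:R)^-1 -> 5 / 3 * n%:R^-1 * base * mu <= 1.
Proof.
move=> n0 mu0 b1; have nR : 0 < n%:R :> R by rewrite ltr0n.
have : 5 / 3 * n%:R^-1 * base * mu <= 5 / 3 * n%:R^-1 * (15 * mu * n%:R)^-1 * mu.
  by rewrite ler_pM2r// ler_pM2l// mulr_gt0// invr_gt0.
have -> : 5 / 3 * n%:R^-1 * (15 * mu * n%:R)^-1 * mu = 9^-1 * (n%:R^-1 ^+ 2) :> R.
  by field; rewrite !gt_eqF.
have : n%:R^-1 ^+ 2 <= 1 :> R by rewrite expr_le1 ?invr_ge0 ?(ltW nR)// invf_le1// ler1n.
lra.
Qed.

(** The recursion has fixed point [4 / 5 * B]. The 10 in the logarithm brings the transient
    [(1 - D)^K * 2 S] down to the remaining [B / 5], through [1 - D <= exp (- D)]. *)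
Lemma linear_rate a D B S : 0 < D <= 1 -> 0 < B -> B < S -> a 0%N <= 2 * S ->
  (forall k, a k.+1 <= (1 - D) * a k + 4 / 5 * B * D) ->
  exists2 K : nat, a K <= B & K%:R <= D^-1 * ln (10 * S / B) + 1.
Proof.
move=> /andP[D0 D1] B0 BS a0 aS; have S0 := lt_trans B0 BS.
have SB0 : 0 < 10 * S / B by rewrite divr_gt0// mulr_gt0.
pose X := D^-1 * ln (10 * S / B).
have X0 : 0 <= X.
  rewrite mulr_ge0 ?invr_ge0 ?(ltW D0)// ln_ge0// ler_pdivlMr//; lra.
have [t1 t2] := andP (truncn_itv X0).
exists (Num.truncn X).+1; last by rewrite -natr1 lerD2r.
have rate k : a k <= (1 - D) ^+ k * (2 * S) + 4 / 5 * B.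
  elim: k => [|k IH]; first by rewrite expr0 mul1r (le_trans a0)// lerDl; lra.
  apply: le_trans (aS k) _; have D1' : 0 <= 1 - D by rewrite subr_ge0.
  have := ler_wpM2l D1' IH; rewrite exprS; lra.
apply: le_trans (rate _) _.
have e1 : (1 - D) ^+ (Num.truncn X).+1 <= B / (10 * S).
  apply: (@le_trans _ _ (expR (- D) ^+ (Num.truncn X).+1)).
    by apply: lerXn2r; rewrite ?nnegrE ?subr_ge0 ?expR_ge0//; exact: expR_ge1Dx.
  rewrite -expRM_natl -[leRHS]invrK invf_div -(lnK (x := 10 * S / B)) ?posrE// -expRN ler_expR.
  rewrite mulrN lerN2 -ler_pdivrMr// mulrC -/X ltW//.
have := ler_wpM2r (_ : 0 <= 2 * S) e1; rewrite mulr_ge0 ?(ltW S0)// => /(_ isT).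
have -> : B / (10 * S) * (2 * S) = B / 5 by field; rewrite gt_eqF.
lra.
Qed.

(* While the minimum is [base] ([A k] below) one has [D <= 2 / (k + 2)] and the bound
   [2 B = 6 W mu r] persists; afterwards the contraction factor is [k / (k + 2)]. *)
Lemma sublinear_rate a (n : nat) mu base s W r : (0 < n)%N -> 0 < mu -> 0 < base ->
  base <= (15 * mu * n%:R)^-1 -> 0 <= s -> s <= W * mu -> 0 < r ->
  r ^+ 2 = base / (mu * n%:R) ->
  let eta k := Num.min base (12 * n%:R / (5 * mu * k.+2%:R ^+ 2)) in
  a 0%N <= 2 * (3 * (W * mu) * r) ->
  (forall k, a k.+1 <= (1 - Num.sqrt (5 / 3 * n%:R^-1 * eta k.+1 * mu)) * a k
    + 3 * s * eta k.+1 * n%:R^-1) ->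
  forall k, a k <= 10 * W / k.+2%:R.
Proof.
move=> n0 mu0 b0 b1 s0 sW r0 r2 eta a0 aS.
have nR : 0 < n%:R :> R by rewrite ltr0n.
have n1 : 1 <= n%:R :> R by rewrite ler1n.
have W0 : 0 <= W by rewrite -(pmulr_lge0 _ mu0) (le_trans s0).
pose D := Num.sqrt (5 / 3 * n%:R^-1 * base * mu).
have D2 : D ^+ 2 = 5 / 3 * (mu * r) ^+ 2.
  rewrite sqr_sqrtr; last by rewrite !mulr_ge0 ?invr_ge0 ?ltW.
  by rewrite exprMn r2; field; rewrite !gt_eqF.
have mr0 : 0 < mu * r by rewrite mulr_gt0.
have D0 : 0 <= D by exact: sqrtr_ge0.
(* A rational substitute for the root of 5 / 3, as [25 / 16 <= 5 / 3]. *)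
have Dlo : 5 / 4 * (mu * r) <= D.
  have m0 : 0 <= 5 / 4 * (mu * r) by rewrite mulr_ge0// ltW.
  rewrite -ler_sqr ?nnegrE// D2 [leLHS]exprMn ler_wpM2r ?sqr_ge0//; lra.
have D1 : D <= 1.
  by rewrite -sqrtr1; apply: ler_wsqrtr; exact: square_step_le1.
have k0 k : 0 < k.+2%:R :> R by rewrite ltr0n.
pose A k := base <= 12 * n%:R / (5 * mu * k.+2%:R ^+ 2).
have AS k : A k.+1 -> A k.
  rewrite /A => h; apply: le_trans h _; rewrite ler_wpM2l ?mulr_ge0 ?(ltW nR)//.
  rewrite lef_pV2 ?posrE ?mulr_gt0 ?exprn_gt0// ler_wpM2l ?mulr_ge0 ?(ltW mu0)//.
  by rewrite ler_sqr ?nnegrE// ler_nat.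
have AD k : A k -> D <= 2 / k.+2%:R.
  move=> Ak; rewrite -ler_sqr ?nnegrE ?divr_ge0 ?(ltW (k0 k))//.
  rewrite sqr_sqrtr; last by rewrite !mulr_ge0 ?invr_ge0 ?ltW.
  apply: (@le_trans _ _ (5 / 3 * n%:R^-1 * (12 * n%:R / (5 * mu * k.+2%:R ^+ 2)) * mu)).
    by rewrite ler_pM2r// ler_pM2l// mulr_gt0// invr_gt0.
  by rewrite le_eqVlt; apply/orP; left; apply/eqP; field; rewrite !gt_eqF.
have bn : base * n%:R^-1 = mu * r ^+ 2 by rewrite r2; field; rewrite !gt_eqF.
have J k : a k <= 10 * W / k.+2%:R /\ (A k -> a k <= 6 * (W * (mu * r))).
  (* From [5 / 4 * mu r <= D <= 2 / (j + 2)], the bound [6 W mu r] is at most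
     [48 / 5 * W / (j + 2)], just under the constant 10. *)
  have AJ j : A j -> a j <= 6 * (W * (mu * r)) -> a j <= 10 * W / j.+2%:R.
    move=> /AD Dj aj; apply: le_trans aj _.
    have h1 : mu * r <= 4 / 5 * (2 / j.+2%:R).
      by have := le_trans Dlo Dj; move: (2 / j.+2%:R) => z; lra.
    have := ler_wpM2l W0 h1; have := divr_ge0 W0 (ltW (k0 j)).
    move: (j.+2%:R^-1) => z; lra.
  elim: k => [|k [IH IHA]].
    (* The regime of constant steps comes first: at 0 the decreasing bound is [3 n / (5 mu)], above
       [1 / (15 mu n)]. *)
    have A0 : A 0%N.
      apply: le_trans b1 _; rewrite -subr_ge0.
      have -> : 12 * n%:R / (5 * mu * 2%:R ^+ 2) - (15 * mu * n%:R)^-1 =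
          (9 * n%:R ^+ 2 - 1) / (15 * mu * n%:R) :> R by field; rewrite !gt_eqF.
      rewrite divr_ge0//; last by rewrite !mulr_ge0 ?ltW.
      have : 1 <= n%:R ^+ 2 :> R by rewrite expr_ge1.
      lra.
    have a0' : a 0%N <= 6 * (W * (mu * r)) by apply: le_trans a0 _; lra.
    by split; [exact: (AJ 0%N)|].
  have [A1|A1] := boolP (A k.+1).
    have ak := IHA (AS _ A1).
    have : a k.+1 <= 6 * (W * (mu * r)).
      have := aS k; rewrite /eta (min_idPl A1) -/D -mulrA bn.
      have h1 := ler_wpM2l (_ : 0 <= 1 - D) ak.
      rewrite subr_ge0 in h1; have {}h1 := h1 D1.
      have h2 : s * (mu * r ^+ 2) <= W * mu * (mu * r ^+ 2).
        by rewrite ler_wpM2r// mulr_ge0 ?sqr_ge0// ltW.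
      have h3 : W * (mu * r) * (5 / 4 * (mu * r)) <= W * (mu * r) * D.
        by rewrite ler_wpM2l// mulr_ge0// ltW.
      have h4 : 0 <= W * (mu * r) * D by rewrite !mulr_ge0// ltW.
      lra.
    by move=> h; split; [exact: AJ|].
  split; last by move=> Ak; case/negP: A1.
  have := aS k; rewrite /eta min_r; last by rewrite ltW// ltNge.
  (* The numerator [12 n / 5] makes [delta] exactly [2 / (k + 3)], the step being that of iteration
     [k + 1]. *)
  have -> : Num.sqrt (5 / 3 * n%:R^-1 * (12 * n%:R / (5 * mu * k.+3%:R ^+ 2)) * mu)
      = 2 / k.+3%:R.
    have -> : 5 / 3 * n%:R^-1 * (12 * n%:R / (5 * mu * k.+3%:R ^+ 2)) * mu
      = (2 / k.+3%:R) ^+ 2 by field; rewrite !gt_eqF.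
    by rewrite sqrtr_sqr ger0_norm// divr_ge0// ltW.
  have h1 := ler_wpM2l (_ : 0 <= 1 - 2 / k.+3%:R) IH.
  have k2 := k0 k; have k3 := k0 k.+1.
  have e3 : k.+3%:R = k.+2%:R + 1 :> R by rewrite natr1.
  have k21 : 1 <= k.+2%:R :> R by rewrite ler1n.
  rewrite e3 in k3 h1 *; move: (k.+2%:R) k2 k21 k3 h1 IH => z z0 z1 z3 h1 IH h.
  have {}h1 := h1 _; apply: le_trans h _.
  have h2 : 3 * s * (12 * n%:R / (5 * mu * (z + 1) ^+ 2)) * n%:R^-1 <= 36 / 5 * W / (z + 1) ^+ 2.
    have -> : 3 * s * (12 * n%:R / (5 * mu * (z + 1) ^+ 2)) * n%:R^-1 =
      36 / 5 * (s / mu) / (z + 1) ^+ 2 by field; rewrite !gt_eqF.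
    rewrite ler_pM2r ?invr_gt0 ?exprn_gt0// ler_pM2l//.
    by rewrite ler_pdivrMr.
  have h3 : (1 - 2 / (z + 1)) * a k <= (1 - 2 / (z + 1)) * (10 * W / z).
    by apply: h1; rewrite subr_ge0 ler_pdivrMr//; lra.
  apply: (le_trans (lerD h3 h2)).
  (* With [z = k + 2], the induction closes because the noise constant 36 / 5 is below 10, leaving
     the [14 / 5 * z] of the numerator. *)
  rewrite -subr_ge0.
  have -> : 10 * W / (z + 1) - ((1 - 2 / (z + 1)) * (10 * W / z) + 36 / 5 * W / (z + 1) ^+ 2) =
    W * (14 / 5 * z + 10) / (z * (z + 1) ^+ 2) by field; rewrite !gt_eqF.
  rewrite divr_ge0 ?mulr_ge0// ?exprn_ge0 ?(ltW z3) ?(ltW z0)//; lra.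
by move=> k; have [] := J k.
Qed.

End Rates.

Section Count.
Context {R : realType}.

(* [ln 10 < 10], [D^-1 <= 3 N] and [1 <= N <= 6 W / eps] for
   [N = n + sqrt (n LQ / mu)], whence 9 from [3 K1] and 98 * 6 + 30 <= 700 otherwise. *)
Lemma evaluation_count (n : nat) (mu LQ base r W B eps S D : R) (K1 K2 : nat) :
  (0 < n)%N -> 0 < mu -> 0 < LQ -> base = base_step n mu LQ ->
  0 < r -> r ^+ 2 = base / (mu * n%:R) -> D ^+ 2 = 5 / 3 * (mu * r) ^+ 2 -> 0 < D ->
  B = 3 * (W * mu) * r -> 0 < eps < B -> 0 <= W ->
  (K1 = 0%N \/ B < S /\ K1%:R <= D^-1 * ln (10 * S / B) + 1) ->
  K2%:R <= 10 * W / eps + 1 ->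
  (n%:R + 3 * K1%:R) + (n%:R + 3 * K2%:R) <=
  9 * ((n%:R + Num.sqrt (n%:R * LQ / mu)) * Num.max 0 (ln (S / eps))) + 700 * (W / eps).
Proof.
move=> n0 mu0 LQ0 bE r0 r2 D2 D0 BE /andP[e0 eB] W0 HK1 HK2.
have nR : 0 < n%:R :> R by rewrite ltr0n.
have n1 : 1 <= n%:R :> R by rewrite ler1n.
have base0 : 0 < base.
  by rewrite bE lt_min !invr_gt0 !mulr_gt0.
have b1 : base <= (3 * LQ)^-1 by rewrite bE ge_min lexx.
have b2 : base <= (15 * mu * n%:R)^-1 by rewrite bE ge_min lexx orbT.
set q := Num.sqrt (n%:R * LQ / mu).
have q0 : 0 <= q by exact: sqrtr_ge0.
have q2 : q ^+ 2 = n%:R * LQ / mu by rewrite sqr_sqrtr// divr_ge0 ?mulr_ge0 ?ltW.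
set N := n%:R + q.
have N1 : 1 <= N by rewrite /N; lra.
have mr0 : 0 < mu * r by rewrite mulr_gt0.
have mr2 : (mu * r) ^+ 2 = mu * base / n%:R by rewrite exprMn r2; field; rewrite !gt_eqF.
have nmr : n%:R * (mu * r) <= 1.
  have a0 : 0 <= n%:R * (mu * r) by apply: mulr_ge0; exact: ltW.
  rewrite -(expr_le1 (n := 2) isT a0) [leLHS]exprMn mr2.
  have -> : n%:R ^+ 2 * (mu * base / n%:R) = base * (mu * n%:R) :> R.
    by field; rewrite gt_eqF.
  rewrite -ler_pdivlMr ?mulr_gt0// mul1r; apply: le_trans b2 _.
  rewrite lef_pV2 ?posrE ?mulr_gt0// -mulrA; have := mulr_gt0 mu0 nR; lra.
have qmr : q * (mu * r) <= 1.
  have a0 : 0 <= q * (mu * r) by apply: mulr_ge0 => //; exact: ltW.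
  rewrite -(expr_le1 (n := 2) isT a0) [leLHS]exprMn mr2 q2.
  have -> : n%:R * LQ / mu * (mu * base / n%:R) = base * LQ :> R.
    by field; rewrite !gt_eqF.
  rewrite -ler_pdivlMr// mul1r; apply: le_trans b1 _.
  have l3 : LQ <= 3 * LQ by lra.
  have p3 : 0 < 3 * LQ by rewrite mulr_gt0.
  by rewrite lef_pV2 ?posrE.
(* [N * (mu r) <= 2], while [eps < B] reads [1 < 3 * (W / eps) * (mu r)]; together they give 6. *)
have Nw : N <= 6 * (W / eps).
  have h : N * (mu * r) <= 2 by rewrite /N mulrDl; exact: lerD nmr qmr.
  have : 1 <= 3 * (W / eps) * (mu * r).
    have -> : 3 * (W / eps) * (mu * r) = B / eps by rewrite BE; field; rewrite gt_eqF.
    by rewrite ler_pdivlMr// mul1r ltW.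
  move=> h2; rewrite -(ler_pM2r mr0); lra.
(* [(3 N)^2 * D^2 >= 15 (base * mu * n + base * LQ)], and whichever bound attains the minimum
   defining [base] makes the bracket at least 1 / 15. *)
have DN : D^-1 <= 3 * N.
  have N0 : 0 < 3 * N by lra.
  rewrite -[leRHS]invrK lef_pV2 ?posrE ?invr_gt0//.
  rewrite -ler_sqr ?nnegrE ?invr_ge0 ?(ltW N0) ?(ltW D0)// exprVn.
  rewrite -[leLHS]div1r ler_pdivrMr ?exprn_gt0// D2 mr2.
  have NN : n%:R ^+ 2 + n%:R * LQ / mu <= N ^+ 2.
    by rewrite -q2 /N sqrrD -subr_ge0; have := mulr_ge0 (ltW nR) q0; lra.
  have c0 : 0 <= 5 / 3 * (mu * base / n%:R) by rewrite !mulr_ge0 ?invr_ge0 ?ltW.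
  have := ler_wpM2l c0 NN; rewrite [(3 * N) ^+ 2]exprMn.
  suff : 9^-1 <= 5 / 3 * (mu * base / n%:R) * (n%:R ^+ 2 + n%:R * LQ / mu) by lra.
  have -> : 5 / 3 * (mu * base / n%:R) * (n%:R ^+ 2 + n%:R * LQ / mu) =
     5 / 3 * (base * (mu * n%:R)) + 5 / 3 * (base * LQ) by field; rewrite !gt_eqF.
  have p1 : 0 <= base * (mu * n%:R) by rewrite !mulr_ge0 ?ltW.
  have p2 : 0 <= base * LQ by rewrite !mulr_ge0 ?ltW.
  have : base = (3 * LQ)^-1 \/ base = (15 * mu * n%:R)^-1.
    by rewrite bE /base_step; case: leP => _; [left | right].
  case=> h.
    have : base * LQ = 3^-1 by rewrite h; field; rewrite gt_eqF.
    lra.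
  have : base * (mu * n%:R) = 15^-1 by rewrite h; field; rewrite !gt_eqF.
  lra.
set l := Num.max 0 (ln (S / eps)).
have l0 : 0 <= l by rewrite le_max lexx.
have K1le : K1%:R <= 3 * N * (10 + l) + 1.
  case: HK1 => [->|[BS h]].
    have h : 0 <= 3 * N * (10 + l) by apply: mulr_ge0; lra.
    exact: addr_ge0 h ler01.
  have B0 := lt_trans e0 eB; have S0 := lt_trans B0 BS.
  apply: le_trans h _; rewrite lerD2r.
  have : ln (10 * S / B) <= 10 + l.
    apply: (@le_trans _ _ (ln (10 * (S / eps)))).
      rewrite ler_ln ?posrE ?divr_gt0 ?mulr_gt0 ?invr_gt0//.
      rewrite -mulrA ler_pM2l// ler_pM2l// lef_pV2 ?posrE//; exact: ltW.
    rewrite lnM ?posrE ?divr_gt0//; apply: lerD; last by rewrite le_max lexx orbT.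
    by rewrite ltW// ln_sublinear.
  move=> h; have l10 : 0 <= 10 + l by lra.
  apply: (@le_trans _ _ (D^-1 * (10 + l))); first by rewrite ler_wpM2l// invr_ge0 ltW.
  by rewrite ler_wpM2r.
have nN : n%:R <= N by rewrite /N; lra.
have Wm : 10 * W / eps = 10 * (W / eps) by rewrite mulrA.
rewrite Wm in HK2; move: (W / eps) Nw HK2 => w Nw HK2.
have -> : 9 * (N * l) = 3 * (3 * N * l) by ring.
have K1le' : K1%:R <= 30 * N + 3 * N * l + 1 by apply: le_trans K1le _; rewrite mulrDr; lra.
move: (3 * N * l) K1le' => z K1le'; lra.
Qed.

(** The left side is [3 s mu r^2], and 4 / 5 is the inverse of the 5 / 4 in [D >= 5 / 4 * mu r]. *)
Lemma noise_budget (n : nat) (mu base r D s W : R) : (0 < n)%N -> 0 < mu -> 0 < r ->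
  0 < D -> 0 <= W -> s <= W * mu -> r ^+ 2 = base / (mu * n%:R) ->
  D ^+ 2 = 5 / 3 * (mu * r) ^+ 2 ->
  3 * s * base * n%:R^-1 <= 4 / 5 * (3 * (W * mu) * r) * D.
Proof.
move=> n0 mu0 r0 D0 W0 sW r2 D2; have nR : 0 < n%:R :> R by rewrite ltr0n.
have mr0 : 0 < mu * r by rewrite mulr_gt0.
have Dlo : 5 / 4 * (mu * r) <= D.
  have m0 : 0 <= 5 / 4 * (mu * r) by rewrite mulr_ge0// ltW.
  rewrite -ler_sqr ?nnegrE ?(ltW D0)// D2 [leLHS]exprMn ler_wpM2r ?sqr_ge0//; lra.
have bn : base * n%:R^-1 = mu * r ^+ 2 by rewrite r2; field; rewrite !gt_eqF.
have h1 : s * (mu * r ^+ 2) <= W * mu * (mu * r ^+ 2).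
  by rewrite ler_wpM2r// mulr_ge0 ?sqr_ge0// ltW.
have h2 : W * mu * r * (5 / 4 * (mu * r)) <= W * mu * r * D.
  by rewrite ler_wpM2l// !mulr_ge0// ltW.
rewrite -mulrA bn; lra.
Qed.

End Count.

(** * The two phases *)

Lemma bigmin_gt0 (R : realType) (n : nat) (q : 'I_n -> R) : (forall i, 0 < q i) ->
  0 < \big[Num.min/1]_(i < n) q i.
Proof.
move=> q0; elim/big_ind : _ => [|a b a0 b0|i _]; [exact: ltr01 | | exact: q0].
by rewrite lt_min a0.
Qed.

(** [n] times the least probability is at most their sum. This allows the noise level to be replaced
    by [rho_Q] times it. *)
Lemma rho_Q_ge1 (R : realType) (n : nat) (q : 'I_n -> R) : (0 < n)%N ->
  (forall i, 0 < q i) -> \sum_(i < n) q i = 1 -> 1 <= rho_Q q.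
Proof.
move=> n0 q0 q1; have m0 := bigmin_gt0 q0.
rewrite /rho_Q invf_ge1; last by rewrite mulr_gt0// ltr0n.
have : \sum_(i < n) \big[Num.min/1]_(j < n) q j <= \sum_(i < n) q i.
  by apply: ler_sum => i _; exact: bigmin_le.
by rewrite q1 sumr_const card_ord mulr_natl => h; exact: h.
Qed.

Lemma first_reaches_exists d (T : measurableType d) (R : realType) (p n : nat)
    (P : probability T R) (F : 'rV[R]_p -> \bar R) (xstar : 'rV[R]_p)
    (e : execution T R p n) (gp : nat -> R) (tol : R) (j : nat) :
  (forall k, expected_gap P F xstar (iter_x e k) = (gp k)%:E) -> gp j <= tol ->
  exists2 K, (K <= j)%N & first_reaches P F xstar e tol K.
Proof.
move=> gE gj; have ex : exists k, gp k <= tol by exists j.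
exists (ex_minn ex); first by case: ex_minnP => m _; exact.
case: ex_minnP => m gm mmin; split; first by rewrite gE lee_fin.
move=> k km; rewrite gE lte_fin ltNge; apply/negP => /mmin.
by rewrite leqNgt km.
Qed.

Lemma base_step_gt0 (R : realType) (n : nat) (mu LQ : R) :
  (0 < n)%N -> 0 < mu -> 0 < LQ -> 0 < base_step n mu LQ.
Proof. by move=> n0 mu0 L0; rewrite lt_min !invr_gt0 !mulr_gt0// ltr0n. Qed.

Lemma decreasing_step_gt0 (R : realType) (n : nat) (mu LQ : R) k :
  (0 < n)%N -> 0 < mu -> 0 < LQ -> 0 < decreasing_step n mu LQ k.
Proof.
move=> n0 mu0 L0; rewrite lt_min base_step_gt0//= divr_gt0//.
  by rewrite mulr_gt0// ltr0n.
by rewrite mulr_gt0 ?exprn_gt0 ?ltr0n// mulr_gt0.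
Qed.

Theorem corollary20 (R : realType) :
  exists C1 C2 : R, 0 < C1 /\ 0 < C2 /\
  forall (p n : nat) (fi : 'I_n -> 'rV[R]_p -> R) (psi : 'rV[R]_p -> \bar R)
    (mu : R) (L q sd : 'I_n -> R) (x0 xstar : 'rV[R]_p) (eps : R),
  (0 < n)%N ->
  0 < mu ->
  (forall i, convex_function setT (fi i)) ->
  (forall i, smooth (L i) (fi i)) ->
  (forall i, mu <= L i) ->
  strongly_convex mu (average fi) ->
  (forall x, psi x != -oo%E) ->
  econvex psi ->
  lower_semicontinuous psi ->
  (forall x, (objective fi psi xstar <= objective fi psi x)%E) ->
  (forall i, 0 < q i) ->
  \sum_(i < n) q i = 1 ->
  objective fi psi x0 \is a fin_num ->
  let F := objective fi psi in
  let LQ := L_Q L q in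
  let eta := base_step n mu LQ in
  let B := 3 * rho_Q q * noise_level q sd * Num.sqrt (eta / (mu * n%:R)) in
  0 < eps < B ->
  forall (d : measure_display) (T : measurableType d) (P : probability T R)
    (e1 : execution T R p n),
  iter_x e1 0 = cst x0 ->
  accelerated_random_svrg P fi psi mu q sd (fun=> eta) mu e1 ->
  exists K1 : nat,
    first_reaches P F xstar e1 B K1 /\
    forall e2 : execution T R p n,
    iter_x e2 0 = iter_x e1 K1 ->
    accelerated_random_svrg P fi psi mu q sd (decreasing_step n mu LQ) mu e2 ->
    exists K2 : nat,
      first_reaches P F xstar e2 eps K2 /\
      ('E_P[fun w => (gradient_evaluations e1 K1 w + gradient_evaluations e2 K2 w)%:R]
       <= (C1 * ((n%:R + Num.sqrt (n%:R * LQ / mu))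
                 * Num.max 0 (ln (fine (F x0 - F xstar)%E / eps)))
           + C2 * (rho_Q q * noise_level q sd / (mu * eps)))%:E)%E.
Proof.
exists 9, 700; split; first exact: ltr0n; split; first exact: ltr0n.
move=> p n fi psi mu L q sd x0 xstar eps n0 mu0 cfi sfi muL scf psiNy cvx lsc xmin q0 q1 fx0
  F LQ eta B epsB d T P e1 e10 run1.
have /andP[eps0 epsltB] := epsB.
have nR : 0 < n%:R :> R by rewrite ltr0n.
have LQ0 : 0 < LQ := L_Q_gt0 n0 mu0 q0 muL.
have eta0 : 0 < eta := base_step_gt0 n0 mu0 LQ0.
have etaL : eta <= (3 * LQ)^-1 by rewrite /eta ge_min lexx.
have etamu : eta <= (15 * mu * n%:R)^-1 by rewrite /eta ge_min lexx orbT.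
have fpsi0 : psi x0 \is a fin_num.
  by move: fx0; rewrite /objective fin_numD => /andP[].
have fstar : psi xstar \is a fin_num.
  have := xmin x0; rewrite -(fineK fx0) /objective => h.
  have : (psi xstar < +oo)%E.
    by rewrite ltey; apply: contraTneq h => ->; rewrite addey// leye_eq.
  by move=> h1; rewrite fin_numE psiNy/= lt_eqF.
(* [W] is the scale shared by both phases: [B = 3 W mu r], and the noise term of the complexity is
   [W / eps]. *)
set s2 := noise_level q sd; set rho := rho_Q q; pose W := rho * s2 / mu.
pose r := Num.sqrt (eta / (mu * n%:R)).
have s20 : 0 <= s2 := noise_level_ge0 sd n0 q0.
have rho1 : 1 <= rho := rho_Q_ge1 n0 q0 q1.
have r0 : 0 < r by rewrite sqrtr_gt0 divr_gt0// mulr_gt0.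
have r2 : r ^+ 2 = eta / (mu * n%:R).
  by rewrite sqr_sqrtr// divr_ge0 ?mulr_ge0 ?ltW.
have W0 : 0 <= W by rewrite divr_ge0 ?(ltW mu0)// mulr_ge0// (le_trans ler01).
have WE : W * mu = rho * s2 by rewrite /W divfK// gt_eqF.
have sW : s2 <= W * mu by rewrite WE ler_peMl.
have BE : B = 3 * (W * mu) * r by rewrite WE /B -/s2 -/rho -/r mulrA.
have B0 : 0 < B := lt_trans eps0 epsltB.
have hx1 : L2 P (iter_x e1 0) by rewrite e10; exact: L2_cst.
have fpsi1 w : psi (iter_x e1 0 w) \is a fin_num by rewrite e10.
have ipsi1 : intg P (fun w => fine (psi (iter_x e1 0 w))).
  by rewrite e10; exact: (intg_cst P (fine (psi x0))).
have [a1 [g1 [gE1 a10 a1S a1g]]] := svrg_convergence n0 mu0 cfi sfi muL scf psiNy cvx lsc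
  q0 q1 fstar xmin run1 (fun=> eta0) (fun=> etaL) (fun=> etamu) hx1 fpsi1 ipsi1.
set S := fine (F x0 - F xstar)%E.
have g10 : g1 0%N = S.
  apply: EFin_inj; rewrite -gE1 /expected_gap e10.
  have -> : (\int[P]_w (F (cst x0 w) - F xstar) = (F x0 - F xstar) * P setT)%E.
    exact: (integral_cst P measurableT (F x0 - F xstar)%E).
  rewrite (_ : P setT = 1%E) ?mule1; last exact: (probability_setT P).
  rewrite /S fineK// /F !objectiveE//.
pose D := Num.sqrt (5 / 3 * n%:R^-1 * eta * mu).
have D2 : D ^+ 2 = 5 / 3 * (mu * r) ^+ 2.
  rewrite sqr_sqrtr; last by rewrite !mulr_ge0 ?invr_ge0 ?ltW.
  by rewrite exprMn r2; field; rewrite !gt_eqF.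
have D0 : 0 < D by rewrite sqrtr_gt0 !mulr_gt0// invr_gt0.
(* If the initial gap is already at most [B], the phase stops at 0; otherwise [B < S], as the linear
   rate requires. *)
have phase1 : exists2 K : nat, first_reaches P F xstar e1 B K &
    (K = 0%N \/ B < S /\ K%:R <= D^-1 * ln (10 * S / B) + 1).
  have [SB|BS] := leP S B.
    have gB : g1 0%N <= B by rewrite g10.
    have [K K0 hK] := first_reaches_exists gE1 gB.
    by exists K => //; left; apply/eqP; rewrite -leqn0.
  have D1 : 0 < D <= 1.
    rewrite D0 -(expr_le1 (n := 2) isT (ltW D0)) sqr_sqrtr; last first.
      by rewrite !mulr_ge0 ?invr_ge0 ?ltW.
    exact: square_step_le1.
  have aS k : a1 k.+1 <= (1 - D) * a1 k + 4 / 5 * B * D.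
    apply: le_trans (a1S k) _; rewrite lerD2l BE.
    exact: noise_budget r2 D2.
  rewrite g10 in a10.
  have [k ak kD] := linear_rate D1 B0 BS a10 aS.
  have [j jk gj] := a1g _ _ ak.
  have [K Kj hK] := first_reaches_exists gE1 gj.
  exists K => //; right; split => //; apply: le_trans kD.
  by rewrite ler_nat (leq_trans Kj).
have [K1 reach1 HK1] := phase1; exists K1; split => // e2 e20 run2.
have sq1 := square_integrableP mu0 sfi psiNy cvx lsc fstar run1 (fun=> eta0) hx1 K1.
(* The restart begins at a random point, whose square integrability, finite [psi] and integrable
   [psi] are inherited from the first run. *)
have hx2 : L2 P (iter_x e2 0) by rewrite e20; have [] := sq1.
have fpsi2 w : psi (iter_x e2 0 w) \is a fin_num.
  by rewrite e20; exact: (psi_x_fin psiNy fstar run1 (fun=> eta0) fpsi1).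
have ipsi2 : intg P (fun w => fine (psi (iter_x e2 0 w))).
  rewrite e20; exact: (intg_psi_x n0 mu0 sfi muL scf psiNy cvx lsc q0 q1 fstar xmin run1
    (fun=> eta0) hx1 fpsi1 ipsi1).
have dec0 k : 0 < decreasing_step n mu LQ k.+1 by exact: decreasing_step_gt0.
have decL k : decreasing_step n mu LQ k.+1 <= (3 * LQ)^-1.
  by apply: le_trans etaL; rewrite /decreasing_step ge_min lexx.
have decmu k : decreasing_step n mu LQ k.+1 <= (15 * mu * n%:R)^-1.
  by apply: le_trans etamu; rewrite /decreasing_step ge_min lexx.
have [a2 [g2 [gE2 a20 a2S a2g]]] := svrg_convergence n0 mu0 cfi sfi muL scf psiNy cvx lsc
  q0 q1 fstar xmin run2 dec0 decL decmu hx2 fpsi2 ipsi2.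
have g20 : g2 0%N <= B.
  by have [h _] := reach1; move: h; rewrite -e20 gE2 lee_fin.
have a20' : a2 0%N <= 2 * (3 * (W * mu) * r).
  by rewrite -BE; apply: le_trans a20 _; rewrite ler_pM2l.
have rate2 := sublinear_rate n0 mu0 eta0 etamu s20 sW r0 r2 a20' a2S.
have X0 : 0 <= 10 * W / eps by rewrite divr_ge0 ?(ltW eps0)// mulr_ge0.
have /andP[t1 t2] := truncn_itv X0.
(* The decreasing rate is at most [eps] as soon as [k + 2 >= 10 W / eps]. *)
have ak2 : a2 (Num.truncn (10 * W / eps)).+1 <= eps.
  apply: le_trans (rate2 _) _; rewrite ler_pdivrMr ?ltr0n// [leRHS]mulrC -ler_pdivrMr//.
  apply: le_trans (ltW t2) _; rewrite ler_nat; exact: leq_trans (leqnSn _) (leqnSn _).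
have [j jk gj] := a2g _ _ ak2.
have [K2 K2j reach2] := first_reaches_exists gE2 gj.
exists K2; split => //.
have HK2 : K2%:R <= 10 * W / eps + 1.
  apply: (@le_trans _ _ (Num.truncn (10 * W / eps)).+1%:R); last by rewrite -natr1 lerD2r.
  by rewrite ler_nat (leq_trans K2j).
have [i1 E1] := evaluations_expectation n0 run1 K1.
have [i2 E2] := evaluations_expectation n0 run2 K2.
have -> : ('E_P[fun w => (gradient_evaluations e1 K1 w + gradient_evaluations e2 K2 w)%:R] =
    ((n%:R + 3 * K1%:R) + (n%:R + 3 * K2%:R))%:E)%E.
  rewrite unlock -E1 -E2 -(ExD i1 i2) (EFin_Ex (intgD i1 i2)).
  by apply: eq_integral => w _; rewrite natrD.
rewrite lee_fin.
have -> : rho * s2 / (mu * eps) = W / eps by rewrite /W; field; rewrite !gt_eqF.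
exact: evaluation_count n0 mu0 LQ0 erefl r0 r2 D2 D0 BE epsB W0 HK1 HK2.
Qed.
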